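(* A generalized Sasakian structure of a manifold $M$ is equivalent with a pair of classical, normal, almost contact metric structures $(F_\pm,Z_\pm,\xi_\pm,\gamma)$ (with the same metric $\gamma$), complemented by a pair of forms $\psi\in\Omega^2(M)$, $\kappa\in\Omega^1(M)$ that satisfy the conditions $$i(Z_\pm)(\psi+d\kappa)=0,\qquad(\psi+d\kappa)^c=-L_{Z_\pm}[L_{Z_\pm}(\psi+d\kappa)]^c,$$ $$(d\psi)^c=i(Z_\pm)\big[\xi_\pm\wedge d[L_{Z_\pm}(\psi+d\kappa)]^c\big],$$ and $$\Xi_\pm=d\xi_\pm\mp[L_{Z_\pm}(\psi+d\kappa)]^c .$$
   Context: An almost contact metric structure $(F,Z,\xi,\gamma)$ on $M$ consists of $F\in End(TM)$, a vector field $Z$, a $1$-form $\xi$ with $\xi(Z)=1$, $F(Z)=0$, $\xi\circ F=0$, $F^2=-Id+\xi\otimes Z$, and a Riemannian metric $\gamma$ with $\gamma(FX,FY)=\gamma(X,Y)-\xi(X)\xi(Y)$. It is normal if the almost complex structure $J=F+dt\otimes Z-\xi\otimes\frac{\partial}{\partial t}$ on $M\times\mathbb{R}$ ($t$ the coordinate on $\mathbb{R}$) is integrable. $\Xi_\pm(X,Y)=\gamma(F_\pm X,Y)$. For a $k$-form $\lambda$ on $M$, $\lambda^c(X_1,\dots,X_k)=\lambda(F_\pm X_1,\dots,F_\pm X_k)$, with $F_+$ in the formulas for the sign $+$ and $F_-$ in the formulas for the sign $-$; every formula with $\pm$ stands for two formulas. For a manifold $N$, $T^{big}N=TN\oplus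 T^*N$ has the metric $g((X,\alpha),(Y,\beta))=\frac12(\alpha(Y)+\beta(X))$ and the Courant bracket $[(X,\alpha),(Y,\beta)]=([X,Y],L_X\beta-L_Y\alpha+\frac12 d(\alpha(Y)-\beta(X)))$. A generalized complex structure is a $g$-skew-symmetric $\Phi\in End(T^{big}N)$ with $\Phi^2=-Id$ whose $\sqrt{-1}$-eigenbundle has sections closed under the Courant bracket. A generalized Riemannian metric on $N$ is a positive definite metric $G$ on $T^{big}N$ such that $\sharp_G$, defined by $2g(\sharp_G\mathcal{X},\mathcal{Y})=G(\mathcal{X},\mathcal{Y})$, satisfies $\sharp_G^2=Id$ and preserves $g$; it is equivalent to a pair $(\gamma,\psi)$ (Riemannian metric, $2$-form), such that the $(\pm1)$-eigenbundles of $\sharp_G$ are $V_\pm=\{(X,\flat_{\psi\pm\gamma}X)\}$, $\flat_\tau X=i(X)\tau$. $(N,G,\Phi)$ is generalized Kähler if $\Phi$ commutes with $\sharp_G$ and both $\Phi$ and $\sharp_G\circ\Phi$ are generalized complex structures. A generalized Sasakian manifold is a manifold $M$ with a generalized Riemannian metric given by a pair $(\gamma,\psi)$, endowed with a translation invariant ($L_{\partial/\partial t}\Phi=0$) generalized complex structure $\Phi$ of $M\times\mathbb{R}$ such that, for some $\kappa\in\Omega^1(M)$, $(M\times\mathbb{R},\tilde G,\Phi)$ is generalized Kähler, where $\tilde G$ is the generalized Riemannian metric of $M\times\mathbb{R}$ given by the pair $(\Gamma,\Psi)$ with $\Gamma=e^t(\gamma+dt^2)$, $\Psi=e^t(\psi+\kappa\wedge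 dt)$. The correspondence in the claim: with $V_\pm$ the eigenbundles of $\sharp_{\tilde G}$ and $\tau_\pm=pr_{T(M\times\mathbb{R})}|_{V_\pm}$, the structures $J_\pm=\tau_\pm\circ\Phi|_{V_\pm}\circ\tau_\pm^{-1}$ are $\Gamma$-compatible, translation invariant almost complex structures of $M\times\mathbb{R}$, and $J_\pm=F_\pm+dt\otimes Z_\pm-\xi_\pm\otimes\frac{\partial}{\partial t}$.
   Formalization: In the converse, ''translation invariant'' means J_± are translation invariant (the lift rescales covectors by e^s), since literal L_{∂/∂t}Φ=0 fails, e.g. for a Sasakian structure and its negative with ψ=κ=0; the direct part is proved for both notions. *)

(* Defs.v *)
From HB Require Import structures.
From mathcomp Require Import all_boot all_order all_algebra ring.
From mathcomp Require Import all_classical all_reals all_analysis.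

Set Implicit Arguments.
Unset Strict Implicit.
Unset Printing Implicit Defensive.

Import Order.TTheory GRing.Theory Num.Theory numFieldNormedType.Exports.

Local Open Scope classical_set_scope.
Local Open Scope ring_scope.

Section Ck.
Variable R : realType.

(* f is of class C^k on the open set U. *)
Fixpoint Ck n (k : nat) (U : set 'rV[R]_n) (f : 'rV[R]_n -> R) : Prop :=
  (forall x, U x -> {for x, continuous f}) /\
  if k is k'.+1 then
    forall v, (forall x, U x -> derivable f x v) /\ Ck k' U ('D_v f)
  else True.

Lemma Ck_ext n k (U : set 'rV[R]_n) f g : open U ->
  (forall x, U x -> f x = g x) -> Ck k U f -> Ck k U g.
Proof.
move=> oU; elim: k f g => [|k IH] f g fg [cf df].
all: have nfg x (Ux : U x) : \forall y \near x, f y = g y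
  by apply: filterS fg (open_nbhs_nbhs (conj oU Ux)).
all: have cg x : U x -> {for x, continuous g}
  by move=> Ux; rewrite /prop_for /continuous_at -fg//;
     exact: cvg_trans (near_eq_cvg (nfg _ Ux)) (cf _ Ux).
- by split.
- split=> // v; split.
  + by move=> x Ux; apply: (near_eq_derivable (nfg _ Ux)); case: (df v) => + _; exact.
  + apply: IH (df v).2 => x Ux; exact: near_eq_derive (nfg _ Ux).
Qed.

Lemma Ck_sub n k (U V : set 'rV[R]_n) f : V `<=` U -> Ck k U f -> Ck k V f.
Proof.
move=> VU; elim: k f => [|k IH] f [cf df]; split=> //.
- by move=> x /VU; exact: cf.
- by move=> x /VU; exact: cf.
- move=> v; split; last exact: IH (df v).2.
  by move=> x /VU; exact: (df v).1.
Qed.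

Lemma CkS n k (U : set 'rV[R]_n) f : Ck k.+1 U f -> Ck k U f.
Proof.
elim: k f => [|k IH] f [cf df]; split=> // v; split; first exact: (df v).1.
exact: IH (df v).2.
Qed.

Lemma Ck_cst n k (U : set 'rV[R]_n) (c : R) : Ck k U (cst c).
Proof.
elim: k c => [|k IH] c; split=> //; try by move=> x _; exact: cst_continuous.
move=> v; split; first by move=> x _; exact: derivable_cst.
suff -> : 'D_v (cst c : 'rV[R]_n -> R) = cst 0 by exact: IH.
by apply/funext => x; rewrite derive_cst.
Qed.

Lemma CkD n k (U : set 'rV[R]_n) f g : open U ->
  Ck k U f -> Ck k U g -> Ck k U (f \+ g).
Proof.
move=> oU; elim: k f g => [|k IH] f g [cf df] [cg dg]; split=> //;
  try by move=> x Ux; exact: (continuousD (cf _ Ux) (cg _ Ux)).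
move=> v; split.
  by move=> x Ux; apply: derivableD; [exact: (df v).1|exact: (dg v).1].
apply: (Ck_ext oU _ (IH _ _ (df v).2 (dg v).2)) => x Ux.
by rewrite /= deriveD//; [exact: (df v).1|exact: (dg v).1].
Qed.

Lemma CkM n k (U : set 'rV[R]_n) f g : open U ->
  Ck k U f -> Ck k U g -> Ck k U (f \* g).
Proof.
move=> oU; elim: k f g => [|k IH] f g Cf Cg.
  by split=> // x Ux; exact: (continuousM (Cf.1 _ Ux) (Cg.1 _ Ux)).
split; first by move=> x Ux; exact: (continuousM (Cf.1 _ Ux) (Cg.1 _ Ux)).
move=> v; have [dfv Cdf] := Cf.2 v; have [dgv Cdg] := Cg.2 v; split.
  by move=> x Ux; apply: derivableM; [exact: dfv|exact: dgv].
apply: (Ck_ext oU _ (CkD oU (IH _ _ (CkS Cf) Cdg) (IH _ _ (CkS Cg) Cdf))).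
by move=> x Ux; rewrite /= deriveM//; [exact: dfv|exact: dgv].
Qed.

Lemma derive_affine n m (A L : 'rV[R]_n -> 'rV[R]_m) (f : 'rV[R]_m -> R) v :
  (forall h v x, A (h *: v + x) = h *: L v + A x) ->
  'D_v (f \o A) = ('D_(L v) f) \o A /\
  (forall x, derivable f (A x) (L v) -> derivable (f \o A) x v).
Proof.
move=> AL; split.
  apply/funext => x; rewrite /derive /=; set F := (X in lim (X @ _) = _).
  set G := (X in _ = lim (X @ _)); suff -> : F = G by [].
  by apply/funext => h; rewrite /F /G /= AL.
move=> x; rewrite /derivable /=; set F := (X in cvg (X @ _) -> _).
set G := (X in _ -> cvg (X @ _)); suff -> : G = F by [].
by apply/funext => h; rewrite /F /G /= AL.
Qed.

Lemma Ck_affine n m k (A L : 'rV[R]_n -> 'rV[R]_m) U V (f : 'rV[R]_m -> R) :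
  (forall h v x, A (h *: v + x) = h *: L v + A x) -> continuous A ->
  (forall x, V x -> U (A x)) -> Ck k U f -> Ck k V (f \o A).
Proof.
move=> AL cA VU; elim: k f => [|k IH] f Cf; split=> //;
  try by move=> x Vx; apply: continuous_comp; [exact: cA|exact: (Cf.1 _ (VU _ Vx))].
move=> v; have [dE dA] := derive_affine f v AL; have [df Cdf] := Cf.2 (L v).
split; first by move=> x Vx; apply: dA; exact: df (VU _ Vx).
by rewrite dE; exact: IH.
Qed.

Lemma derive_coord n (i : 'I_n) v :
  'D_v (fun x : 'rV[R]_n => x 0 i) = cst (v 0 i) /\
  (forall x : 'rV[R]_n, derivable (fun x : 'rV[R]_n => x 0 i) x v).
Proof.
suff H x : is_derive x v (fun x : 'rV[R]_n => x 0 i) (v 0 i).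
  split; first by apply/funext => x; have := H x => -[_ ->].
  by move=> x; have := H x => -[].
have K : (fun h : R => h^-1 *: ((h *: v + x) 0 i - x 0 i)) @ 0^' --> v 0 i.
  apply: (@cvg_trans _ ((cst (v 0 i) : R -> R) @ 0^')); last exact: cvg_cst.
  apply: near_eq_cvg; near=> h.
  rewrite !mxE addrK /= /GRing.scale /= mulrA mulVf ?mul1r//.
  by near: h; exact: nbhs_dnbhs_neq.
apply: DeriveDef; first by apply/cvg_ex; exists (v 0 i).
exact: cvg_lim K.
Unshelve. all: by end_near. Qed.

Lemma Ck_coord n k (U : set 'rV[R]_n) i : Ck k U (fun x => x 0 i).
Proof.
have c (x : 'rV[R]_n) : {for x, continuous (fun x : 'rV[R]_n => x 0 i)}.
  exact: coord_continuous.
case: k => [|k]; split=> // v; have [-> d] := derive_coord i v.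
by split; [move=> x _; exact: d|exact: Ck_cst].
Qed.

End Ck.

Section Charts.
Variable R : realType.

(* cinv is the inverse of cmap on cimg; its values outside are irrelevant. *)
Record chart (M : topologicalType) n := Chart {
  cdom : set M;
  cmap : M -> 'rV[R]_n;
  cinv : 'rV[R]_n -> M
}.

Definition cimg (M : topologicalType) n (c : chart M n) := cmap c @` cdom c.

Definition chart_axiom (M : topologicalType) n (c : chart M n) : Prop :=
  [/\ open (cdom c) /\ open (cimg c),
      forall p, cdom c p -> cinv c (cmap c p) = p,
      forall p, cdom c p -> {for p, continuous (cmap c)} &
      forall x, cimg c x -> {for x, continuous (cinv c)}].

Definition compatible (M : topologicalType) n (c c' : chart M n) : Prop :=
  forall k i, Ck k (cmap c @` (cdom c `&` cdom c')) (fun x => cmap c' (cinv c x) 0 i).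

Record manifold n := Manifold {
  points :> topologicalType;
  atlas : set (chart points n);
  points_hausdorff : hausdorff_space points;
  points_second_countable : @second_countable points;
  atlas_chart : forall c, atlas c -> chart_axiom c;
  atlas_cover : forall p, exists2 c, atlas c & cdom c p;
  atlas_compatible : forall c c', atlas c -> atlas c' -> compatible c c'
}.

Arguments atlas {n} m.

Section Product.

Lemma cvg_mx (T : topologicalType) m n (f : T -> 'M[R]_(m, n)) x :
  (forall i j, {for x, continuous (fun y => f y i j)}) -> {for x, continuous f}.
Proof.
move=> cf A [B xB BA].
have H : \forall y \near x, forall ij, B ij.1 ij.2 (f y ij.1 ij.2).
  by apply: filter_forall => -[i j]; exact: (cf i j _ (xB i j)).
by apply: filterS H => y H; apply: BA => i j; exact: (H (i, j)).
Qed.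

Lemma eq_cont (T U : topologicalType) (f g : T -> U) x :
  f =1 g -> {for x, continuous g} -> {for x, continuous f}.
Proof. by move=> /funext ->. Qed.

Lemma lsubmx_cont n m : continuous (@lsubmx R 1 n m).
Proof.
move=> x; apply: cvg_mx => i j.
apply: (@eq_cont _ _ _ (fun y : 'rV[R]_(n + m) => y i (lshift m j))).
  by move=> y; rewrite mxE.
exact: coord_continuous.
Qed.

Lemma cvg_row_mx (T : topologicalType) n m (f : T -> 'rV[R]_n)
    (g : T -> 'rV[R]_m) x :
  {for x, continuous f} -> {for x, continuous g} ->
  {for x, continuous (fun y => row_mx (f y) (g y))}.
Proof.
move=> cf cg; apply: cvg_mx => i j; rewrite -(fintype.splitK j).
case: (fintype.split j) => k /=.
  apply: (@eq_cont _ _ _ ((fun z : 'rV[R]_n => z i k) \o f)).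
    by move=> y; rewrite row_mxEl.
  by apply: (continuous_comp cf); exact: coord_continuous.
apply: (@eq_cont _ _ _ ((fun z : 'rV[R]_m => z i k) \o g)).
  by move=> y; rewrite row_mxEr.
by apply: (continuous_comp cg); exact: coord_continuous.
Qed.

Lemma hausdorff_prodR (M : topologicalType) :
  hausdorff_space M -> hausdorff_space (M * R)%type.
Proof.
move=> hM p q pq.
have fst_cl : cluster (nbhs p.1) q.1.
  move=> A B pA qB; have [||y [Ay By]] := pq (fst @^-1` A) (fst @^-1` B).
  - exact: (@cvg_fst _ _ _ (nbhs p.2) _ _ pA).
  - exact: (@cvg_fst _ _ _ (nbhs q.2) _ _ qB).
  by exists y.1.
have snd_cl : cluster (nbhs p.2) q.2.
  move=> A B pA qB; have [||y [Ay By]] := pq (snd @^-1` A) (snd @^-1` B).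
  - exact: (@cvg_snd _ _ (nbhs p.1) _ _ _ pA).
  - exact: (@cvg_snd _ _ (nbhs q.1) _ _ _ qB).
  by exists y.2.
by rewrite [p]surjective_pairing [q]surjective_pairing (hM _ _ fst_cl)
  (@Rhausdorff R _ _ snd_cl).
Qed.

Lemma second_countable_prodR (M : topologicalType) :
  @second_countable M -> @second_countable (M * R)%type.
Proof.
move=> [B cB [oB bB]].
pose I (ab : rat * rat) : set R := [set` `]ratr ab.1, ratr ab.2[].
exists ((fun UV : set M * (rat * rat) => UV.1 `*` I UV.2) @` (B `*` setT)).
  apply: sub_countable (card_image_le _ _) _.
  by apply: countableX => //; exact: countableP.
split.
  move=> _ [[U ab] [/= BU _] <-]; rewrite openE => -[x t] [/= Ux It].
  exists (U, I ab) => //; split; first by exact: (open_nbhs_nbhs (conj (oB _ BU) Ux)).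
  by apply: open_nbhs_nbhs; split=> //; exact: interval_open.
move=> [x t] A [[U V] [/= xU tV] UVA].
have [W [BW Wx] WU] := bB x _ xU.
have /nbhs_ballP[e /= e0 eV] := tV.
have [a /andP[ae at_]] := @rat_in_itvoo R (t - e) t (ltac:(by rewrite ltrBlDr ltrDl)).
have [b /andP[tb be]] := @rat_in_itvoo R t (t + e) (ltac:(by rewrite ltrDl)).
exists (W `*` I (a, b)).
  split; first by exists (W, (a, b)).
  by split=> //=; rewrite /I /= in_itv /=; apply/andP; split.
move=> [y s] [/= Wy]; rewrite /I /= in_itv /= => /andP[as_ sb].
apply: UVA; split=> /=; first exact: WU.
apply: eV; rewrite /ball /= ltr_distlC.
by rewrite (lt_trans ae)//= (lt_trans sb).
Qed.

Variables (n : nat) (M : topologicalType).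

Definition cyl_chart (c : chart M n) : chart (M * R)%type (n + 1) := {|
  cdom := [set q | cdom c q.1];
  cmap := fun q => row_mx (cmap c q.1) (q.2%:M : 'M[R]_1);
  cinv := fun x => (cinv c (lsubmx x), rsubmx x 0 0) |}.

Lemma cyl_chart_img c (A : set M) :
  cmap (cyl_chart c) @` [set q | A q.1] = [set x | (cmap c @` A) (lsubmx x)].
Proof.
apply/seteqP; split=> [_ [[p t] /= Ap <-]|x [p Ap px]] /=.
  by rewrite row_mxKl; exists p.
exists (p, rsubmx x 0 0) => //=; rewrite px -[RHS]hsubmxK; congr row_mx.
by rewrite -mx11_scalar.
Qed.

Lemma cyl_chart_axiom c : chart_axiom c -> chart_axiom (cyl_chart c).
Proof.
move=> [[oD oI] cK cc ci]; split.
- split; first by apply: open_comp => // q _; exact: cvg_fst.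
  rewrite /cimg (cyl_chart_img _ (cdom c)).
  by apply: open_comp => // x _; exact: lsubmx_cont.
- by move=> [p t] /= cp; rewrite row_mxKl row_mxKr cK// mxE eqxx.
- move=> [p t] /= cp; apply: cvg_row_mx.
    by apply: (@continuous_comp _ _ _ fst (cmap c)); [exact: cvg_fst|exact: cc].
  apply: cvg_mx => i j; apply: (@eq_cont _ _ _ snd); last exact: cvg_snd.
  by move=> y; rewrite !ord1 mxE eqxx mulr1n.
- move=> x; rewrite /cimg (cyl_chart_img _ (cdom c)) => ix.
  have c1 : {for x, continuous (fun y : 'rV[R]_(n + 1) => cinv c (lsubmx y))}.
    by apply: (continuous_comp (@lsubmx_cont n 1 x)); exact: ci.
  have c2 : {for x, continuous (fun y : 'rV[R]_(n + 1) => rsubmx y 0 0)}.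
    apply: (@eq_cont _ _ _ (fun y : 'rV[R]_(n + 1) => y 0 (rshift n 0))).
      by move=> y; rewrite mxE.
    exact: coord_continuous.
  move=> A [[B C] [/= pB pC] BCA].
  apply: (@filterS2 _ (nbhs x) _ _ _ _ _ (c1 _ pB) (c2 _ pC)).
  by move=> y By Cy; exact: (BCA (_, _)).
Qed.

Lemma lsubmx_affine h (v x : 'rV[R]_(n + 1)) :
  lsubmx (h *: v + x) = h *: lsubmx v + lsubmx x.
Proof. by rewrite linearP. Qed.

Lemma cyl_compatible c c' : compatible c c' -> compatible (cyl_chart c) (cyl_chart c').
Proof.
move=> cc' k i; rewrite (cyl_chart_img _ (cdom c `&` cdom c')).
rewrite -(fintype.splitK i); case: (fintype.split i) => j /=.
  set F := (X in Ck _ _ X).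
  suff -> : F = (fun x => cmap c' (cinv c x) 0 j) \o @lsubmx R 1 n 1.
    exact: (Ck_affine lsubmx_affine (@lsubmx_cont _ _) _ (cc' k j)).
  by apply/funext => x; rewrite /F /= row_mxEl.
set F := (X in Ck _ _ X).
suff -> : F = fun x => x 0 (rshift n 0) by exact: Ck_coord.
by apply/funext => x; rewrite /F /= row_mxEr !ord1 !mxE eqxx mulr1n.
Qed.

End Product.

Section Cylinder.
Variables (n : nat) (M : manifold n).

Definition cyl_atlas : set (chart (M * R)%type (n + 1)) :=
  @cyl_chart n M @` atlas M.

Lemma cyl_atlas_chart c : cyl_atlas c -> chart_axiom c.
Proof. by move=> [c0 Ac <-]; apply: cyl_chart_axiom; exact: atlas_chart. Qed.

Lemma cyl_atlas_cover (q : M * R) : exists2 c, cyl_atlas c & cdom c q.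
Proof.
case: q => p t; have [c Ac cp] := atlas_cover p.
by exists (cyl_chart c) => //; exists c.
Qed.

Lemma cyl_atlas_compatible c c' : cyl_atlas c -> cyl_atlas c' -> compatible c c'.
Proof.
move=> [c0 Ac <-] [c1 Ac' <-].
by apply: cyl_compatible; exact: atlas_compatible.
Qed.

(* M * R with the product charts. *)
Definition cylinder : manifold (n + 1) :=
  Manifold (hausdorff_prodR (@points_hausdorff _ M))
    (second_countable_prodR (@points_second_countable _ M))
    cyl_atlas_chart cyl_atlas_cover cyl_atlas_compatible.

End Cylinder.
End Charts.

Arguments atlas {R n} m.
Arguments chart {R} M n.


Section Calculus.
Variables (R : realType) (n : nat) (M : manifold R n).

Definition smooth : {pred M -> R} :=
  fun f => `[< forall c k, atlas M c -> Ck k (cimg c) (f \o cinv c) >].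

Lemma smooth_subring : subring_closed smooth.
Proof.
have oc c : atlas M c -> open (cimg c) by move=> /atlas_chart[[]].
split.
- by apply/asboolP => c k Ac; exact: Ck_cst.
- move=> f g /asboolP sf /asboolP sg; apply/asboolP => c k Ac.
  have H := CkM (oc c Ac) (Ck_cst k _ (-1)) (sg c k Ac).
  apply: Ck_ext (CkD (oc c Ac) (sf c k Ac) H); first exact: oc.
  by move=> x _ /=; rewrite mulN1r.
- move=> f g /asboolP sf /asboolP sg; apply/asboolP => c k Ac.
  exact: CkM (oc c Ac) (sf c k Ac) (sg c k Ac).
Qed.

HB.instance Definition _ :=
  GRing.isSubringClosed.Build (M -> R) smooth smooth_subring.

Record Cinf := MkCinf { Cinf_val :> M -> R; _ : Cinf_val \in smooth }.

HB.instance Definition _ := [isSub for Cinf_val].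
HB.instance Definition _ := [Choice of Cinf by <:].
HB.instance Definition _ :=
  GRing.SubChoice_isSubComPzRing.Build _ _ Cinf (subringClosedP _).

Lemma smooth_cst (a : R) : (cst a : M -> R) \in smooth.
Proof. by apply/asboolP => c k Ac; exact: Ck_cst. Qed.

Definition Cinf_cst a : Cinf := MkCinf (smooth_cst a).

Lemma Cinf_cst1 : Cinf_cst 1 = 1. Proof. exact: val_inj. Qed.

(* Vector fields are the R-linear derivations of the ring of smooth functions,
   and tensor fields are maps on vector fields that are multilinear over that
   ring; the scalars of the modules vfield and form1 below are the smooth
   functions. *)
Definition derivation : {pred (Cinf -> Cinf^o)} := fun D => `[<
  (forall a f g, D (Cinf_cst a * f + g) = Cinf_cst a * D f + D g) /\
  (forall f g, D (f * g) = f * D g + D f * g) >].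

Lemma derivation_submod : submod_closed derivation.
Proof.
split.
  by apply/asboolP; split=> *; rewrite /GRing.zero /= !(mulr0, mul0r) addr0.
move=> h D D' /asboolP[DL DM] /asboolP[DL' DM']; apply/asboolP.
have E f : (h *: D + D') f = h * D f + D' f by [].
by split=> [a f g|f g]; rewrite !E ?DL ?DL' ?DM ?DM'; ring.
Qed.

HB.instance Definition _ :=
  GRing.isSubmodClosed.Build _ (Cinf -> Cinf^o) derivation derivation_submod.

Record vfield := MkVfield { vf_val :> Cinf -> (Cinf^o)%type; _ : vf_val \in derivation }.

HB.instance Definition _ := [isSub for vf_val].
HB.instance Definition _ := [Choice of vfield by <:].
HB.instance Definition _ := [SubChoice_isSubLmodule of vfield by <:].

Lemma vf_lin (X : vfield) a f g : X (Cinf_cst a * f + g) = Cinf_cst a * X f + X g.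
Proof. by case: X => X /= /asboolP[]. Qed.

Lemma vf_mul (X : vfield) f g : X (f * g) = f * X g + X f * g.
Proof. by case: X => X /= /asboolP[]. Qed.

Lemma vfD (X : vfield) f g : X (f + g) = X f + X g.
Proof. by have := vf_lin X 1 f g; rewrite Cinf_cst1 !mul1r. Qed.

Lemma bracket_subproof (X Y : vfield) : (fun f => X (Y f) - Y (X f)) \in derivation.
Proof.
by apply/asboolP; split=> [a f g|f g]; rewrite !(vf_lin, vf_mul) ?vfD ?vf_mul; ring.
Qed.

Definition bracket (X Y : vfield) : vfield := MkVfield (bracket_subproof X Y).

Definition one_form : {pred (vfield -> Cinf^o)} := fun w => `[< linear w >].

Lemma one_form_submod : submod_closed one_form.
Proof.
split.
  by apply/asboolP => h X Y; rewrite /GRing.zero /= scaler0 addr0.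
move=> h w w' /asboolP wL /asboolP wL'; apply/asboolP => k X Y.
have E Z : (h *: w + w') Z = h * w Z + w' Z by [].
rewrite !E wL wL' -![k *: (_ : Cinf^o)]/(k * (_ : Cinf)); ring.
Qed.

HB.instance Definition _ :=
  GRing.isSubmodClosed.Build _ (vfield -> Cinf^o) one_form one_form_submod.

Record form1 := MkForm1 { form1_val :> vfield -> (Cinf^o)%type; _ : form1_val \in one_form }.

HB.instance Definition _ := [isSub for form1_val].
HB.instance Definition _ := [Choice of form1 by <:].
HB.instance Definition _ := [SubChoice_isSubLmodule of form1 by <:].

Lemma form1_lin (w : form1) h X Y : w (h *: X + Y) = h * w X + w Y.
Proof. by case: w => w /= /asboolP; exact. Qed.

Lemma dfun_subproof (f : Cinf) : (fun X : vfield => X f) \in one_form.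
Proof. by apply/asboolP. Qed.

Definition dfun f : form1 := MkForm1 (dfun_subproof f).

Lemma lie1_subproof (X : vfield) (w : form1) :
  (fun Y => X (w Y) - w (bracket X Y)) \in one_form.
Proof.
apply/asboolP => h Y Z.
have E : bracket X (h *: Y + Z) = h *: bracket X Y + ((X h : Cinf) *: Y + bracket X Z).
  apply/val_inj/funext => f.
  have EE (g : Cinf) (V W : vfield) : (g *: V + W) f = g * V f + W f by [].
  have EB (V W : vfield) : bracket V W f = V (W f) - W (V f) by [].
  change (bracket X (h *: Y + Z) f =
    (h *: bracket X Y + ((X h : Cinf) *: Y + bracket X Z)) f).
  rewrite !EB !EE vfD vf_mul.
  rewrite !EB -[_ (X f)]/(h * Y (X f) + Z (X f)); ring.
rewrite E !form1_lin vfD vf_mul -![h *: (_ : Cinf^o)]/(h * (_ : Cinf)); ring.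
Qed.

Definition lie1 X w : form1 := MkForm1 (lie1_subproof X w).

End Calculus.

Arguments smooth {R n} M.
Arguments Cinf {R n} M.
Arguments Cinf_cst {R n} M a.
Arguments derivation {R n} M.
Arguments vfield {R n} M.
Arguments one_form {R n} M.
Arguments form1 {R n} M.


Section Cylinder_calculus.
Variables (R : realType) (n : nat) (M : manifold R n).
Notation N := (cylinder M).

Lemma smooth_pull (f : Cinf M) : (fun q : N => f q.1) \in smooth N.
Proof.
apply/asboolP => _ k [c Ac <-]; rewrite /cimg (cyl_chart_img _ (cdom c)).
case: f => f /= /asboolP sf.
exact: (Ck_affine (@lsubmx_affine R n) (@lsubmx_cont _ _ _) _ (sf c k Ac)).
Qed.

Definition pull f : Cinf N := MkCinf (smooth_pull f).

Lemma smooth_slice (f : Cinf N) (t : R) : (fun p : M => f (p, t)) \in smooth M.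
Proof.
apply/asboolP => c k Ac; case: f => f /= /asboolP sf.
have := sf (cyl_chart c) k (ex_intro2 _ _ c Ac erefl).
rewrite /cimg (cyl_chart_img _ (cdom c)) => Cf.
pose A (x : 'rV[R]_n) := row_mx x (t%:M : 'M[R]_1).
pose L (x : 'rV[R]_n) := row_mx x (0 : 'M[R]_1).
have AL h v x : A (h *: v + x) = h *: L v + A x.
  by rewrite /A /L scale_row_mx add_row_mx scaler0 add0r.
have cA : continuous A.
  move=> x.
  by apply: (@cvg_row_mx _ _ _ _ id (fun=> t%:M) x);
    [exact: cvg_id|exact: cst_continuous].
have Ac' x : cimg c x -> (cmap c @` cdom c) (lsubmx (A x)) by rewrite /A row_mxKl.
have := Ck_affine AL cA Ac' Cf; set F := (X in Ck _ _ X -> _).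
suff -> : F = (fun p : M => f (p, t)) \o cinv c by [].
by apply/funext => x; rewrite /F /= /A row_mxKl row_mxKr mxE eqxx mulr1n.
Qed.

Definition slice t f : Cinf M := MkCinf (smooth_slice f t).

Lemma smooth_time : (fun q : N => q.2) \in smooth N.
Proof.
apply/asboolP => _ k [c Ac <-].
have -> : (fun q : N => q.2) \o cinv (cyl_chart c) = (fun x => x 0 (rshift n 0)).
  by apply/funext => x /=; rewrite mxE.
exact: Ck_coord.
Qed.

Definition time : Cinf N := MkCinf smooth_time.

Lemma derive_time (f : N -> R) (c : chart M n) (x : 'rV[R]_(n + 1)) :
  let e : 'rV[R]_(n + 1) := row_mx 0 1%:M in
  ('D_1 (fun s : R => f (cinv c (lsubmx x), s)) (rsubmx x 0 0) =
     'D_e (f \o cinv (cyl_chart c)) x) /\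
  (derivable (f \o cinv (cyl_chart c)) x e ->
     derivable (fun s : R => f (cinv c (lsubmx x), s)) (rsubmx x 0 0) 1).
Proof.
move=> e; rewrite /derive /derivable.
set F := (X in lim (X @ _) = _); set G := (X in _ = lim (X @ _)).
suff FG : F = G by split; rewrite -?/F -?/G FG.
apply/funext => h; rewrite /F /G /=; congr (_ *: (f (cinv c _, _) - _)).
  by rewrite linearP /= row_mxKl scaler0 add0r.
by rewrite linearP /= row_mxKr !mxE eqxx mulr1n.
Qed.

(* The derivative of f along R. *)
Definition d_time (f : N -> R) (q : N) : R := 'D_1 (fun s : R => f (q.1, s)) q.2.

Lemma d_timeE (f : N -> R) (c : chart M n) x :
  d_time f (cinv (cyl_chart c) x) =
  'D_(row_mx 0 1%:M : 'rV[R]_(n + 1)) (f \o cinv (cyl_chart c)) x.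
Proof. exact: (derive_time f c x).1. Qed.

Lemma derivable_time (f : Cinf N) (q : N) : derivable (fun s : R => f (q.1, s)) q.2 1.
Proof.
have [c Ac cq] := @atlas_cover _ _ M q.1.
have [_ cK _ _] := cyl_chart_axiom (atlas_chart Ac).
rewrite -(cK q cq); apply: (derive_time f c _).2.
case: f => f /= /asboolP /(_ (cyl_chart c) 1%N (ex_intro2 _ _ c Ac erefl)).
by move=> [_ /(_ (row_mx 0 1%:M)) [+ _]]; apply; exists q.
Qed.

Lemma smooth_d_time (f : Cinf N) : d_time f \in smooth N.
Proof.
apply/asboolP => _ k [c Ac <-].
have -> : d_time f \o cinv (cyl_chart c) =
    'D_(row_mx 0 1%:M : 'rV[R]_(n + 1)) (f \o cinv (cyl_chart c)).
  by apply/funext => x; exact: d_timeE.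
case: f => f /= /asboolP /(_ (cyl_chart c) k.+1 (ex_intro2 _ _ c Ac erefl)).
by move=> [_ /(_ (row_mx 0 1%:M)) []].
Qed.

Lemma d_time_subproof : (fun f => MkCinf (smooth_d_time f)) \in derivation N.
Proof.
apply/asboolP; split=> [a f g|f g]; apply/val_inj/funext => q /=.
  have df := @derivable_time f q; have dg := @derivable_time g q.
  have E : (fun s : R => (Cinf_cst N a * f + g) (q.1, s)) =
      (a *: (fun s : R => f (q.1, s))) + (fun s : R => g (q.1, s)) by [].
  rewrite /d_time E deriveD//; last exact: derivableZ.
  by rewrite deriveZ.
have df := @derivable_time f q; have dg := @derivable_time g q.
have E : (fun s : R => (f * g) (q.1, s)) =
    (fun s : R => f (q.1, s)) * (fun s : R => g (q.1, s)) by [].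
rewrite /d_time E deriveM//; case: q {df dg E} => p t.
change (f (p, t) * d_time g (p, t) + g (p, t) * d_time f (p, t) =
  f (p, t) * d_time g (p, t) + d_time f (p, t) * g (p, t)).
by congr (_ + _); rewrite mulrC.
Qed.

Definition ddt : vfield N := MkVfield d_time_subproof.

Lemma hpart_subproof (W : vfield N) (t : R) :
  (fun f => slice t (W (pull f))) \in derivation M.
Proof.
apply/asboolP; split=> [a f g|f g].
  have -> : pull (Cinf_cst M a * f + g) = Cinf_cst N a * pull f + pull g by exact: val_inj.
  by rewrite vf_lin; exact: val_inj.
have -> : pull (f * g) = pull f * pull g by exact: val_inj.
by rewrite vf_mul; exact: val_inj.
Qed.

(* The image of W at the points (p, t), t fixed, under the projection to M. *)
Definition hpart (W : vfield N) t : vfield M := MkVfield (hpart_subproof W t).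

End Cylinder_calculus.


Section Tensors.
Variables (R : realType) (n : nat) (M : manifold R n).
Implicit Types (X Y V W Z : vfield M) (w : form1 M).

Definition tensor2 := vfield M -> vfield M -> Cinf M.
Definition tensor3 := vfield M -> vfield M -> vfield M -> Cinf M.

Definition form2 (l : tensor2) : Prop :=
  (forall h X Y V, l (h *: X + Y) V = h * l X V + l Y V) /\
  (forall X Y, l X Y = - l Y X).

Definition riemannian (g : tensor2) : Prop :=
  [/\ forall h X Y V, g (h *: X + Y) V = h * g X V + g Y V,
      forall X Y, g X Y = g Y X,
      forall X (p : M), 0 <= g X X p &
      forall X (p : M), g X X p = 0 -> forall f : Cinf M, X f p = 0].

(* Conventions without factors 1/2, and (u /\ v)(X, Y) = u X v Y - u Y v X. *)
Definition d1 w : tensor2 := fun X Y => X (w Y) - Y (w X) - w (bracket X Y).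

Definition d2 (l : tensor2) : tensor3 := fun X Y V =>
  X (l Y V) - Y (l X V) + V (l X Y)
  - l (bracket X Y) V + l (bracket X V) Y - l (bracket Y V) X.

Definition lie2 Z (l : tensor2) : tensor2 := fun X Y =>
  Z (l X Y) - l (bracket Z X) Y - l X (bracket Z Y).

Definition wedge13 w (l : tensor3) X Y V W : Cinf M :=
  w X * l Y V W - w Y * l X V W + w V * l X Y W - w W * l X Y V.

Definition c2 (F : vfield M -> vfield M) (l : tensor2) : tensor2 :=
  fun X Y => l (F X) (F Y).

Definition c3 (F : vfield M -> vfield M) (l : tensor3) : tensor3 :=
  fun X Y V => l (F X) (F Y) (F V).

Definition integrable (J : vfield M -> vfield M) : Prop := forall X Y,
  bracket (J X) (J Y) - J (bracket (J X) Y) - J (bracket X (J Y))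
    - bracket X Y = 0.

End Tensors.

Section Generalized.
Variables (R : realType) (n : nat) (N : manifold R n).

Definition tbig := (vfield N * form1 N)%type.
Implicit Types (x y : tbig) (Phi S : tbig -> tbig).

Definition pairing x y : Cinf N := Cinf_cst N 2^-1 * (x.2 y.1 + y.2 x.1).

Definition courant x y : tbig :=
  (bracket x.1 y.1,
   lie1 x.1 y.2 - lie1 y.1 x.2
     + Cinf_cst N 2^-1 *: dfun (x.2 y.1 - y.2 x.1 : Cinf N)).

(* A pair u : tbig * tbig stands for the section u.1 + sqrt(-1) u.2 of the
   complexification, to which the bracket is extended bilinearly. *)
Definition ccourant (u v : tbig * tbig) : tbig * tbig :=
  (courant u.1 v.1 - courant u.2 v.2, courant u.1 v.2 + courant u.2 v.1).

Definition ieigen Phi (u : tbig * tbig) : Prop :=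
  Phi u.1 = - u.2 /\ Phi u.2 = u.1.

Definition generalized_complex Phi : Prop :=
  [/\ linear Phi,
      forall x y, pairing (Phi x) y = - pairing x (Phi y),
      forall x, Phi (Phi x) = - x &
      forall u v, ieigen Phi u -> ieigen Phi v -> ieigen Phi (ccourant u v)].

(* S is the endomorphism sharp_G. *)
Definition generalized_metric (G : tbig -> tbig -> Cinf N) S : Prop :=
  [/\ [/\ forall h x y z, G (h *: x + y) z = h * G x z + G y z,
          forall x y, G x y = G y x,
          forall x (q : N), 0 <= G x x q &
          forall x (q : N), G x x q = 0 ->
            (forall f : Cinf N, x.1 f q = 0) /\
            (forall Y : vfield N, x.2 Y q = 0)],
      linear S,
      forall x y, Cinf_cst N 2 * pairing (S x) y = G x y,
      forall x, S (S x) = x &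
      forall x y, pairing (S x) (S y) = pairing x y].

(* Signs are booleans: + is false, - is true.  This is V_+ for b = false and V_- for b = true. *)
Definition Vpm (Gam Psi : vfield N -> vfield N -> N -> R) (b : bool) x : Prop :=
  forall (Y : vfield N) (q : N),
    x.2 Y q = Psi x.1 Y q + (-1) ^+ b * Gam x.1 Y q.

Definition given_by S (Gam Psi : vfield N -> vfield N -> N -> R) : Prop :=
  forall (b : bool) x, S x = (-1) ^+ b *: x <-> Vpm Gam Psi b x.

Definition generalized_kahler S Phi : Prop :=
  [/\ forall x, Phi (S x) = S (Phi x),
      generalized_complex Phi & generalized_complex (S \o Phi)].

End Generalized.

Section Sasakian.
Variables (R : realType) (n : nat) (M : manifold R n).
Notation N := (cylinder M).
Implicit Types (g psi : tensor2 M) (kappa : form1 M) (Phi : tbig N -> tbig N).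

(* Gamma = e^t (g + dt^2) and Psi = e^t (psi + kappa /\ dt).  The value of a
   pulled back tensor at (p, t) is computed with the projections hpart _ t. *)
Definition cone_metric g (W W' : vfield N) (q : N) : R :=
  expR q.2 * (g (hpart W q.2) (hpart W' q.2) q.1 + W (time M) q * W' (time M) q).

Definition cone_form psi kappa (W W' : vfield N) (q : N) : R :=
  expR q.2 * (psi (hpart W q.2) (hpart W' q.2) q.1
    + (kappa (hpart W q.2) q.1 * W' (time M) q
       - W (time M) q * kappa (hpart W' q.2) q.1)).

(* For w = 0 this is the Lie derivative with respect to d/dt, which is the
   infinitesimal form of the natural lift (X, a) |-> (s_* X, s_* a) of the
   translations s of the cylinder.  The translation by s multiplies Gamma and
   Psi by e^s, hence it is not the natural lift but (X, a) |-> (s_* X, e^s s_* a)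
   that preserves V_+ and V_- (and the metric g up to a constant); the case
   w = 1 is the infinitesimal form of the latter.  On a generalized Kaehler
   structure with the metric cone_metric, cone_form, invariance of Phi for
   w = 1 means that tau_b o Phi o tau_b^-1 is translation invariant for both
   signs, and invariance for w = 0 means that, moreover, these two complex
   structures coincide. *)
Definition lie_time (w : R) (x : tbig N) : tbig N :=
  (bracket (ddt M) x.1, lie1 (ddt M) x.2 - Cinf_cst N w *: x.2).

Definition translation_invariant w Phi : Prop :=
  forall x, Phi (lie_time w x) = lie_time w (Phi x).

Definition generalized_sasakian w g psi kappa Phi : Prop :=
  translation_invariant w Phi /\
  exists G S, [/\ generalized_metric G S,
    given_by S (cone_metric g) (cone_form psi kappa) & generalized_kahler S Phi].

Record contact_triple := ContactTriple {
  tF : vfield M -> vfield M;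
  tZ : vfield M;
  txi : form1 M
}.

Definition almost_contact_metric g (A : contact_triple) : Prop :=
  [/\ linear (tF A),
      txi A (tZ A) = 1 /\ tF A (tZ A) = 0,
      forall X, txi A (tF A X) = 0,
      forall X, tF A (tF A X) = - X + (txi A X : Cinf M) *: tZ A &
      forall X Y, g (tF A X) (tF A Y) = g X Y - txi A X * txi A Y].

(* W' is the image of W under F + dt (x) Z - xi (x) d/dt. *)
Definition cone_image (A : contact_triple) (W W' : vfield N) : Prop :=
  forall (f : Cinf N) (p : M) (t : R),
    W' f (p, t) = tF A (hpart W t) (slice t f) p
      + W (time M) (p, t) * tZ A (slice t f) p
      - txi A (hpart W t) p * ddt M f (p, t).

Definition normal (A : contact_triple) : Prop :=
  exists J : vfield N -> vfield N, (forall W, cone_image A W (J W)) /\ integrable J.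

Definition sasakian_equations g psi kappa (b : bool) (A : contact_triple) : Prop :=
  let: ContactTriple F Z xi := A in
  let sigma : tensor2 M := fun X Y => psi X Y + d1 kappa X Y in
  let Lc := c2 F (lie2 Z sigma) in
  [/\ forall Y, sigma Z Y = 0,
      forall X Y, c2 F sigma X Y = - lie2 Z Lc X Y,
      forall X Y V, c3 F (d2 psi) X Y V = wedge13 xi (d2 Lc) Z X Y V &
      forall X Y, g (F X) Y = d1 xi X Y - (-1) ^+ b * Lc X Y].

Definition sasakian_pair g psi kappa (A : bool -> contact_triple) : Prop :=
  forall b, [/\ almost_contact_metric g (A b), normal (A b) &
                sasakian_equations g psi kappa b (A b)].

(* The endomorphism tau_b o Phi o tau_b^-1, which maps x.1 to (Phi x).1 for x
   in V_b, is F_b + dt (x) Z_b - xi_b (x) d/dt. *)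
Definition corresponds g psi kappa Phi (A : bool -> contact_triple) : Prop :=
  forall b x, Vpm (cone_metric g) (cone_form psi kappa) b x ->
    cone_image (A b) x.1 (Phi x).1.

End Sasakian.

(* Main.v *)
(* The eigenbundle V_b of S is the graph {(X, i(X)(Psi + (-1)^b Gam))}, so it is a
   copy of the tangent bundle, and an orthogonal Phi with Phi^2 = -1 that commutes
   with S is the same as a pair of Gam-orthogonal almost complex structures J_b.
   Phi and S o Phi are both integrable if and only if, for both signs, J_b is
   integrable and dPsi(J_b X, J_b Y, J_b V) = -(-1)^b d omega_b(X, Y, V), where
   omega_b(X, Y) = Gam(J_b X, Y).  On the cylinder, translation invariance and
   orthogonality for Gam = e^t (gamma + dt^2) make J_b = F + dt (x) Z - xi (x) d/dt
   with an almost contact metric (F, Z, xi, gamma), and the equation for dPsi has one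
   component that involves d/dt and one that does not; together they amount to the
   four equations for sigma = psi + d kappa, once L_Z xi = 0 is known, which follows
   from normality.

   Vector fields are derivations of the algebra of smooth functions, hence cutoff
   functions and Hadamard's lemma are needed to find local frames.  These show that
   a tensor on M * R is determined by its values on the lifts of vector fields of M
   and on d/dt, and that a 1-form is represented by a vector field. *)
Require Import Defs.
From mathcomp Require Import all_boot all_order all_algebra ring lra.
From mathcomp Require Import all_classical all_reals all_analysis.

Set Implicit Arguments.
Unset Strict Implicit.
Unset Printing Implicit Defensive.

Import Order.TTheory GRing.Theory Num.Theory numFieldNormedType.Exports.

Local Open Scope classical_set_scope.
Local Open Scope ring_scope.

(** * Calculus on open sets of R^n *)

Section Mean.
Variable R : realType.
Notation mu := (@lebesgue_measure R).

(** A vector field is a derivation of global functions only, so coordinates enter cut off: chi and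
    chi x_i stand for 1 and x_i, and the quotient rule for (chi x_i) / chi, cleared of denominators,
    produces the terms [chi * X (u i) - u i * X chi] and the powers of chi. Gluing needs no
    partition of unity: [smooth_div] gets smoothness of f from that of r f, with r nonzero at the
    given point. Hadamard's lemma is proved relative to an affine projection, which serves both a
    point (fields are spanned by partials) and a slice t = const (fields of the cylinder split into
    a horizontal part and d/dt).

    The equation for dPsi does not come out of the Courant brackets directly. They give an identity
    that mixes arguments with and without J, and the vanishing of the (3,0) part of d omega, a
    second use of integrability, converts it. The sum psi + d kappa arises because d/dt reproduces
    e^t. Invariance of weight 0 is reduced to weight 1, under which both eigenbundles are preserved;
    the reduction rests on definiteness of the metric. *)

Definition cont01 (f : R -> R) := forall u, u \in `[0, 1] -> {for u, continuous f}.

Lemma cont01D f g : cont01 f -> cont01 g -> cont01 (fun u => f u + g u).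
Proof. by move=> cf cg u u01; apply: (@continuousD _ _ _ f g); [exact: cf|exact: cg]. Qed.

Lemma cont01Z a f : cont01 f -> cont01 (fun u => a * f u).
Proof.
move=> cf u u01; apply: (@continuousM _ _ (cst a) f); last exact: cf.
exact: cst_continuous.
Qed.

Definition mean (f : R -> R) : R := \int[mu]_(u in `[0, 1]) f u.

Lemma cont01_within f : cont01 f -> {within `[0, 1], continuous f}.
Proof.
move=> cf; apply: continuous_in_subspaceT => u; rewrite inE /= => u01.
exact: cf.
Qed.

Lemma cont01_integrable f : cont01 f -> mu.-integrable `[0, 1] (EFin \o f).
Proof.
move=> cf; apply: continuous_compact_integrable; first exact: segment_compact.
exact: cont01_within.
Qed.

Lemma meanD f g : cont01 f -> cont01 g ->
  mean (fun u => f u + g u) = mean f + mean g.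
Proof. by move=> cf cg; apply: RintegralD => //; exact: cont01_integrable. Qed.

Lemma meanZ a f : cont01 f -> mean (fun u => a * f u) = a * mean f.
Proof. by move=> cf; apply: RintegralZl => //; exact: cont01_integrable. Qed.

Lemma mean_dist f g e : cont01 f -> cont01 g ->
  (forall u, u \in `[0, 1] -> `|f u - g u| <= e) -> `|mean f - mean g| <= e.
Proof.
move=> cf cg fge.
have cfg : cont01 (fun u => f u - g u).
  by move=> u u01; apply: (@continuousB _ _ _ f g); [exact: cf|exact: cg].
rewrite -RintegralB//; try exact: cont01_integrable.
apply: (le_trans (le_normr_Rintegral _ (cont01_integrable cfg))) => //.
apply: (@le_trans _ _ (\int[mu]_(u in `[0, 1]) e)).
  apply: le_Rintegral => //.
  - apply: (@cont01_integrable (fun u => `|f u - g u|)) => u u01.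
    by apply: continuous_comp; [exact: cfg|exact: norm_continuous].
  - by apply: (@cont01_integrable (cst e)) => u u01; exact: cst_continuous.
rewrite Rintegral_cst//= lebesgue_measure_itv/= lte01 oppr0 adde0.
by rewrite mulr1.
Qed.

Lemma mean_derive (F f : R -> R) : cont01 f ->
  (forall u : R, u \in `[0, 1] -> is_derive u 1 F (f u)) -> mean f = F 1 - F 0.
Proof.
move=> cf dF; rewrite /mean /Rintegral (@continuous_FTC2 _ _ F)//.
- exact: cont01_within.
- have cF u : u \in `[0, 1] -> {for u, continuous F}.
    by move=> u01; have [d _] := dF u u01; exact/differentiable_continuous/derivable1_diffP.
  split.
  + by move=> u /subset_itv_oo_cc u01; have [] := dF u u01.
  + apply: cvg_at_right_filter; apply: cF; by rewrite in_itv /= lexx ler01.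
  + apply: cvg_at_left_filter; apply: cF; by rewrite in_itv /= lexx ler01.
- move=> u /subset_itv_oo_cc u01; have [d <-] := dF u u01.
  by rewrite derive1E.
Qed.

End Mean.

(** * Directional derivatives and the mean value theorem *)

Section Directional.
Variables (R : realType) (n : nat).
Implicit Types (f g : 'rV[R]_n -> R) (x v w : 'rV[R]_n) (U : set 'rV[R]_n).

Lemma is_derive_line f x v (s d : R) :
  is_derive (s *: v + x) v f d -> is_derive s 1 (fun t : R => f (t *: v + x)) d.
Proof.
have E : (fun h : R => h^-1 *: (f ((h *: 1 + s) *: v + x) - f (s *: v + x))) =
         (fun h : R => h^-1 *: (f (h *: v + (s *: v + x)) - f (s *: v + x))).
  by apply/funext => h; rewrite [_ *: 1]mulr1 scalerDl addrA.
case=> dv <-; split; first by rewrite /derivable E.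
by rewrite /derive E.
Qed.

Lemma is_derive_lineP f x v (d : R) :
  is_derive x v f d <-> is_derive (0 : R) 1 (fun h : R => f (h *: v + x)) d.
Proof.
split=> [dv|].
  by apply: (@is_derive_line _ _ _ 0); rewrite scale0r add0r.
case=> dv <-; split; first by apply/derivable1P.
rewrite /derive /=; set F := (X in lim (X @ _) = _).
set G := (X in _ = lim (X @ _)); suff -> : F = G by [].
by apply/funext => h; rewrite /F /G /= scale0r add0r addr0 [_%:A]mulr1.
Qed.

(** Precomposing the line h |-> h v + x with h |-> a h needs no division by a, so a = 0 is
    included. *)
Lemma is_derive_scaledir f x v (a d : R) :
  is_derive x v f d -> is_derive x (a *: v) f (a * d).
Proof.
move=> /is_derive_lineP dv; apply/is_derive_lineP.
have -> : (fun h : R => f (h *: (a *: v) + x)) =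
    (fun h : R => f (h *: v + x)) \o (fun h => a * h).
  by apply/funext => h /=; rewrite scalerA mulrC.
have da : is_derive (0 : R) 1 (fun h => a * h) a.
  have da := @is_deriveZ R R R id a 0 1 1 (is_derive_id _ _).
  apply: (is_derive_eq da); exact: mulr1.
rewrite mulrC; apply: is_derive1_comp.
by rewrite mulr0.
Qed.

Lemma MVT_line f (df : 'rV[R]_n -> R) x v :
  (forall s : R, s \in `[0, 1] -> is_derive (s *: v + x) v f (df (s *: v + x))) ->
  exists2 c : R, c \in `[0, 1] & f (v + x) - f x = df (c *: v + x).
Proof.
move=> dfs; pose F (s : R) := f (s *: v + x).
have dF (s : R) : s \in `[0, 1] -> is_derive s 1 F (df (s *: v + x)).
  by move=> s01; apply: is_derive_line; exact: dfs.
have le01 : (0 : R) <= 1 by [].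
have dFo (s : R) : s \in `]0, 1[ -> is_derive s 1 F (df (s *: v + x)).
  by move=> /subset_itv_oo_cc; exact: dF.
have cF : {within `[0, 1], continuous F}.
  apply: continuous_in_subspaceT => s; rewrite inE /= => /dF[ds _].
  exact/differentiable_continuous/derivable1_diffP.
have [c c01] := MVT_segment le01 dFo cF.
rewrite /F scale1r scale0r add0r subr0 mulr1 => E; by exists c.
Qed.

(** The mean value theorem for an increment whose base point and direction both move with t: it
    becomes a directional derivative at a point that tends to x. Continuity of the derivatives then
    gives additivity in the direction ([deriveDdir]) and the chain rule ([is_derive_comp]). *)
Lemma path_MVT T (F : set_system T) {FF : Filter F} (b k : T -> 'rV[R]_n) f x U :
  b @ F --> x -> k @ F --> (0 : 'rV[R]_n) -> open U -> U x ->
  (forall y v, U y -> derivable f y v) ->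
  exists2 psi : T -> 'rV[R]_n, psi @ F --> x &
    \forall t \near F, f (k t + b t) - f (b t) = 'D_(k t) f (psi t).
Proof.
move=> bx k0 oU Ux dU.
have /nbhs_ballP[e /= e0 eU] : nbhs x U by exact: open_nbhs_nbhs.
have H t : exists c : R, 0 <= c <= 1 /\ (`|k t| < e / 2 -> `|b t - x| < e / 2 ->
    f (k t + b t) - f (b t) = 'D_(k t) f (c *: k t + b t)).
  have [[ke be]|nke] := pselect (`|k t| < e / 2 /\ `|b t - x| < e / 2); last first.
    (* For t far from the limit the intermediate parameter is irrelevant; 0 keeps it in [0, 1], so
       that the bound on [c t *: k t] holds for all t. *)
    by exists 0; rewrite lexx ler01; split=> // ke be; case: nke.
  have [|c c01 E] := @MVT_line f ('D_(k t) f) (b t) (k t).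
    move=> s; rewrite in_itv /= => /andP[s0 s1]; apply/derivableP/dU/eU.
    rewrite -ball_normE /ball_ /= distrC -addrA (le_lt_trans (ler_normD _ _))//.
    rewrite [ltRHS](splitr e) ltr_leD//; last exact: ltW.
    by rewrite normrZ ger0_norm// (le_lt_trans _ ke)// ler_piMl.
  by exists c; split=> //; move: c01; rewrite in_itv.
have [c Hc] := choice H.
have cb : (fun t => c t *: k t + b t) @ F --> x.
  rewrite -[X in _ --> X]add0r; apply: cvgD => //.
  apply/norm_cvg0P; apply: (@squeeze_cvgr _ _ _ _ (fun=> 0) (fun t => `|k t|)).
  - apply: nearW => t; rewrite normr_ge0 /= normrZ; have [/andP[c0 c1] _] := Hc t.
    by rewrite ger0_norm// ler_piMl.
  - exact: cvg_cst.
  - by apply/norm_cvg0P.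
exists (fun t => c t *: k t + b t) => //; near=> t.
have [_ Ht] := Hc t; apply: Ht.
  near: t; move/cvgr0Pnorm_lt : k0; apply; exact: divr_gt0.
near: t; move/cvgrPdist_lt : bx => /(_ (e / 2)); rewrite divr_gt0// => /(_ isT).
by apply: filterS => t; rewrite distrC.
Unshelve. all: by end_near. Qed.

End Directional.

Section SmoothOn.
Variables (R : realType).

Definition smooth_on n (U : set 'rV[R]_n) (f : 'rV[R]_n -> R) := forall k, Ck k U f.

Lemma cvg_sumR (T : Type) (F : set_system T) {FF : Filter F} (I : Type) (r : seq I)
    (f : I -> T -> R) (l : I -> R) :
  (forall i, f i @ F --> l i) ->
  (fun t => \sum_(i <- r) f i t) @ F --> \sum_(i <- r) l i.
Proof.
move=> fl; elim: r => [|i r IH].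
  under eq_fun do rewrite big_nil; rewrite big_nil; exact: cvg_cst.
by under eq_fun do rewrite big_cons; rewrite big_cons; exact: cvgD.
Qed.

Section Fixed_dim.
Variable n : nat.
Implicit Types (f g : 'rV[R]_n -> R) (x v w : 'rV[R]_n) (U V : set 'rV[R]_n).

Lemma smooth_on_cont U f x : smooth_on U f -> U x -> {for x, continuous f}.
Proof. by move=> sf; case: (sf 0) => + _; exact. Qed.

Lemma smooth_on_derivable U f x v : smooth_on U f -> U x -> derivable f x v.
Proof. by move=> sf; case: (sf 1) => _ /(_ v)[+ _]; exact. Qed.

Lemma smooth_on_derive U f v : smooth_on U f -> smooth_on U ('D_v f).
Proof. by move=> sf k; case: (sf k.+1) => _ /(_ v)[]. Qed.

Lemma smooth_on_sub U V f : V `<=` U -> smooth_on U f -> smooth_on V f.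
Proof. by move=> VU sf k; exact: Ck_sub VU (sf k). Qed.

Lemma Ck_local k U f :
  (forall x, U x -> exists V, [/\ open V, V x & Ck k V f]) -> Ck k U f.
Proof.
elim: k f => [|k IH] f H; (split; first by
  move=> x /H[V [oV Vx []]] + _; exact) => // v; split.
  by move=> x /H[V [oV Vx [_ /(_ v)[+ _]]]]; exact.
apply: IH => x /H[V [oV Vx [_ /(_ v)[_ CV]]]]; exists V; split=> //.
Qed.

Lemma Ck_sum k U (I : Type) (r : seq I) (F : I -> 'rV[R]_n -> R) : open U ->
  (forall i, Ck k U (F i)) -> Ck k U (fun x => \sum_(i <- r) F i x).
Proof.
move=> oU CF; elim: r => [|i r IH].
  have -> : (fun x => \sum_(i <- [::]) F i x) = cst 0 by apply/funext => x; rewrite big_nil.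
  exact: Ck_cst.
have -> : (fun x => \sum_(j <- i :: r) F j x) = F i \+ (fun x => \sum_(j <- r) F j x).
  by apply/funext => x; rewrite big_cons.
exact: CkD.
Qed.

Lemma Ck_prod k U (I : Type) (r : seq I) (F : I -> 'rV[R]_n -> R) : open U ->
  (forall i, Ck k U (F i)) -> Ck k U (fun x => \prod_(i <- r) F i x).
Proof.
move=> oU CF; elim: r => [|i r IH].
  have -> : (fun x => \prod_(i <- [::]) F i x) = cst 1 by apply/funext => x; rewrite big_nil.
  exact: Ck_cst.
have -> : (fun x => \prod_(j <- i :: r) F j x) = F i \* (fun x => \prod_(j <- r) F j x).
  by apply/funext => x; rewrite big_cons.
exact: CkM.
Qed.

Lemma CkV k U f : open U -> (forall x, U x -> f x != 0) ->
  Ck k U f -> Ck k U (fun x => (f x)^-1).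
Proof.
move=> oU f0; elim: k f f0 => [|k IH] f f0 Cf.
  by split=> // x Ux; exact: (continuousV (f0 x Ux) (Cf.1 x Ux)).
split; first by move=> x Ux; exact: (continuousV (f0 x Ux) (Cf.1 x Ux)).
move=> v; have [df Cdf] := Cf.2 v; split.
  by move=> x Ux; apply: derivableV; [exact: f0|exact: df].
have CV := IH f f0 (CkS Cf).
apply: (Ck_ext oU _ (CkM oU (CkM oU (Ck_cst _ _ (-1)) (CkM oU CV CV)) Cdf)).
move=> x Ux /=; rewrite deriveV; [|exact: f0|exact: df].
by rewrite /GRing.scale /= expr2 invfM mulN1r.
Qed.

Lemma derive_scaledir f x v a : derivable f x v -> 'D_(a *: v) f x = a * 'D_v f x.
Proof. by move=> /derivableP/(is_derive_scaledir a)[_ ->]. Qed.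

Lemma cvg_scale0 v : (fun h : R => h *: v) @ 0^' --> (0 : 'rV[R]_n).
Proof.
rewrite -(scale0r v); apply: (cvg_trans (cvg_app _ (@nbhs_dnbhs _ 0))).
exact: scalel_continuous.
Qed.

(** The increment along v + w is split at the corner h v + x; each half is a directional derivative
    at a point near x, and ['D_v f] and ['D_w f] are continuous there. *)
Lemma deriveDdir U f x v w : open U -> smooth_on U f -> U x ->
  is_derive x (v + w) f ('D_v f x + 'D_w f x).
Proof.
move=> oU sf Ux; have df y u (Uy : U y) := @smooth_on_derivable U f y u sf Uy.
have cx : (fun h : R => x) @ 0^' --> x by exact: cvg_cst.
have cvx : (fun h : R => h *: v + x) @ 0^' --> x.
  by rewrite -[X in _ --> X]add0r; apply: cvgD => //; exact: cvg_scale0.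
have [p px Ep] := path_MVT cx (cvg_scale0 v) oU Ux df.
have [q qx Eq] := path_MVT cvx (cvg_scale0 w) oU Ux df.
have nU : nbhs x U by exact: open_nbhs_nbhs.
suff H : (fun h : R => h^-1 *: (f (h *: (v + w) + x) - f x)) @ 0^' -->
    'D_v f x + 'D_w f x.
  by split; [apply/cvg_ex; eexists; exact: H|exact: cvg_lim H].
have cD u : {for x, continuous ('D_u f)}.
  exact: smooth_on_cont (smooth_on_derive u sf) Ux.
have H1 : (fun h => 'D_v f (p h) + 'D_w f (q h)) @ 0^' --> 'D_v f x + 'D_w f x.
  apply: cvgD; [exact: (cvg_comp _ _ px (cD v))|exact: (cvg_comp _ _ qx (cD w))].
apply: cvg_trans H1; apply: near_eq_cvg; near=> h.
have h0 : h != 0 by near: h; exact: nbhs_dnbhs_neq.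
have Uph : U (p h) by near: h; exact: px.
have Uqh : U (q h) by near: h; exact: qx.
have E : f (h *: (v + w) + x) - f x =
    (f (h *: w + (h *: v + x)) - f (h *: v + x)) + (f (h *: v + x) - f x).
  by rewrite addrA subrK scalerDr addrA [h *: v + _]addrC.
rewrite E (near Ep h)// (near Eq h)// !derive_scaledir; try exact: df.
by rewrite -mulrDr /GRing.scale /= mulrA mulVf// mul1r addrC.
Unshelve. all: by end_near. Qed.

Lemma derive_row U f x v : open U -> smooth_on U f -> U x ->
  'D_v f x = \sum_i v 0 i * 'D_(delta_mx 0 i) f x.
Proof.
move=> oU sf Ux; have df u := @smooth_on_derivable U f x u sf Ux.
rewrite {1}[v]row_sum_delta (big_morph (fun u => 'D_u f x) (id1 := 0) (op1 := +%R)).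
- by apply: eq_bigr => i _; rewrite derive_scaledir.
- by move=> u w; have [_ ->] := deriveDdir u w oU sf Ux.
- by rewrite -(scale0r (0 : 'rV_n)) derive_scaledir ?mul0r.
Qed.

End Fixed_dim.

Section Chain_rule.
Variables (n m : nat) (phi : 'rV[R]_n -> 'rV[R]_m).
Variables (U : set 'rV[R]_m) (V : set 'rV[R]_n).
Hypotheses (oU : open U) (oV : open V) (VU : forall x, V x -> U (phi x)).
Hypothesis sphi : forall i, smooth_on V (fun x => phi x 0 i).

Lemma phi_cont x : V x -> {for x, continuous phi}.
Proof.
by move=> Vx; apply: cvg_mx => i j; rewrite ord1; exact: smooth_on_cont (sphi j) Vx.
Qed.

(** The increment of phi is the moving direction in [path_MVT]; [derive_row] expands it in partial
    derivatives at the intermediate point before the limit is taken. *)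
Lemma is_derive_comp f x v : smooth_on U f -> V x ->
  is_derive x v (f \o phi)
    (\sum_i 'D_v (fun y => phi y 0 i) x * 'D_(delta_mx 0 i) f (phi x)).
Proof.
move=> sf Vx; have Ux := VU Vx.
have df y u (Uy : U y) := @smooth_on_derivable _ U f y u sf Uy.
have cx : (fun h : R => phi x) @ 0^' --> phi x by exact: cvg_cst.
have cvx : (fun h : R => h *: v + x) @ 0^' --> x.
  by rewrite -[X in _ --> X]add0r; apply: cvgD => //; [exact: cvg_scale0|exact: cvg_cst].
have ck : (fun h : R => phi (h *: v + x) - phi x) @ 0^' --> (0 : 'rV_m).
  rewrite -(subrr (phi x)); apply: cvgB => //.
  exact: (cvg_comp _ _ cvx (phi_cont Vx)).
have [p px Ep] := path_MVT cx ck oU Ux df.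
set l := \sum_i _.
suff H : (fun h : R => h^-1 *: ((f \o phi) (h *: v + x) - (f \o phi) x)) @ 0^' --> l.
  by split; [apply/cvg_ex; eexists; exact: H|exact: cvg_lim H].
have H1 : (fun h => \sum_i (h^-1 *: (phi (h *: v + x) 0 i - phi x 0 i)) *
    'D_(delta_mx 0 i) f (p h)) @ 0^' --> l.
  apply: cvg_sumR => i; apply: cvgM.
    exact: smooth_on_derivable (sphi i) Vx.
  have cD : {for phi x, continuous ('D_(delta_mx 0 i) f)}.
    exact: smooth_on_cont (smooth_on_derive _ sf) Ux.
  exact: (cvg_comp _ _ px cD).
apply: cvg_trans H1; apply: near_eq_cvg; near=> h.
have Uph : U (p h) by near: h; apply: px; exact: open_nbhs_nbhs.
have E : f (phi (h *: v + x)) - f (phi x) = 'D_(phi (h *: v + x) - phi x) f (p h).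
  by rewrite -(near Ep h)// subrK.
rewrite /= E (derive_row _ oU sf Uph) [RHS]mulr_sumr.
by apply: eq_bigr => i _; rewrite !mxE [RHS]mulrA.
Unshelve. all: by end_near. Qed.

(** Induction on k for all f at once: the chain rule expresses the derivative by products of a
    smooth function and a composition with a partial derivative of f. *)
Lemma smooth_on_comp f : smooth_on U f -> smooth_on V (f \o phi).
Proof.
move=> sf k; elim: k f sf => [|k IH] f sf; split=> //;
  try by move=> x Vx; apply: continuous_comp;
    [exact: phi_cont|exact: smooth_on_cont sf (VU Vx)].
move=> v; split; first by move=> x Vx; have [] := is_derive_comp v sf Vx.
pose g x := \sum_i 'D_v (fun y => phi y 0 i) x * 'D_(delta_mx 0 i) f (phi x).
apply: (@Ck_ext _ _ _ _ g) => //.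
  by move=> x Vx; have [_ ->] := is_derive_comp v sf Vx.
apply: Ck_sum => // i; apply: CkM => //; first exact: smooth_on_derive (sphi i) k.
exact: IH (smooth_on_derive _ sf).
Qed.

End Chain_rule.
End SmoothOn.

(** * Differentiation under the integral sign *)

Section Parametric_mean.
Variables (R : realType) (n : nat).

Lemma mean_cst (c : R) : mean (fun=> c) = c.
Proof.
by rewrite /mean Rintegral_cst//= lebesgue_measure_itv/= lte01 oppr0 adde0 mulr1.
Qed.

Definition jcont (V : set 'rV[R]_n) (h : R -> 'rV[R]_n -> R) :=
  forall y, V y -> forall u, u \in `[0, 1] ->
  {for (u, y), continuous (fun z : R * 'rV[R]_n => h z.1 z.2)}.

Variable V : set 'rV[R]_n.
Hypothesis oV : open V.

Lemma jcont_cont01 h y : jcont V h -> V y -> cont01 (h^~ y).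
Proof.
move=> jh Vy u u01.
apply: (@continuous2_cvg _ _ _ _ (nbhs u) _ id (cst y) h u y).
- exact: jh.
- exact: cvg_id.
- exact: cvg_cst.
Qed.

(** A tube argument: compactness of [0, 1] makes the neighbourhood of y independent of u. *)
Lemma jcont_near h y e : jcont V h -> V y -> 0 < e ->
  \forall y' \near y, forall u, u \in `[0, 1] -> `|h u y' - h u y| < e.
Proof.
move=> jh Vy e0.
have /compact_near_coveringP cov := @segment_compact R 0 1.
have := cov _ (nbhs y) (fun y' u => `|h u y' - h u y| < e) _.
move=> /(_ _); apply => u u01.
have e20 : 0 < e / 2 by rewrite divr_gt0.
have /cvgrPdist_lt /(_ _ e20) [[A B] [/= uA yB] AB] := jh _ Vy _ u01.
exists (A, B) => //= -[u' y'] [/= Au' By'] /=.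
have H1 := AB (u', y') (conj Au' By').
have H2 := AB (u', y) (conj Au' (nbhs_singleton yB)).
rewrite /= in H1 H2.
have -> : h u' y' - h u' y = - (h u y - h u' y') + (h u y - h u' y).
  by rewrite opprB addrA subrK.
by rewrite (le_lt_trans (ler_normD _ _))// normrN [ltRHS](splitr e) ltrD.
Qed.

Lemma mean_cont h y : jcont V h -> V y ->
  {for y, continuous (fun y => mean (h^~ y))}.
Proof.
move=> jh Vy; apply/(@cvgrPdist_le _ _ _ (nbhs y)) => e e0; near=> z.
apply: mean_dist; [exact: jcont_cont01|apply: jcont_cont01 => //|].
  by near: z; exact: open_nbhs_nbhs.
move=> u u01; rewrite distrC; apply: ltW.
have : forall u, u \in `[0, 1] -> `|h u z - h u y| < e.
  by near: z; exact: jcont_near.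
exact.
Unshelve. all: by end_near. Qed.

(** For each u the mean value theorem writes the difference quotient as [k u] at a point of the
    segment from y to t v + y. [jcont_near] brings this close to [k u y] uniformly in u, and
    [mean_dist] integrates the bound. *)
Lemma mean_is_derive h k v : jcont V h -> jcont V k ->
  (forall y, V y -> forall u, u \in `[0, 1] -> is_derive y v (h u) (k u y)) ->
  forall y, V y -> is_derive y v (fun y => mean (h^~ y)) (mean (k^~ y)).
Proof.
move=> jh jk dh y Vy.
suff H : (fun t : R => t^-1 *: (mean (h^~ (t *: v + y)) - mean (h^~ y))) @ 0^' -->
    mean (k^~ y).
  by split; [apply/cvg_ex; eexists; exact: H|exact: cvg_lim H].
apply/cvgrPdist_le => e e0.
have /nbhs_ballP[d /= d0 dH] : nbhs y
    (V `&` [set z | forall u, u \in `[0, 1] -> `|k u z - k u y| < e]).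
  by apply: filterI; [exact: open_nbhs_nbhs|exact: jcont_near].
near=> t.
have t0 : t != 0 by near: t; exact: nbhs_dnbhs_neq.
have tv : `|t *: v| < d.
  by near: t; move/cvgr0Pnorm_lt : (cvg_scale0 v); exact.
have seg (c : R) : c \in `[0, 1] -> ball y d (c *: (t *: v) + y).
  rewrite in_itv /= => /andP[c0 c1]; rewrite -ball_normE /ball_ /=.
  rewrite opprD addrCA subrr addr0 normrN normrZ ger0_norm//.
  by rewrite (le_lt_trans _ tv)// ler_piMl.
have Vt : V (t *: v + y).
  by have /dH[] := seg 1 (ltac:(by rewrite in_itv /= lexx ler01)); rewrite scale1r.
have c1 := jcont_cont01 jh Vt; have c2 := jcont_cont01 jh Vy.
have c3 : cont01 (fun u => - 1 * h u y).
  exact: cont01Z.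
have c4 : cont01 (fun u => h u (t *: v + y) + - 1 * h u y) by exact: cont01D.
have c5 : cont01 (fun u => t^-1 * (h u (t *: v + y) + - 1 * h u y)) by exact: cont01Z.
have -> : t^-1 *: (mean (h^~ (t *: v + y)) - mean (h^~ y)) =
    mean (fun u => t^-1 * (h u (t *: v + y) + - 1 * h u y)).
  by rewrite meanZ// meanD// meanZ// mulN1r.
apply: mean_dist => //; first exact: jcont_cont01.
move=> u u01.
have [|c c01 E] := @MVT_line _ _ (h u) (fun z => t * k u z) y (t *: v).
  by move=> s /seg/dH[Vs _]; apply: is_derive_scaledir; exact: dh.
rewrite mulN1r E mulrA mulVf// mul1r distrC ltW//.
by have /dH[_] := seg c c01; exact.
Unshelve. all: by end_near. Qed.

End Parametric_mean.

(** * Hadamard's lemma relative to an affine projection *)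

Section Hadamard.
Variables (R : realType) (n : nat) (P L : 'rV[R]_n -> 'rV[R]_n).
Variables (U V : set 'rV[R]_n).
Hypothesis PL : forall h v x, P (h *: v + x) = h *: L v + P x.
Hypothesis cP : continuous P.
Hypotheses (oU : open U) (oV : open V).

Definition seg (u : R) y := u *: y + (1 - u) *: P y.

Hypothesis segU : forall y, V y -> forall u, u \in `[0, 1] -> U (seg u y).

Lemma seg_line u y : seg u y = u *: (y - P y) + P y.
Proof. by rewrite /seg scalerBr scalerBl scale1r -addrA [- _ + _]addrC. Qed.

Lemma seg_affine u h v x :
  seg u (h *: v + x) = h *: (u *: v + (1 - u) *: L v) + seg u x.
Proof.
rewrite /seg PL !scalerDr !scalerA (mulrC u) (mulrC (1 - u) h) -!addrA.
by congr (_ + _); rewrite addrCA.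
Qed.

Lemma seg_cont z : {for z, continuous (fun z : R * 'rV[R]_n => seg z.1 z.2)}.
Proof.
rewrite /seg; apply: (@cvgD _ _ _ (nbhs z)).
  by apply: (@cvgZ _ _ _ (nbhs z)); [exact: cvg_fst|exact: cvg_snd].
apply: (@cvgZ _ _ _ (nbhs z)).
  by apply: (@cvgB _ _ _ (nbhs z)); [exact: cvg_cst|exact: cvg_fst].
apply: (@continuous_comp _ _ _ snd P); first exact: cvg_snd.
exact: cP.
Qed.

Lemma jcont_seg (phi : R -> R) g : continuous phi ->
  (forall x, U x -> {for x, continuous g}) ->
  jcont V (fun u y => phi u * g (seg u y)).
Proof.
move=> cphi cg y Vy u u01.
apply: (@continuousM _ _ (fun z => phi z.1) (fun z => g (seg z.1 z.2))).
  by apply: (@continuous_comp _ _ _ fst phi); [exact: cvg_fst|exact: cphi].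
apply: (@continuous_comp _ _ _ (fun z => seg z.1 z.2) g); first exact: seg_cont.
by apply: cg; exact: segU.
Qed.

(** The weight phi is there for the induction: differentiating [g (seg u y)] along v yields
    derivatives of g along v and L v with the new weights [phi u * u] and [phi u * (1 - u)]. *)
Lemma smooth_mean (phi : R -> R) g : continuous phi -> smooth_on U g ->
  smooth_on V (fun y => mean (fun u => phi u * g (seg u y))).
Proof.
move=> + + k; elim: k phi g => [|k IH] phi g cphi sg.
all: have cg f : smooth_on U f -> forall x, U x -> {for x, continuous f}
  by move=> sf x; exact: smooth_on_cont.
all: have jg := jcont_seg cphi (cg g sg).
all: have cG y : V y ->
  {for y, continuous (fun y => mean (fun u => phi u * g (seg u y)))}
  by exact: (mean_cont oV jg).
- by split.
split=> // v.
pose p1 u := phi u * u; pose p2 u := phi u * (1 - u).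
have cp1 : continuous p1 by move=> u; apply: (@continuousM _ _ phi id); [exact: cphi|exact: cvg_id].
have cp2 : continuous p2.
  move=> u; apply: (@continuousM _ _ phi (fun u => 1 - u)); first exact: cphi.
  by apply: (@cvgB _ _ _ (nbhs u)); [exact: cvg_cst|exact: cvg_id].
have s1 := smooth_on_derive v sg; have s2 := smooth_on_derive (L v) sg.
have j1 := jcont_seg cp1 (cg _ s1); have j2 := jcont_seg cp2 (cg _ s2).
pose g' u y := p1 u * 'D_v g (seg u y) + p2 u * 'D_(L v) g (seg u y).
have jg' : jcont V g'.
  by move=> y Vy u u01; exact: (continuousD (j1 _ Vy _ u01) (j2 _ Vy _ u01)).
have D y (Vy : V y) : is_derive y v (fun y => mean (fun u => phi u * g (seg u y)))
    (mean (g'^~ y)).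
  apply: (mean_is_derive oV jg jg') => // {}y {}Vy u u01.
  have Us := segU Vy u01.
  have [dE dd] := derive_affine g v (seg_affine u).
  have dsg w : derivable g (seg u y) w by exact: smooth_on_derivable sg Us.
  have dg : is_derive y v (g \o seg u) (u * 'D_v g (seg u y) + (1 - u) * 'D_(L v) g (seg u y)).
    split; first by apply: dd.
    have -> := congr1 (fun F => F y) dE; rewrite /=; have [_ ->] := deriveDdir (u *: v) ((1 - u) *: L v) oU sg Us.
    by rewrite !derive_scaledir.
  have := @is_deriveZ _ _ _ (g \o seg u) (phi u) _ _ _ dg.
  move=> H; apply: (is_derive_eq H).
  by rewrite /g' /p1 /p2 -!mulrA -mulrDr.
split; first by move=> y /D[].
apply: Ck_ext (CkD oV (IH p1 _ cp1 s1) (IH p2 _ cp2 s2)) => //.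
move=> y Vy; have [_ ->] := D y Vy; rewrite /= /g' meanD//.
  exact: (jcont_cont01 j1).
exact: (jcont_cont01 j2).
Qed.

(** H i is the mean of the i-th partial derivative along the segment from P y to y, and the identity
    is the fundamental theorem of calculus on it. At a fixed point of P the segment degenerates and
    the mean is that of a constant. *)
Lemma hadamard g : smooth_on U g -> exists H : 'I_n -> 'rV[R]_n -> R,
  [/\ forall i, smooth_on V (H i),
      forall y, V y -> g y = g (P y) + \sum_i (y - P y) 0 i * H i y &
      forall i y, V y -> P y = y -> H i y = 'D_(delta_mx 0 i) g y].
Proof.
move=> sg; pose D i := 'D_(delta_mx 0 i) g.
have sD i : smooth_on U (D i) by exact: smooth_on_derive.
pose H i y := mean (fun u => cst 1 u * D i (seg u y)).
have c1 : continuous (cst 1 : R -> R) by exact: cst_continuous.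
exists H; split.
- by move=> i; apply: smooth_mean.
- move=> y Vy.
  have jD i : jcont V (fun u y => cst 1 u * D i (seg u y)).
    by apply: jcont_seg => // x; exact: smooth_on_cont (sD i).
  have cD i : cont01 (fun u => cst 1 u * D i (seg u y)) by exact: (jcont_cont01 (jD i)).
  have cZ i : cont01 (fun u => (y - P y) 0 i * (cst 1 u * D i (seg u y))).
    exact: cont01Z.
  have sumE (r : seq 'I_n) :
      cont01 (fun u => \sum_(i <- r) (y - P y) 0 i * (cst 1 u * D i (seg u y))) /\
      mean (fun u => \sum_(i <- r) (y - P y) 0 i * (cst 1 u * D i (seg u y))) =
      \sum_(i <- r) (y - P y) 0 i * H i y.
    elim: r => [|i r [cr IH]].
      under eq_fun do rewrite big_nil; rewrite big_nil mean_cst; split=> //.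
      by move=> u _; exact: cst_continuous.
    under eq_fun do rewrite big_cons; rewrite big_cons -IH; split.
      exact: cont01D.
    by rewrite meanD// meanZ.
  have [cS <-] := sumE (index_enum 'I_n).
  pose F (u : R) := g (seg u y).
  have dF (u : R) : u \in `[0, 1] ->
      is_derive u 1 F (\sum_i (y - P y) 0 i * (cst 1 u * D i (seg u y))).
    move=> u01; have Us := segU Vy u01.
    have -> : F = (fun u => g (u *: (y - P y) + P y)).
      by apply/funext => s; rewrite /F seg_line.
    apply: is_derive_line; rewrite -seg_line; split.
      exact: smooth_on_derivable sg Us.
    by rewrite (derive_row _ oU sg Us); apply: eq_bigr => i _; rewrite mul1r.
  rewrite (mean_derive cS dF) /F /seg scale1r subrr scale0r addr0 scale0r add0r subr0.
  by rewrite scale1r addrC subrK.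
- move=> i y Vy Py; rewrite /H -[RHS]mean_cst; congr mean; apply/funext => u.
  by rewrite /= mul1r /seg Py -scalerDl addrC subrK scale1r.
Qed.

End Hadamard.

(** * A smooth bump function *)

Section Univariate.
Variable R : realType.

Fixpoint smooth1 k (f : R -> R) : Prop :=
  (forall x, derivable f x 1) /\ if k is k'.+1 then smooth1 k' (derive1 f) else True.

Lemma smooth1_derivable k f x : smooth1 k f -> derivable f x 1.
Proof. by case: k => [|k] [+ _]; exact. Qed.

Lemma smooth_on_uni n (U : set 'rV[R]_n) f q : open U ->
  (forall k, smooth1 k f) -> smooth_on U q -> smooth_on U (f \o q).
Proof.
move=> oU + sq k.
have cf g x : (forall k, smooth1 k g) -> U x -> {for x, continuous (g \o q)}.
  move=> sg Ux; apply: continuous_comp; first exact: smooth_on_cont sq Ux.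
  apply/differentiable_continuous/derivable1_diffP; exact: smooth1_derivable (sg 0).
elim: k f => [|k IH] f sf; first by split=> // x; exact: cf.
split; first by move=> x; exact: cf.
move=> v.
have D x : U x -> is_derive x v (f \o q) ((derive1 f) (q x) * 'D_v q x).
  move=> Ux; apply/is_derive_lineP.
  apply: (@is_derive1_comp _ f (fun h : R => q (h *: v + x))).
    rewrite scale0r add0r derive1E; apply/derivableP; exact: smooth1_derivable (sf 0).
  apply/is_derive_lineP/derivableP; exact: smooth_on_derivable sq Ux.
split; first by move=> x /D[].
have sf' j : smooth1 j (derive1 f) by case: (sf j.+1).
apply: Ck_ext (CkM oU (IH _ sf') (smooth_on_derive v sq k)) => //.
by move=> x /D[_ ->].
Qed.

Lemma smooth1_expR k : smooth1 k (@expR R).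
Proof.
have d (x : R) : derivable (@expR R) x 1 by [].
elim: k => [|k IH]; split=> //.
suff -> : derive1 (@expR R) = expR by [].
by apply/funext => x; rewrite derive1E; have [_ ->] := is_derive_expR x.
Qed.

(** The polynomial makes the family closed under differentiation: p becomes X^2 (p - p'), so
    smoothness to all orders follows by induction from a single derivative. *)
Definition exp_flat (p : {poly R}) (x : R) : R :=
  if 0 < x then p.[x^-1] * expR (- x^-1) else 0.

(** With y = 1/h, one term of the exponential series gives y^(m+1) <= (m+1)! e^y; this is one power
    more than needed, hence the factor [|h|]. *)
Lemma exp_flatXn_le m (h : R) : `|exp_flat 'X^m h| <= m.+1`!%:R * `|h|.
Proof.
rewrite /exp_flat; case: ifPn => [h0|_]; last by rewrite normr0 mulr_ge0.
have y0 : 0 < h^-1 by rewrite invr_gt0.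
have fact0 : 0 < (m.+1`!%:R : R) by rewrite ltr0n fact_gt0.
have H : h^-1 ^+ m.+1 <= m.+1`!%:R * expR h^-1.
  rewrite mulrC -ler_pdivrMr//.
  by rewrite (le_trans _ (expR_ge1Dxn m (ltW y0)))// lerDr.
rewrite hornerXn (gtr0_norm h0) ger0_norm; last first.
  by rewrite mulr_ge0 ?exprn_ge0 ?(ltW y0)// ltW// expR_gt0.
rewrite expRN ler_pdivrMr ?expR_gt0// -mulrA (mulrC h) mulrA -ler_pdivrMr//.
by rewrite -exprSr.
Qed.

Lemma exp_flatXn_cvg0 m : exp_flat 'X^m h @[h --> (0 : R)] --> (0 : R).
Proof.
apply/norm_cvg0P; apply: (@squeeze_cvgr _ _ _ _ (fun=> 0) (fun h : R => m.+1`!%:R * `|h|)).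
- by apply: nearW => h; rewrite normr_ge0 exp_flatXn_le.
- exact: cvg_cst.
- rewrite -[X in _ --> X](mulr0 m.+1`!%:R) -[X in _ * X](normr0 R).
  apply: cvgM; first exact: cvg_cst.
  exact: norm_continuous.
Qed.

Lemma exp_flat_cvg0 p : exp_flat p h @[h --> (0 : R)] --> (0 : R).
Proof.
have -> : exp_flat p = fun h => \sum_(i < size p) p`_i * exp_flat 'X^i h.
  apply/funext => h; rewrite /exp_flat; case: ifPn => _; last first.
    by rewrite big1// => i _; rewrite mulr0.
  rewrite horner_coef mulr_suml; apply: eq_bigr => i _.
  by rewrite hornerXn mulrA.
rewrite -[X in _ --> X](_ : \sum_(i < size p) p`_i * 0 = 0); last first.
  by rewrite big1// => i _; rewrite mulr0.
apply: cvg_sumR => i; apply: cvgM; first exact: cvg_cst.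
exact: exp_flatXn_cvg0.
Qed.

Lemma is_derive_exp_flat p x : is_derive x (1 : R) (exp_flat p) (exp_flat ('X^2 * (p^`() *- 1 + p)) x).
Proof.
have [x0|x0|<-] := ltgtP 0 x.
- have D : is_derive x (1 : R) ((fun y => p.[y] * expR (- y)) \o (fun x => x^-1))
      ((p^`().[x^-1] * expR (- x^-1) - p.[x^-1] * expR (- x^-1)) * (- x ^- 2)).
    apply: is_derive1_comp; last first.
      have H := @is_deriveV R id x 1 1 (lt0r_neq0 x0) (is_derive_id _ _).
      by apply: (is_derive_eq H); exact: mulr1.
    have dN : is_derive x^-1 (1 : R) (fun y : R => expR (- y)) (- expR (- x^-1)).
      have H := @is_derive1_comp R expR -%R x^-1 _ _ (is_derive_expR _) (is_deriveNid _ _).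
      by apply: (is_derive_eq H); rewrite mulrN1.
    have H := is_deriveM (is_derive_poly p x^-1) dN.
    apply: (is_derive_eq H); rewrite /GRing.scale /=.
    by rewrite mulrN addrC mulrC.
  apply: (@near_eq_is_derive _ _ _ ((fun y => p.[y] * expR (- y)) \o (fun x => x^-1))).
    near=> y; rewrite /exp_flat /= ifT//; near: y.
    exact: lt_nbhsr.
  apply: (is_derive_eq D); rewrite /exp_flat x0 !hornerE /=.
  rewrite -exprVn; ring.
- apply: (@near_eq_is_derive _ _ _ (cst 0)).
    near=> y; rewrite /exp_flat ifF//; apply/negbTE; rewrite -leNgt; apply: ltW; near: y.
    exact: lt_nbhsl.
  have -> : exp_flat ('X^2 * (p^`() *- 1 + p)) x = 0 by rewrite /exp_flat lt_gtF.
  exact: is_derive_cst.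
- have -> : exp_flat ('X^2 * (p^`() *- 1 + p)) 0 = 0 by rewrite /exp_flat ltxx.
  suff H : (fun h : R => h^-1 *: (exp_flat p (h *: 1 + 0) - exp_flat p 0)) @ 0^' --> (0 : R).
    by split; [apply/cvg_ex; eexists; exact: H|exact: cvg_lim H].
  (* Division by h amounts to multiplying p by X, so the difference quotient at 0 stays in the
     family. *)
  apply: (@cvg_trans _ (exp_flat ('X * p) h @[h --> 0^'])); last first.
    exact: cvg_trans (cvg_app _ (@nbhs_dnbhs _ 0)) (exp_flat_cvg0 _).
  apply: near_eq_cvg; near=> h.
  have h0 : h != 0 by near: h; exact: nbhs_dnbhs_neq.
  rewrite addr0 [_%:A]mulr1 /exp_flat ltxx subr0; case: ifPn => _; last by rewrite scaler0.
  by rewrite hornerM hornerX -mulrA.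
Unshelve. all: by end_near. Qed.

Lemma smooth1_exp_flat k p : smooth1 k (exp_flat p).
Proof.
elim: k p => [|k IH] p; split=> //;
  try by move=> x; have [] := is_derive_exp_flat p x.
suff -> : derive1 (exp_flat p) = exp_flat ('X^2 * (p^`() *- 1 + p)) by exact: IH.
by apply/funext => x; rewrite derive1E; have [_ ->] := is_derive_exp_flat p x.
Qed.

Lemma bump n (a : 'rV[R]_n) (r : R) : 0 < r -> exists2 b : 'rV[R]_n -> R,
  smooth_on setT b /\ b a != 0 & forall y, b y != 0 -> forall i, `|y 0 i - a 0 i| < r.
Proof.
move=> r0; pose q (e : R) i (y : 'rV[R]_n) := r + e * (y 0 i - a 0 i).
(* The two factors for i are nonzero exactly when y_i - a_i > -r and y_i - a_i < r, so the product
   lives on an open cube. *)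
pose b (y : 'rV[R]_n) := \prod_i (exp_flat 1 (q 1 i y) * exp_flat 1 (q (-1) i y)).
have oT : open [set: 'rV[R]_n] by exact: openT.
have f1 (x : R) : (exp_flat 1 x != 0) = (0 < x).
  rewrite /exp_flat; case: ifPn => x0; last by rewrite eqxx.
  by rewrite hornerC mul1r gt_eqF// expR_gt0.
exists b; first split.
- move=> k; apply: Ck_prod => // i; apply: CkM => //.
    apply: (smooth_on_uni (q := q 1 i) oT (smooth1_exp_flat^~ 1)) => j.
    apply: (@CkD _ _ _ _ (cst r) (fun y => 1 * (y 0 i - a 0 i))) => //; first exact: Ck_cst.
    apply: (@CkM _ _ _ _ (cst 1) (fun y => y 0 i - a 0 i)) => //; first exact: Ck_cst.
    by apply: (@CkD _ _ _ _ (fun y => y 0 i) (cst (- a 0 i))) => //;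
      [exact: Ck_coord|exact: Ck_cst].
  apply: (smooth_on_uni (q := q (-1) i) oT (smooth1_exp_flat^~ 1)) => j.
  apply: (@CkD _ _ _ _ (cst r) (fun y => -1 * (y 0 i - a 0 i))) => //; first exact: Ck_cst.
  apply: (@CkM _ _ _ _ (cst (-1)) (fun y => y 0 i - a 0 i)) => //; first exact: Ck_cst.
  by apply: (@CkD _ _ _ _ (fun y => y 0 i) (cst (- a 0 i))) => //;
    [exact: Ck_coord|exact: Ck_cst].
- apply/prodf_neq0 => i _; rewrite mulf_neq0// f1 /q subrr mulr0 addr0//.
- move=> y /prodf_neq0 by0 i; have := by0 i isT.
  rewrite mulf_eq0 negb_or !f1 /q mul1r mulN1r => /andP[h1 h2].
  by rewrite ltr_norml; apply/andP; split; lra.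
Qed.

End Univariate.

(** * Smooth functions, local frames and the musical isomorphism *)

Section Evaluation.
Variables (R : realType) (n : nat) (M : manifold R n).
Implicit Types (f g h : Cinf M) (X Y : vfield M) (w : form1 M) (p : M).

Lemma CinfP f g : (forall p, f p = g p) <-> f = g.
Proof. by split=> [fg|->//]; apply/val_inj/funext. Qed.

Lemma evD f g p : (f + g) p = f p + g p. Proof. by []. Qed.
Lemma evN f p : (- f) p = - f p. Proof. by []. Qed.
Lemma evM f g p : (f * g) p = f p * g p. Proof. by []. Qed.
Lemma ev0 p : (0 : Cinf M) p = 0. Proof. by []. Qed.
Lemma ev1 p : (1 : Cinf M) p = 1. Proof. by []. Qed.
Lemma ev_cst a p : Cinf_cst M a p = a. Proof. by []. Qed.

Lemma ev_sum (I : Type) (r : seq I) P (F : I -> Cinf M) p :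
  (\sum_(i <- r | P i) F i) p = \sum_(i <- r | P i) F i p.
Proof. by elim/big_rec2: _ => // i y1 y2 _ <-. Qed.

Lemma ev_prod (I : Type) (r : seq I) P (F : I -> Cinf M) p :
  (\prod_(i <- r | P i) F i) p = \prod_(i <- r | P i) F i p.
Proof. by elim/big_rec2: _ => // i y1 y2 _ <-. Qed.

Lemma evX f k p : (f ^+ k) p = f p ^+ k.
Proof. by elim: k => [|k IH]; rewrite ?expr0// !exprS evM IH. Qed.

Lemma vfieldP X Y : (forall f, X f = Y f) <-> X = Y.
Proof. by split=> [XY|->//]; apply/val_inj/funext. Qed.

Lemma form1P (w w' : form1 M) : (forall X, w X = w' X) <-> w = w'.
Proof. by split=> [XY|->//]; apply/val_inj/funext. Qed.

Lemma vf_addE X Y f : (X + Y) f = X f + Y f. Proof. by []. Qed.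
Lemma vf_oppE X f : (- X) f = - X f. Proof. by []. Qed.
Lemma vf_0E f : (0 : vfield M) f = 0. Proof. by []. Qed.
Lemma vf_scaleE h X f : (h *: X) f = h * X f. Proof. by []. Qed.

Lemma vf_sumE (I : Type) (r : seq I) P (F : I -> vfield M) f :
  (\sum_(i <- r | P i) F i) f = \sum_(i <- r | P i) F i f.
Proof. by elim/big_rec2: _ => // i y1 y2 _ <-. Qed.

Lemma vf_cst X a : X (Cinf_cst M a) = 0.
Proof.
have X1 : X 1 = 0.
  have := vf_mul X 1 1; rewrite !mulr1 mul1r => /eqP.
  by rewrite -subr_eq0 opprD addrA subrr add0r oppr_eq0 => /eqP.
have X0 : X 0 = 0.
  have := vfD X 0 0; rewrite addr0 => /eqP.
  by rewrite -subr_eq0 opprD addrA subrr add0r oppr_eq0 => /eqP.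
have -> : Cinf_cst M a = Cinf_cst M a * 1 + 0 by rewrite mulr1 addr0.
by rewrite vf_lin X1 X0 mulr0 addr0.
Qed.

Lemma vf_0 X : X 0 = 0. Proof.
by transitivity (X (Cinf_cst M 0)); [congr (X _); exact/CinfP|exact: vf_cst].
Qed.

Lemma vf_1 X : X 1 = 0.
Proof. by transitivity (X (Cinf_cst M 1)); [congr (X _); exact/CinfP|exact: vf_cst]. Qed.

Lemma vf_opp X f : X (- f) = - X f.
Proof.
have -> : - f = Cinf_cst M (-1) * f + 0 by apply/CinfP => p; rewrite evD evM /= mulN1r addr0.
by rewrite vf_lin vf_0 addr0; apply/CinfP => p; rewrite evM /= mulN1r.
Qed.

Lemma vf_sum X (I : Type) (r : seq I) P (F : I -> Cinf M) :
  X (\sum_(i <- r | P i) F i) = \sum_(i <- r | P i) X (F i).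
Proof. by rewrite (big_morph X (vfD X) (vf_0 X)). Qed.

End Evaluation.

(** * Local criteria for smoothness *)

Section Smooth_criteria.
Variables (R : realType) (n : nat) (M : manifold R n).

Lemma open_preim (T T' : topologicalType) (O : set T) (V : set T') (phi : T -> T') :
  open O -> open V -> (forall y, O y -> {for y, continuous phi}) ->
  open [set y | O y /\ V (phi y)].
Proof.
move=> oO oV cphi; rewrite openE => y [Oy Vy].
apply: filterI; first exact: open_nbhs_nbhs.
by apply: (cphi y Oy); exact: open_nbhs_nbhs.
Qed.

Lemma cimg_open (c : @chart R M n) : atlas M c -> open (cimg c).
Proof. by move=> /atlas_chart[[]]. Qed.

Lemma cdom_open (c : @chart R M n) : atlas M c -> open (cdom c).
Proof. by move=> /atlas_chart[[]]. Qed.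

Lemma cinvK (c : @chart R M n) p : atlas M c -> cdom c p -> cinv c (cmap c p) = p.
Proof. by move=> /atlas_chart[_ + _ _]; exact. Qed.

Lemma cimg_cinv (c : @chart R M n) y : atlas M c -> cimg c y ->
  cdom c (cinv c y) /\ cmap c (cinv c y) = y.
Proof. by move=> Ac [p cp <-]; rewrite cinvK. Qed.

Lemma cmap_img (c : @chart R M n) p : cdom c p -> cimg c (cmap c p).
Proof. by exists p. Qed.

Lemma cmap_cont (c : @chart R M n) p : atlas M c -> cdom c p -> {for p, continuous (cmap c)}.
Proof. by move=> /atlas_chart[_ _ + _]; exact. Qed.

Lemma cinv_cont (c : @chart R M n) y : atlas M c -> cimg c y -> {for y, continuous (cinv c)}.
Proof. by move=> /atlas_chart[_ _ _]; exact. Qed.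

Lemma smooth_chart (f : Cinf M) c : atlas M c -> smooth_on (cimg c) (f \o cinv c).
Proof. by case: f => f /= /asboolP sf Ac k; exact: sf. Qed.

(** Any other chart differs from the given one by a transition map, which is smooth by compatibility
    of the atlas; the chain rule applies on the overlap. *)
Lemma smooth_local (f : M -> R) :
  (forall p, exists c V, [/\ atlas M c, cdom c p, open V /\ V (cmap c p) &
     V `<=` cimg c /\ smooth_on V (f \o cinv c)]) -> f \in smooth M.
Proof.
move=> H; apply/asboolP => c' k Ac'; apply: Ck_local => x [p c'p <-].
have [c [V [Ac cp [oV Vp] [VI sf]]]] := H p.
pose O := [set y | cimg c' y /\ cdom c (cinv c' y)].
have oO : open O.
  apply: open_preim; [exact: cimg_open|exact: cdom_open|move=> y; exact: cinv_cont].
have OE : O `<=` cmap c' @` (cdom c' `&` cdom c).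
  by move=> y [[q c'q <-]]; rewrite cinvK// => cq; exists q.
pose phi y := cmap c (cinv c' y).
pose W := [set y | O y /\ V (phi y)].
have cphi y : O y -> {for y, continuous phi}.
  move=> [c'y cy]; apply: continuous_comp; first exact: cinv_cont.
  exact: cmap_cont.
have oW : open W by exact: open_preim.
exists W; split=> //.
  by rewrite /W /= /phi /O /= cinvK//; split=> //; split=> //; exact: cmap_img.
have sphi i : smooth_on W (fun y => phi y 0 i).
  move=> j; apply: (@Ck_sub _ _ _ (cmap c' @` (cdom c' `&` cdom c))).
    by move=> y [/OE].
  exact: (atlas_compatible Ac' Ac j i).
have WV y : W y -> V (phi y) by case.
have := smooth_on_comp oV oW WV sphi sf k.
apply: Ck_ext => // y [[c'y cy] _] /=.
by rewrite /phi cinvK.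
Qed.

(** Where r does not vanish, f is the product of r f with the smooth function 1/r; the multiplier
    may change from point to point. *)
Lemma smooth_div (f : M -> R) :
  (forall p, exists2 r : Cinf M, r p != 0 & (fun q => r q * f q) \in smooth M) ->
  f \in smooth M.
Proof.
move=> H; apply: smooth_local => p; have [r rp srf] := H p.
have [c Ac cp] := atlas_cover p.
pose V := [set y | cimg c y /\ [set~ 0] (r (cinv c y))].
have sr := smooth_chart r Ac.
have oV : open V.
  apply: (@open_preim _ _ (cimg c) [set~ 0] (r \o cinv c)).
  - exact: cimg_open.
  - by apply: closed_openC; apply: accessible_closed_set1; apply: hausdorff_accessible;
      exact: Rhausdorff.
  - by move=> y; exact: smooth_on_cont.
exists c, V; split=> //.
  by split=> //; split; [exact: cmap_img|rewrite /= cinvK//; exact/eqP].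
have VI : V `<=` cimg c by move=> y [].
split=> // k.
have r0 y : V y -> (r \o cinv c) y != 0 by move=> [_] /eqP.
have C1 := CkV oV r0 (smooth_on_sub VI sr k).
have C2 := smooth_on_sub VI (smooth_chart (MkCinf srf) Ac) k.
apply: Ck_ext (CkM oV C1 C2) => //.
by move=> y /r0 /= ry; rewrite mulrA mulVf// mul1r.
Qed.

End Smooth_criteria.

(** * Cutoff functions and local frames *)

Section Cutoff.
Variables (R : realType) (n : nat) (M : manifold R n).

Lemma mx_norm_le (v : 'rV[R]_n) r : 0 <= r -> (forall i, `|v 0 i| <= r) -> `|v| <= r.
Proof.
move=> r0 vr; rewrite [leLHS]/Num.norm /= mx_normrE; apply/bigmax_leP; split=> //.
by move=> [i j] _ /=; rewrite ord1.
Qed.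

(** The support is closed twice, in coordinate space and, carried back by [cinv], in M: the second
    makes extension by zero smooth at points outside the chart. [cut_dom] is convex because
    Hadamard's lemma needs segments. *)
Record cutoff (p : M) := Cutoff {
  cut_chart : @chart R M n;
  cut_dom : set 'rV[R]_n;
  cut_fun : 'rV[R]_n -> R;
  cut_supp : set 'rV[R]_n;
  cut_atlas : atlas M cut_chart;
  cut_center : cdom cut_chart p;
  cut_open : open cut_dom;
  cut_img : cut_dom `<=` cimg cut_chart;
  cut_conv : forall y z, cut_dom y -> cut_dom z ->
    forall u, u \in `[0, 1] -> cut_dom (u *: y + (1 - u) *: z);
  cut_smooth : smooth_on setT cut_fun;
  cut_neq0 : cut_fun (cmap cut_chart p) != 0;
  cut_suppP : forall y, cut_fun y != 0 -> cut_supp y;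
  cut_supp_dom : cut_supp `<=` cut_dom;
  cut_supp_closed : closed cut_supp;
  cut_supp_closedM : closed (cinv cut_chart @` cut_supp)
}.

(** The bump is supported in the closed ball of half the radius; this is compact, hence its image in
    the Hausdorff space M is closed. *)
Lemma cutoff_exists p : exists C : cutoff p, True.
Proof.
have [c Ac cp] := atlas_cover p; pose p0 := cmap c p.
have /nbhs_ballP[e /= e0 eI] : nbhs p0 (cimg c).
  by apply: open_nbhs_nbhs; split; [exact: cimg_open|exact: cmap_img].
have e20 : 0 < e / 2 by rewrite divr_gt0.
have [b [sb b0] bs] := bump p0 e20.
pose K := closed_ball p0 (e / 2).
have KE : K = [set y | `|p0 - y| <= e / 2] by rewrite /K closed_ballE.
have KB : K `<=` ball p0 e.
  rewrite KE => y /= Ky; rewrite -ball_normE /ball_ /= (le_lt_trans Ky)//.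
  by rewrite ltr_pdivrMr// ltr_pMr// ltr1n.
have cK : closed K by exact: closed_ball_closed.
have kK : compact K.
  apply: bounded_closed_compact => //; exists (`|p0| + e / 2); split.
    exact: num_real.
  rewrite KE => m ltm y /= Ky; apply: le_trans (ltW ltm).
  have -> : y = p0 - (p0 - y) by rewrite opprB addrCA subrr addr0.
  by rewrite (le_trans (ler_normB _ _))// lerD2l.
have ckK : closed (cinv c @` K).
  apply: compact_closed; first exact: points_hausdorff.
  apply: continuous_compact => //; apply: continuous_in_subspaceT => y.
  by rewrite inE => /KB/eI; exact: cinv_cont.
unshelve eexists (@Cutoff p c (ball p0 e) b K Ac cp (ball_open p0 e) eI _ sb b0 _ KB cK ckK) => //.
- move=> y z; rewrite -ball_normE /ball_ /= => yb zb u; rewrite in_itv /= => /andP[u0 u1].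
  have -> : p0 - (u *: y + (1 - u) *: z) = u *: (p0 - y) + (1 - u) *: (p0 - z).
    rewrite !scalerBr addrACA -scalerDl addrC.
    by rewrite [u + _]addrC subrK scale1r opprD addrC.
  have u1' : 0 <= 1 - u by rewrite subr_ge0.
  rewrite (le_lt_trans (ler_normD _ _))// !normrZ !ger0_norm//.
  (* Strictness of the estimate comes from the term with factor u, so u = 0 is treated apart. *)
  have [->|/eqP nu] := u =P 0; first by rewrite mul0r add0r subr0 mul1r.
  have -> : e = u * e + (1 - u) * e by rewrite -mulrDl addrC subrK mul1r.
  have up : 0 < u by rewrite lt_neqAle u0 eq_sym nu.
  by apply: ltr_leD; [rewrite ltr_pM2l|rewrite ler_wpM2l// ltW].
- move=> y /bs by0; rewrite KE /= mx_norm_le ?ltW// => i.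
  by rewrite !mxE distrC ltW.
Qed.

Variables (p : M) (C : cutoff p).
Let c := cut_chart C.
Let Ac : atlas M c := cut_atlas C.
Let B := cut_dom C.
Let b := cut_fun C.

Definition extend (g : 'rV[R]_n -> R) (m : M) : R :=
  if `[< cdom c m >] then b (cmap c m) * g (cmap c m) else 0.

Lemma cut_fun0 m : cdom c m -> ~ (cinv c @` cut_supp C) m -> b (cmap c m) = 0.
Proof.
move=> cm; apply: contra_notP => /eqP/cut_suppP sm; exists (cmap c m) => //.
exact: cinvK.
Qed.

Lemma cut_supp_cdom m : (cinv c @` cut_supp C) m -> cdom c m.
Proof. by move=> [y /cut_supp_dom/cut_img/(cimg_cinv Ac)[+ _] <-]. Qed.

(** Every point lies in the preimage of [B], where g is smooth, or off the closed support, where the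
    product vanishes. A is the identity for functions on M and a projection of coordinates for
    functions on the cylinder. *)
Lemma cut_mul_smooth k (U : set 'rV[R]_k) (A : 'rV[R]_k -> 'rV[R]_n) (g : 'rV[R]_k -> R) :
  open U -> continuous A ->
  smooth_on U (b \o A) -> smooth_on (U `&` A @^-1` B) g ->
  smooth_on U (fun y => b (A y) * g y).
Proof.
move=> oU cA sb sg j; apply: Ck_local => y Uy.
have [By|nBy] := pselect (B (A y)).
  have oV : open (U `&` A @^-1` B).
    by apply: openI => //; apply: open_comp; [move=> z _; exact: cA|exact: cut_open].
  by exists (U `&` A @^-1` B); split=> //; apply: CkM => //;
    apply: Ck_sub (sb j) => z [].
pose V := U `&` A @^-1` (~` cut_supp C).
have oV : open V.
  apply: openI => //; apply: open_comp; first by move=> z _; exact: cA.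
  by apply: closed_openC; exact: cut_supp_closed.
exists V; split=> //; first by split=> //= /cut_supp_dom.
apply: (@Ck_ext _ _ _ _ (cst 0)) => //; last exact: Ck_cst.
move=> z [_ /=]; have [->|/eqP/cut_suppP //] := b (A z) =P 0.
by rewrite mul0r.
Qed.

Lemma smooth_extend g : smooth_on B g -> extend g \in smooth M.
Proof.
move=> sg; apply: smooth_local => m.
have [cm|ncm] := pselect (cdom c m).
  exists c, (cimg c); split=> //; first by split; [exact: cimg_open|exact: cmap_img].
  split=> // k.
  apply: (@Ck_ext _ _ _ _ (fun y => b y * g y)); first exact: cimg_open.
    move=> y /(cimg_cinv Ac)[cy yK]; rewrite /= /extend yK ifT//; exact/asboolP.
  apply: (@cut_mul_smooth n (cimg c) id).
  - exact: cimg_open.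
  - by move=> y; exact: cvg_id.
  - exact: smooth_on_sub (@subsetT _ _) (cut_smooth C).
  - exact: smooth_on_sub (@subIsetr _ _ _) sg.
have [c' Ac' c'm] := atlas_cover m.
pose V := [set y | cimg c' y /\ (~` (cinv c @` cut_supp C)) (cinv c' y)].
have oV : open V.
  apply: open_preim; [exact: cimg_open| |by move=> y; exact: cinv_cont].
  by apply: closed_openC; exact: cut_supp_closedM.
exists c', V; split=> //.
  split=> //; split; first exact: cmap_img.
  by rewrite /= cinvK// => /cut_supp_cdom.
split; first by move=> y [].
move=> k; apply: (@Ck_ext _ _ _ _ (cst 0)) => //; last exact: Ck_cst.
move=> y [_ /= ny]; rewrite /extend; case: ifPn => // /asboolP cy.
by rewrite cut_fun0// mul0r.
Qed.

End Cutoff.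

Section Frame.
Variables (R : realType) (n : nat) (M : manifold R n) (p : M) (C : cutoff p).
Notation N := (cylinder M).
Let c := cut_chart C.
Let Ac : atlas M c := cut_atlas C.
Let B := cut_dom C.
Let b := cut_fun C.

Lemma smooth_on_coord i : smooth_on B (fun y => y 0 i).
Proof. by move=> k; exact: Ck_coord. Qed.

Lemma smooth_on_one : smooth_on B (fun=> 1).
Proof. by move=> k; exact: Ck_cst. Qed.

Lemma smooth_on_partial i (f : Cinf M) :
  smooth_on B ('D_(delta_mx 0 i) (f \o cinv c)).
Proof.
apply: smooth_on_derive; apply: smooth_on_sub (smooth_chart f Ac); exact: cut_img.
Qed.

Definition frame_cut : Cinf M := MkCinf (smooth_extend smooth_on_one).
Definition frame_coord i : Cinf M := MkCinf (smooth_extend (smooth_on_coord i)).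
Definition frame_partial i f : Cinf M := MkCinf (smooth_extend (smooth_on_partial i f)).

Lemma extendE (g : 'rV[R]_n -> R) m : cdom c m -> extend C g m = b (cmap c m) * g (cmap c m).
Proof. by move=> cm; rewrite /extend ifT//; exact/asboolP. Qed.

Lemma extend0 (g : 'rV[R]_n -> R) m : ~ cdom c m -> extend C g m = 0.
Proof. by move=> ncm; rewrite /extend ifF//; exact/asboolPn. Qed.

Lemma chart_derivable (f : Cinf M) m v : cdom c m -> derivable (f \o cinv c) (cmap c m) v.
Proof.
move=> cm; apply: smooth_on_derivable (smooth_chart f Ac) _; exact: cmap_img.
Qed.

Lemma frame_partial_subproof i : frame_partial i \in derivation M.
Proof.
apply/asboolP; split=> [a f g|f g]; apply/CinfP => m;
  rewrite !(evD, evM) ?ev_cst /=; (have [cm|ncm] := pselect (cdom c m);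
    last by rewrite !extend0// ?mulr0 ?mul0r addr0); rewrite !extendE//.
  have -> : (Cinf_cst M a * f + g) \o cinv c = a *: (f \o cinv c) + (g \o cinv c) by [].
  rewrite deriveD; [|exact/derivableZ/chart_derivable|exact: chart_derivable].
  rewrite deriveZ; last exact: chart_derivable.
  by rewrite /GRing.scale /=; ring.
have -> : (f * g) \o cinv c = (f \o cinv c) * (g \o cinv c) by [].
rewrite deriveM; [|exact: chart_derivable|exact: chart_derivable].
rewrite /GRing.scale /= cinvK//; ring.
Qed.

Definition frame_field i : vfield M := MkVfield (frame_partial_subproof i).

Lemma frame_fieldE i f m : frame_field i f m =
  extend C ('D_(delta_mx 0 i) (f \o cinv c)) m.
Proof. by []. Qed.

Lemma frame_cut_neq0 : frame_cut p != 0.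
Proof. by rewrite /= extendE ?mulr1; [exact: cut_neq0|exact: cut_center]. Qed.

(** Hadamard's lemma at the coordinates y' of a point q (a constant projection) gives chi^2 (f -
    f(q)) = \sum A_i h_i with A_i = chi (x_i - y'_i), an identity between global functions. Since f
    - f(q) and all A_i vanish at q, applying X there leaves chi^2 X f on one side and X(A_i) times
    [h i q], which is [frame_field i f q], on the other. *)
Lemma frame_spanning (X : vfield M) f :
  frame_cut ^+ 3 * X f =
  \sum_i (frame_cut * X (frame_coord i) - frame_coord i * X frame_cut) * frame_field i f.
Proof.
apply/CinfP => q; rewrite evM evX ev_sum.
(* Where the cutoff vanishes, so does each [frame_field i f]; elsewhere q lies in the chart and y'
   in the convex domain. *)
have [b0|b0] := eqVneq (frame_cut q) 0.
  rewrite b0 expr0n mul0r big1// => i _; rewrite evM frame_fieldE.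
  have [cq|ncq] := pselect (cdom c q); last by rewrite extend0// mulr0.
  by move: b0; rewrite /= !extendE// mulr1 => ->; rewrite mul0r mulr0.
have cq : cdom c q by apply: contrapT => ncq; move: b0; rewrite /= extend0// eqxx.
pose y' := cmap c q.
have bE : frame_cut q = b y' by rewrite /= extendE// mulr1.
have By' : B y' by apply/cut_supp_dom/cut_suppP; rewrite -/b -bE.
pose g := f \o cinv c.
have sg : smooth_on B g by apply: smooth_on_sub (smooth_chart f Ac); exact: cut_img.
have PL (h : R) (v x : 'rV[R]_n) : cst y' (h *: v + x) = h *: 0 + cst y' x.
  by rewrite scaler0 add0r.
have [H [sH gH Hy']] := hadamard PL (@cst_continuous _ _ y') (@cut_open _ _ _ _ C) (@cut_open _ _ _ _ C)
  (fun y By u u01 => cut_conv By By' u01) sg.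
pose A i := frame_coord i - Cinf_cst M (y' 0 i) * frame_cut.
pose h i := MkCinf (smooth_extend (sH i)).
have E : frame_cut * (frame_cut * (f - Cinf_cst M (f q))) = \sum_i A i * h i.
  apply/CinfP => m; rewrite evM evM evD evN ev_sum ev_cst.
  have [cm|ncm] := pselect (cdom c m); last first.
    have -> : frame_cut m = 0 by exact: extend0.
    rewrite mul0r big1// => i _; rewrite evM.
    by have -> : h i m = 0; [exact: extend0|rewrite mulr0].
  have [bm0|bm0] := eqVneq (b (cmap c m)) 0.
    have -> : frame_cut m = 0 by rewrite /= extendE// bm0 mul0r.
    rewrite mul0r big1// => i _; rewrite evM.
    by have -> : h i m = 0; [rewrite /= extendE// bm0 mul0r|rewrite mulr0].
  have Bm : B (cmap c m) by exact/cut_supp_dom/cut_suppP.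
  have gm : f m = f q + \sum_i (cmap c m - y') 0 i * H i (cmap c m).
    by have := gH _ Bm; rewrite /g /= !cinvK.
  rewrite gm [f q + _]addrC addrK !mulr_sumr; apply: eq_bigr => i _.
  rewrite evM /A evD evN evM ev_cst /= !extendE// !mxE; ring.
have Xq0 : (f - Cinf_cst M (f q)) q = 0 by rewrite evD evN ev_cst subrr.
have Aq0 i : A i q = 0.
  by rewrite /A evD evN evM ev_cst /= !extendE// -/y'; ring.
have LE : (X (frame_cut * (frame_cut * (f - Cinf_cst M (f q)))) : Cinf M) q =
    frame_cut q ^+ 2 * X f q.
  have XF : X (f - Cinf_cst M (f q)) = X f by rewrite vfD vf_opp vf_cst oppr0 addr0.
  rewrite !vf_mul XF !(evD, evM, evN) ev_cst; ring.
have RE : (X (\sum_i A i * h i) : Cinf M) q =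
    \sum_i (X (frame_coord i) q - y' 0 i * X frame_cut q) * frame_field i f q.
  rewrite vf_sum ev_sum; apply: eq_bigr => i _.
  have XA : X (A i) = X (frame_coord i) - Cinf_cst M (y' 0 i) * X frame_cut.
    by rewrite /A vfD vf_opp vf_mul vf_cst mul0r addr0.
  have hq : h i q = frame_field i f q by rewrite frame_fieldE /= !extendE// Hy'.
  by rewrite vf_mul evD !evM Aq0 mul0r add0r XA evD evN evM ev_cst hq.
rewrite exprS -mulrA -LE E RE mulr_sumr; apply: eq_bigr => i _.
rewrite evM evD evN !evM.
have -> : frame_coord i q = frame_cut q * y' 0 i by rewrite bE /= extendE.
ring.
Qed.

(** The quotient rule: [frame_field i] is chi d/dx_i and [frame_coord j] is chi x_j, so the left
    side is chi^3 times the i-th partial derivative of (chi x_j) / chi. *)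
Lemma frame_dual i j :
  frame_cut * frame_field i (frame_coord j) - frame_coord j * frame_field i frame_cut =
  frame_cut ^+ 3 *+ (i == j).
Proof.
apply/CinfP => q.
have -> : (frame_cut ^+ 3 *+ (i == j)) q = frame_cut q ^+ 3 * (i == j)%:R.
  by case: (i == j); rewrite ?mulr1n ?mulr1 ?mulr0n ?mulr0 ?evX.
rewrite evD evN !evM !frame_fieldE.
have [cq|ncq] := pselect (cdom c q); last first.
  by rewrite /= !extend0// expr0n /= !mul0r subrr.
have Iq : cimg c (cmap c q) by exact: cmap_img.
have nI : nbhs (cmap c q) (cimg c) by apply: open_nbhs_nbhs; split=> //; exact: cimg_open.
have sb y v : derivable b y v by apply: smooth_on_derivable (cut_smooth C) _.
have E g (sg : smooth_on B g) v :
    'D_v (MkCinf (smooth_extend sg) \o cinv c) (cmap c q) = 'D_v (fun y => b y * g y) (cmap c q).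
  apply: near_eq_derive; apply: filterS nI => y /(cimg_cinv Ac)[cy yK].
  by rewrite /= extendE// yK.
rewrite !extendE// !E /= !extendE// !mulr1.
have dc k : derivable (fun x : 'rV[R]_n => x 0 k) (cmap c q) (delta_mx 0 i).
  exact: (derive_coord k _).2.
have -> : (fun y : 'rV[R]_n => b y * 1) = b by apply/funext => y; rewrite mulr1.
have -> : (fun y : 'rV[R]_n => b y * y 0 j) = b * (fun y => y 0 j) by [].
rewrite deriveM//.
rewrite (congr1 (fun F => F (cmap c q)) (derive_coord j (delta_mx 0 i : 'rV[R]_n)).1).
by rewrite /= mxE eqxx /= /GRing.scale /= eq_sym; ring.
Qed.

(** In a product chart the derivative of a slice along x_i is that of f along (e_i, 0), which is
    smooth in all variables; near a point outside the chart the cutoff makes everything vanish. *)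
Lemma smooth_frame_slice i (f : Cinf N) :
  (fun q : N => frame_field i (slice q.2 f) q.1) \in smooth N.
Proof.
apply: smooth_local => -[m t].
have [cm|ncm] := pselect (cdom c m).
  pose cN := cyl_chart c.
  have AcN : atlas N cN by exists c.
  have oI : open (cimg cN) by exact: (@cimg_open _ _ N).
  exists cN, (cimg cN); split=> //; first by split=> //; exact: (@cmap_img _ _ N).
  split=> // k.
  apply: (@Ck_ext _ _ _ _ (fun y => b (lsubmx y) *
     'D_(row_mx (delta_mx 0 i) 0) (f \o cinv cN) y)) => //.
    move=> y Iy.
    change (b (lsubmx y) * 'D_(row_mx (delta_mx 0 i) 0) (f \o cinv cN) y =
      extend C ('D_(delta_mx 0 i) (slice (rsubmx y 0 0) f \o cinv c)) (cinv c (lsubmx y))).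
    have [cy yK] := @cimg_cinv _ _ N _ _ AcN Iy.
    have ly : cmap c (cinv c (lsubmx y)) = lsubmx y.
      by move: yK => /(congr1 lsubmx); rewrite /= row_mxKl.
    rewrite extendE// ly; congr (_ * _).
    pose A (x : 'rV[R]_n) := row_mx x ((rsubmx y 0 0)%:M : 'M[R]_1).
    pose L (x : 'rV[R]_n) := row_mx x (0 : 'M[R]_1).
    have AL h v x : A (h *: v + x) = h *: L v + A x.
      by rewrite /A /L scale_row_mx add_row_mx scaler0 add0r.
    have Ay : A (lsubmx y) = y by rewrite /A -mx11_scalar hsubmxK.
    have [dE _] := derive_affine (f \o cinv cN) (delta_mx 0 i) AL.
    have -> : slice (rsubmx y 0 0) f \o cinv c = (f \o cinv cN) \o A.
      by apply/funext => x; rewrite /= /A row_mxKl row_mxKr [_%:M 0 0]mxE eqxx mulr1n.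
    by rewrite (congr1 (fun F => F (lsubmx y)) dE) /= Ay.
  apply: (@cut_mul_smooth _ _ _ _ C _ (cimg cN) (@lsubmx R 1 n 1)) => //.
  - exact: lsubmx_cont.
  - move=> j; apply: (Ck_affine (@lsubmx_affine R n) (@lsubmx_cont _ _ _) _ (cut_smooth C j)).
    by [].
  - apply: smooth_on_sub (@subIsetl _ _ _) _.
    apply: smooth_on_derive; exact: (@smooth_chart _ _ N).
have [c' Ac' c'm] := atlas_cover m.
pose cN := cyl_chart c'.
have AcN : atlas N cN by exists c'.
have oI : open (cimg cN) by exact: (@cimg_open _ _ N).
pose K := cinv c @` cut_supp C.
pose V := [set y | cimg cN y /\ (fst @^-1` (~` K)) (cinv cN y)].
have oV : open V.
  apply: open_preim => //; last by move=> y; exact: (@cinv_cont _ _ N).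
  apply: open_comp => [q _|]; first exact: cvg_fst.
  by apply: closed_openC; exact: cut_supp_closedM.
exists cN, V; split=> //.
  split=> //; split; first exact: (@cmap_img _ _ N).
  by rewrite /= row_mxKl cinvK// => /cut_supp_cdom.
split; first by move=> y [].
move=> k; apply: (@Ck_ext _ _ _ _ (cst 0)) => //; last exact: Ck_cst.
move=> y [_ /= ny].
change (0 = extend C ('D_(delta_mx 0 i) (slice (rsubmx y 0 0) f \o cinv c))
  (cinv c' (lsubmx y))).
have [cy|ncy] := pselect (cdom c (cinv c' (lsubmx y))); last by rewrite extend0.
by rewrite extendE// /b cut_fun0// mul0r.
Qed.

End Frame.

Section Local_frame.
Variables (R : realType) (n : nat) (M : manifold R n).
Notation N := (cylinder M).

(* With chi a cutoff around p, u i = chi x_i and E i = chi d/dx_i in a chart, so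
   that chi * X (u i) - u i * X chi = chi^2 X(x_i). *)
Lemma local_frame (p : M) : exists (chi : Cinf M) (u : 'I_n -> Cinf M) (E : 'I_n -> vfield M),
  [/\ chi p != 0,
      forall (X : vfield M) (f : Cinf M), chi ^+ 3 * X f =
        \sum_i (chi * X (u i) - u i * X chi) * E i f,
      forall i j, chi * E i (u j) - u j * E i chi = chi ^+ 3 *+ (i == j) &
      forall i (f : Cinf N), (fun q : N => E i (slice q.2 f) q.1) \in smooth N].
Proof.
have [C _] := cutoff_exists p.
exists (frame_cut C), (frame_coord C), (frame_field C); split.
- exact: frame_cut_neq0.
- exact: frame_spanning.
- exact: frame_dual.
- exact: smooth_frame_slice.
Qed.

End Local_frame.

(** * Function-linear functionals and the field dual to a 1-form *)

Section Linear_functionals.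
Variables (R : realType) (n : nat) (M : manifold R n).
Implicit Types (f h : Cinf M) (X Y : vfield M) (p : M).

Definition lin (Q : vfield M -> Cinf M) := forall h X Y, Q (h *: X + Y) = h * Q X + Q Y.

Lemma lin_form1 (w : form1 M) : lin w. Proof. exact: form1_lin. Qed.

Lemma lin_vf f : lin (fun X => X f). Proof. by []. Qed.

Section Lin.
Variable Q : vfield M -> Cinf M.
Hypothesis linQ : lin Q.

Lemma linD X Y : Q (X + Y) = Q X + Q Y.
Proof. by rewrite -{1}[X]scale1r linQ mul1r. Qed.

Lemma lin0 : Q 0 = 0.
Proof. by have /eqP := linD 0 0; rewrite addr0 -subr_eq0 opprD addrA subrr add0r oppr_eq0 => /eqP. Qed.

Lemma linZ h X : Q (h *: X) = h * Q X.
Proof. by rewrite -[h *: X]addr0 linQ lin0 addr0. Qed.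

Lemma linN X : Q (- X) = - Q X.
Proof. by rewrite -scaleN1r linZ mulN1r. Qed.

Lemma linB X Y : Q (X - Y) = Q X - Q Y.
Proof. by rewrite linD linN. Qed.

Lemma lin_sum (I : Type) (r : seq I) P (F : I -> vfield M) :
  Q (\sum_(i <- r | P i) F i) = \sum_(i <- r | P i) Q (F i).
Proof. by rewrite (big_morph Q linD lin0). Qed.

End Lin.

Lemma frame_vf chi (u : 'I_n -> Cinf M) (E : 'I_n -> vfield M) :
  (forall X f, chi ^+ 3 * X f = \sum_i (chi * X (u i) - u i * X chi) * E i f) ->
  forall X, chi ^+ 3 *: X = \sum_i (chi * X (u i) - u i * X chi : Cinf M) *: E i.
Proof.
by move=> H X; apply/vfieldP => f; rewrite vf_scaleE H vf_sumE.
Qed.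

(** Multiplied by chi^3, X is a combination of frame fields whose global coefficients vanish at p,
    and Q passes through them. *)
Lemma lin_tensorial Q p X : lin Q -> (forall f, X f p = 0) -> Q X p = 0.
Proof.
move=> linQ X0; have [chi [u [E [chi0 /frame_vf span _ _]]]] := local_frame p.
have /(congr1 Q) := span X; rewrite (linZ linQ) (lin_sum linQ) => /(congr1 (fun f : Cinf M => f p)).
rewrite evM evX ev_sum big1 => [/eqP|i _].
  by rewrite mulf_eq0 expf_eq0 /= (negbTE chi0) => /eqP.
by rewrite (linZ linQ) evM evD evN !evM !X0 !mulr0 subrr mul0r.
Qed.

Definition bilin (l : tensor2 M) := (forall Y, lin (l^~ Y)) /\ (forall X, lin (l X)).

Lemma riemannian_bilin (g : tensor2 M) : riemannian g -> bilin g.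
Proof.
move=> [gl gs _ _]; split=> [Y h X X'|X h Y Y']; first exact: gl.
by rewrite gs gl !(gs X).
Qed.

Lemma form2_bilin l : form2 l -> bilin l.
Proof.
move=> [ll la]; split=> [Y h X X'|X h Y Y']; first exact: ll.
by rewrite la ll !(la X) opprD mulrN.
Qed.

Lemma ev_det (A : 'M[Cinf M]_n) p : (\det A) p = \det (map_mx (fun f => f p) A).
Proof.
rewrite /determinant ev_sum; apply: eq_bigr => s _; rewrite evM ev_prod; congr (_ * _).
  by rewrite evX evN ev1.
by apply: eq_bigr => i _; rewrite mxE.
Qed.

Section Musical.
Variable g : tensor2 M.
Hypothesis rg : riemannian g.
Let bg := riemannian_bilin rg.
Let gl Y := bg.1 Y.
Let gr X := bg.2 X.

Lemma riemannian_eq0 X p : (forall Y, g X Y p = 0) -> forall f, X f p = 0.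
Proof. by move=> X0; have [_ _ _ H] := rg; apply: H; exact: X0. Qed.

Lemma musical_local (a : form1 M) p : exists (W : vfield M) (d : Cinf M),
  d p != 0 /\ forall Y, g W Y = d * a Y.
Proof.
have [chi [u [E [chi0 /frame_vf span dual _]]]] := local_frame p.
pose G := \matrix_(i < n, j < n) g (E i) (E j).
pose W0 := \sum_i \sum_j (a (E i) * (\adj G) i j : Cinf M) *: E j.
have W0E k : g W0 (E k) = \det G * a (E k).
  rewrite /W0 (lin_sum (gl _)) -/G.
  transitivity (\sum_i (a (E i) : Cinf M) * (\adj G *m G) i k).
    apply: eq_bigr => i _; rewrite (lin_sum (gl _)) [X in _ = _ * X]mxE mulr_sumr.
    by apply: eq_bigr => j _; rewrite (linZ (gl _)) [G _ _]mxE mulrA.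
  rewrite mul_adj_mx (bigD1 k)//= big1 ?addr0 => [|i ik].
    by rewrite mxE eqxx mulr1n mulrC.
  by rewrite mxE (negbTE ik) mulr0n mulr0.
exists (chi ^+ 3 *: W0), (chi ^+ 3 * \det G); split.
  (* A kernel vector v of G at p yields a field X orthogonal at p to the frame, hence to everything,
     so X vanishes at p; duality of the frame with the u_j then forces v = 0. *)
  rewrite evM evX mulf_neq0 ?expf_neq0// ev_det; apply/det0P => -[v v0 vG].
  pose X := \sum_i Cinf_cst M (v 0 i) *: E i.
  have X0 : forall f, X f p = 0.
    apply: riemannian_eq0 => Y.
    have EX k : g X (E k) p = 0.
      move/matrixP/(_ 0 k): vG; rewrite !mxE => <-.
      rewrite /X (lin_sum (gl _)) ev_sum; apply: eq_bigr => i _.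
      by rewrite (linZ (gl _)) evM ev_cst !mxE.
    have := congr1 (fun h : Cinf M => h p) (congr1 (g X) (span Y)).
    rewrite (linZ (gr _)) (lin_sum (gr _)) evM ev_sum big1 => [/eqP|k _].
      by rewrite evX mulf_eq0 expf_eq0 /= (negbTE chi0) => /eqP.
    by rewrite (linZ (gr _)) evM EX mulr0.
  case/eqP: v0; apply/rowP => j; rewrite mxE.
  have : (chi * X (u j) - u j * X chi : Cinf M) p = v 0 j * chi p ^+ 3.
    have -> : chi * X (u j) - u j * X chi = \sum_i Cinf_cst M (v 0 i) *
        (chi * E i (u j) - u j * E i chi).
      rewrite /X !vf_sumE !mulr_sumr -sumrB; apply: eq_bigr => i _.
      by rewrite !vf_scaleE; ring.
    under eq_bigr do rewrite dual.
    rewrite (bigD1 j)// big1 ?addr0 => [|i ij].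
      by rewrite eqxx mulr1n -evX; exact: addr0.
    by rewrite (negbTE ij) mulr0n mulr0.
  rewrite evD evN !evM !X0 !mulr0 subrr => /esym/eqP.
  by rewrite mulf_eq0 expf_eq0 /= (negbTE chi0) orbF => /eqP.
move=> Y; rewrite (linZ (gl _)) -(linZ (gr _)) span (lin_sum (gr _)).
transitivity (\sum_i (\det G * a ((chi * Y (u i) - u i * Y chi : Cinf M) *: E i) : Cinf M)).
  apply: eq_bigr => i _; rewrite (linZ (gr _)) W0E (linZ (lin_form1 a)); ring.
rewrite -mulr_sumr -(lin_sum (lin_form1 a)) -span (linZ (lin_form1 a)); ring.
Qed.

(** By definiteness the local solutions divided by their factors d agree at common points, so the
    value at m may be taken from the solution chosen for m itself; [dV] expresses this without
    division and feeds [smooth_div]. *)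
Lemma musical (a : form1 M) : exists W : vfield M, forall Y, g W Y = a Y.
Proof.
have [W HW] := choice (musical_local a).
have [d Hd] := choice HW.
have d0 p : d p p != 0 by case: (Hd p).
have gW p Y : g (W p) Y = d p * a Y by case: (Hd p).
pose V (f : Cinf M) (m : M) : R := W m f m / d m m.
have dV p f q : d p q * V f q = W p f q.
  have := @riemannian_eq0 (Cinf_cst M (d p q) *: W q - Cinf_cst M (d q q) *: W p) q _ f.
  rewrite vf_addE vf_oppE !vf_scaleE evD evN !evM !ev_cst => H.
  have -> : d p q * V f q = (d p q * W q f q) / d q q by rewrite /V mulrA.
  have /eqP -> : d p q * W q f q == d q q * W p f q.
    rewrite -subr_eq0 H// => Y.
    by rewrite (linB (gl _)) !(linZ (gl _)) evD evN !evM !gW !evM !ev_cst; ring.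
  by rewrite mulrAC mulfV ?mul1r.
have sV f : V f \in smooth M.
  apply: smooth_div => p; exists (d p); first exact: d0.
  have -> : (fun q => d p q * V f q) = (W p f : Cinf M) by apply/funext => q; exact: dV.
  by case: (W p f : Cinf M).
have derV : (fun f => MkCinf (sV f)) \in derivation M.
  apply/asboolP; split=> [c f h|f h]; apply/CinfP => q.
    change (V (Cinf_cst M c * f + h) q = c * V f q + V h q).
    by rewrite /V vf_lin evD evM ev_cst mulrDl mulrA.
  change (V (f * h) q = f q * V h q + V f q * h q).
  by rewrite /V vf_mul evD !evM; ring.
exists (MkVfield derV) => Y; apply/CinfP => q; apply: (mulfI (d0 q)).
have E : d q *: MkVfield derV = W q.
  by apply/vfieldP => f; apply/CinfP => m; rewrite -(dV q f m).
by have := congr1 (fun f : Cinf M => f q) (gW q Y); rewrite -E (linZ (gl _)) !evM.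
Qed.

End Musical.
End Linear_functionals.

(** * Vector fields and forms on the cylinder *)

Section Cylinder_fields.
Variables (R : realType) (n : nat) (M : manifold R n).
Notation N := (cylinder M).
Implicit Types (f : Cinf N) (g : Cinf M) (X Y : vfield M) (W : vfield N).

Lemma cyl_img (c : @chart R M n) x : cimg (cyl_chart c) x = cimg c (lsubmx x).
Proof. by rewrite /cimg (cyl_chart_img _ (cdom c)). Qed.

(** The quotient is defined globally, with the value of d/dt f at s = t. Hadamard's lemma relative
    to the projection onto t = const in a product chart serves to show that it is smooth. *)
Lemma slice_hadamard f (t : R) : exists h : Cinf N,
  (forall p s, f (p, s) = f (p, t) + (s - t) * h (p, s)) /\
  (forall p, h (p, t) = ddt M f (p, t)).
Proof.
pose h (q : N) : R := if q.2 == t then ddt M f q else (f q - f (q.1, t)) / (q.2 - t).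
suff sh : h \in smooth N.
  exists (MkCinf sh); split=> [p s|p] /=; rewrite /h /=; last by rewrite eqxx.
  have [->|st] := eqVneq s t; first by rewrite subrr mul0r addr0.
  by rewrite mulrCA mulfV ?subr_eq0// mulr1 addrC subrK.
apply: smooth_local => q; have [c Ac cq] := @atlas_cover _ _ M q.1.
pose cN := cyl_chart c; have AcN : atlas N cN by exists c.
have oI : open (cimg cN) by exact: (@cimg_open _ _ N).
exists cN, (cimg cN); split=> //; first by split=> //; exact: (@cmap_img _ _ N).
split=> //.
pose P (y : 'rV[R]_(n + 1)) : 'rV[R]_(n + 1) := row_mx (lsubmx y) (t%:M : 'M[R]_1).
pose L (y : 'rV[R]_(n + 1)) : 'rV[R]_(n + 1) := row_mx (lsubmx y) (0 : 'M[R]_1).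
have PL a v x : P (a *: v + x) = a *: L v + P x.
  by rewrite /P /L linearP scale_row_mx add_row_mx scaler0 add0r.
have cP : continuous P.
  move=> x; apply: (@cvg_row_mx _ _ _ _ (@lsubmx R 1 n 1) (fun=> t%:M) x).
    exact: lsubmx_cont.
  exact: cst_continuous.
have segI y : cimg cN y -> forall u, u \in `[0, 1] -> cimg cN (seg P u y).
  move=> Iy u _; rewrite cyl_img /seg linearD /= !linearZ /= row_mxKl -scalerDl.
  by rewrite addrC subrK scale1r -cyl_img.
pose F := f \o cinv cN.
have sF : smooth_on (cimg cN) F by exact: (@smooth_chart _ _ N).
have [H [sH FH HP]] := hadamard PL cP oI oI segI sF.
pose e : 'I_(n + 1) := rshift n 0.
have yP y : y - P y = row_mx 0 ((rsubmx y 0 0 - t)%:M : 'M[R]_1).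
  rewrite -{1}[y]hsubmxK /P opp_row_mx add_row_mx subrr; congr row_mx.
  by rewrite {1}[rsubmx y]mx11_scalar -raddfB.
move=> k; apply: (@Ck_ext _ _ _ _ (H e)) => //; last exact: sH.
move=> y Iy; rewrite /= /h /=.
have fy : f (cinv c (lsubmx y), rsubmx y 0 0) =
    f (cinv c (lsubmx y), t) + (rsubmx y 0 0 - t) * H e y.
  have := FH y Iy; rewrite /F /= {1}/P => ->; congr (_ + _).
    by rewrite /P row_mxKl row_mxKr mxE eqxx mulr1n.
  rewrite big_split_ord /= big1 ?add0r => [|i _].
    by rewrite big_ord1 yP row_mxEr mxE eqxx mulr1n.
  by rewrite yP row_mxEl mxE mul0r.
case: eqP => [st|/eqP st]; last first.
  by rewrite fy [f _ + _]addrC addrK mulrAC mulfV ?mul1r// subr_eq0.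
have Py : P y = y.
  by apply/esym/eqP; rewrite -subr_eq0 yP st subrr raddf0 row_mx0.
rewrite (HP e y Iy Py) -/(cinv cN y).
change ('D_(delta_mx 0 e) F y = d_time f (cinv cN y)).
rewrite d_timeE; congr ('D_ _ _ _).
apply/rowP => i; rewrite -(fintype.splitK i); case: (fintype.split i) => j /=.
  by rewrite row_mxEl !mxE /= /e; case: eqP => // /eqP; rewrite eq_lrshift.
by rewrite row_mxEr !mxE !ord1 /e !eqxx.
Qed.

Lemma pull_slice_time f t : exists2 h : Cinf N,
  f = pull (slice t f) + (time M - Cinf_cst N t) * h & forall p, h (p, t) = ddt M f (p, t).
Proof.
have [h [Hh ht]] := slice_hadamard f t; exists h => //.
by apply/CinfP => -[p s]; exact: Hh.
Qed.

(** W is applied to f = pull (slice t f) + (time - t) h. On the slice only W(time) h survives of the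
    last product, and h equals d/dt f there. *)
Lemma vf_decomp W f p t :
  W f (p, t) = hpart W t (slice t f) p + W (time M) (p, t) * ddt M f (p, t).
Proof.
have [h fE ht] := pull_slice_time f t.
have tt : (time M - Cinf_cst N t) (p, t) = 0 by exact: subrr.
rewrite {1}fE vfD vf_mul vfD vf_opp vf_cst oppr0 addr0 evD evD !evM.
by rewrite tt mul0r add0r ht.
Qed.

End Cylinder_fields.

(** * Lifting fields and tensors from M to the cylinder *)

Section Lift.
Variables (R : realType) (n : nat) (M : manifold R n).
Notation N := (cylinder M).
Implicit Types (f : Cinf N) (g h : Cinf M) (X Y : vfield M) (W V : vfield N).

Lemma CinfN_smooth (F : Cinf N) : (F : N -> R) \in smooth N.
Proof. by case: F. Qed.

Lemma pullE g p t : pull g (p, t) = g p. Proof. by []. Qed.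
Lemma sliceE f t p : slice t f p = f (p, t). Proof. by []. Qed.

Lemma CinfNP f f' : (forall p t, f (p, t) = f' (p, t)) -> f = f'.
Proof. by move=> ff; apply/CinfP => -[p t]. Qed.

Lemma slice_pull t g : slice t (pull g) = g.
Proof. exact/CinfP. Qed.

Lemma pullD g h : pull (g + h) = pull g + pull h. Proof. exact/CinfP. Qed.
Lemma pullN g : pull (- g) = - pull g. Proof. exact/CinfP. Qed.
Lemma pullM g h : pull (g * h) = pull g * pull h. Proof. exact/CinfP. Qed.
Lemma pull0 : pull (0 : Cinf M) = 0. Proof. exact/CinfP. Qed.
Lemma pull_1 : pull (1 : Cinf M) = 1. Proof. exact/CinfP. Qed.

(** The slice of f varies with t; joint smoothness comes from the frame derivatives of slices in
    [local_frame]. *)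
Lemma smooth_lift X f : (fun q : N => X (slice q.2 f) q.1) \in smooth N.
Proof.
apply: smooth_div => -[p t].
have [chi [u [E [chi0 span _ sE]]]] := local_frame p.
exists (pull (chi ^+ 3)); first by rewrite pullE evX expf_neq0.
pose F : Cinf N := \sum_i pull (chi * X (u i) - u i * X chi) * MkCinf (sE i f).
have -> : (fun q : N => pull (chi ^+ 3) q * X (slice q.2 f) q.1) = F.
  apply/funext => -[m s]; rewrite /F ev_sum.
  change ((chi ^+ 3 * X (slice s f) : Cinf M) m = \sum_i (pull
    (chi * X (u i) - u i * X chi) * MkCinf (sE i f)) (m, s)).
  by rewrite span ev_sum.
exact: CinfN_smooth.
Qed.

Lemma lift_subproof X : (fun f => MkCinf (smooth_lift X f)) \in derivation N.
Proof.
apply/asboolP; split=> [a f f'|f f']; apply: CinfNP => p t.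
  have E : slice t (Cinf_cst N a * f + f') = Cinf_cst M a * slice t f + slice t f'.
    exact/CinfP.
  have := congr1 (fun F : Cinf M => F p) (vf_lin X a (slice t f) (slice t f')).
  by rewrite -E.
have E : slice t (f * f') = slice t f * slice t f' by exact/CinfP.
have := congr1 (fun F : Cinf M => F p) (vf_mul X (slice t f) (slice t f')).
by rewrite -E.
Qed.

Definition lift X : vfield N := MkVfield (lift_subproof X).

Lemma liftE X f p t : lift X f (p, t) = X (slice t f) p. Proof. by []. Qed.

Lemma slice_lift X f t : slice t (lift X f) = X (slice t f).
Proof. exact/CinfP. Qed.

Lemma lift_pull X g : lift X (pull g) = pull (X g).
Proof. by apply: CinfNP => p t; rewrite liftE slice_pull. Qed.

Lemma lift_time X : lift X (time M) = 0.
Proof.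
apply: CinfNP => p t; rewrite liftE.
have -> : slice t (time M) = Cinf_cst M t by exact/CinfP.
by rewrite vf_cst.
Qed.

Lemma lift_lin h X Y : lift (h *: X + Y) = pull h *: lift X + lift Y.
Proof. by apply/vfieldP => f; apply: CinfNP. Qed.

Lemma liftD X Y : lift (X + Y) = lift X + lift Y.
Proof. by apply/vfieldP => f; apply: CinfNP. Qed.

Lemma liftN X : lift (- X) = - lift X.
Proof. by apply/vfieldP => f; apply: CinfNP. Qed.

Lemma liftZ h X : lift (h *: X) = pull h *: lift X.
Proof. by apply/vfieldP => f; apply: CinfNP. Qed.

Lemma lift0 : lift 0 = 0.
Proof. by apply/vfieldP => f; apply: CinfNP. Qed.

Lemma ddt_pull g : ddt M (pull g) = 0.
Proof.
apply: CinfNP => p t; change ('D_1 (fun _ : R => g p) t = 0).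
by rewrite (derive_cst (g p)).
Qed.

Lemma ddt_time : ddt M (time M) = 1.
Proof.
by apply: CinfNP => p t; change ('D_1 (@id R) t = 1); rewrite derive_id.
Qed.

Lemma hpart_pull W t g p : hpart W t g p = W (pull g) (p, t). Proof. by []. Qed.

Lemma hpart_lift X t : hpart (lift X) t = X.
Proof. by apply/vfieldP => g; apply/CinfP => p; rewrite hpart_pull lift_pull. Qed.

Lemma hpart_ddt t : hpart (ddt M) t = 0.
Proof. by apply/vfieldP => g; apply/CinfP => p; rewrite hpart_pull ddt_pull. Qed.

Lemma hpart_lin f W V t : hpart (f *: W + V) t = slice t f *: hpart W t + hpart V t.
Proof. by apply/vfieldP => g; apply/CinfP. Qed.

Lemma vfieldN_ext W V : (forall g, W (pull g) = V (pull g)) -> W (time M) = V (time M) -> W = V.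
Proof.
move=> WV Wt; apply/vfieldP => f; apply: CinfNP => p t; rewrite (vf_decomp W) (vf_decomp V) Wt; congr (_ + _).
by rewrite !hpart_pull WV.
Qed.

Lemma brE (X' Y' : vfield N) f : bracket X' Y' f = X' (Y' f) - Y' (X' f). Proof. by []. Qed.

Lemma bracket_lift X Y : bracket (lift X) (lift Y) = lift (bracket X Y).
Proof.
by apply/vfieldP => f; apply: CinfNP => p t; rewrite brE evD evN !liftE !slice_lift.
Qed.

Lemma bracket_ddt_lift X : bracket (ddt M) (lift X) = 0.
Proof.
apply: vfieldN_ext => [g|]; rewrite brE.
  by rewrite lift_pull !ddt_pull vf_0 subrr.
by rewrite lift_time ddt_time vf_0 vf_1 subrr.
Qed.

Lemma cyl_frame p : exists (chi : Cinf M) (u : 'I_n -> Cinf M) (E : 'I_n -> vfield M),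
  chi p != 0 /\ forall W, pull (chi ^+ 3) *: W =
    \sum_i (pull chi * W (pull (u i)) - pull (u i) * W (pull chi) : Cinf N) *: lift (E i)
    + (pull (chi ^+ 3) * W (time M) : Cinf N) *: ddt M.
Proof.
have [chi [u [E [chi0 span _ _]]]] := local_frame p.
exists chi, u, E; split=> // W; apply/vfieldP => f; apply: CinfNP => m t.
rewrite vf_scaleE evM (vf_decomp W) vf_addE evD vf_sumE ev_sum vf_scaleE !evM mulrDr.
congr (_ + _); last by rewrite mulrA.
have := congr1 (fun F : Cinf M => F m) (span (hpart W t) (slice t f)).
by rewrite evM ev_sum => E1; rewrite pullE E1.
Qed.

(** Near each point chi^3 W is a combination of lifts and d/dt over the smooth functions. This
    principle replaces coordinates in the tensor identities on the cylinder. *)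
Lemma cyl_ind (Q : vfield N -> Cinf N) : lin Q ->
  (forall X, Q (lift X) = 0) -> Q (ddt M) = 0 -> forall W, Q W = 0.
Proof.
move=> linQ QX Qt W; apply: CinfNP => p t.
have [chi [u [E [chi0 span]]]] := cyl_frame p.
have := congr1 Q (span W); rewrite (linZ linQ) (linD linQ) (lin_sum linQ) (linZ linQ) Qt mulr0.
rewrite addr0 big1 => [|i _]; last by rewrite (linZ linQ) QX mulr0.
move=> /(congr1 (fun F : Cinf N => F (p, t))); rewrite evM pullE evX => /eqP.
by rewrite mulf_eq0 expf_eq0 /= (negbTE chi0) => /eqP.
Qed.

Lemma smooth_pull1 (Q : vfield M -> Cinf M) W : lin Q ->
  (fun q : N => Q (hpart W q.2) q.1) \in smooth N.
Proof.
move=> linQ; apply: smooth_div => -[p t].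
have [chi [u [E [chi0 span _ sE]]]] := local_frame p.
exists (pull (chi ^+ 3)); first by rewrite pullE evX expf_neq0.
pose F : Cinf N := \sum_i (pull chi * W (pull (u i)) - pull (u i) * W (pull chi)) *
  pull (Q (E i)).
have -> : (fun q : N => pull (chi ^+ 3) q * Q (hpart W q.2) q.1) = F.
  apply/funext => -[m s]; rewrite /F ev_sum.
  have := congr1 (fun X => Q X m) (frame_vf span (hpart W s)).
  by rewrite (linZ linQ) (lin_sum linQ) evM ev_sum => E1; rewrite pullE E1;
    apply: eq_bigr => i _; rewrite (linZ linQ).
exact: CinfN_smooth.
Qed.

(** Only the first argument is expanded in the frame; [smooth_pull1] handles the second slot with
    E_i fixed in the first. *)
Lemma smooth_pull2 (l : tensor2 M) W V : bilin l ->
  (fun q : N => l (hpart W q.2) (hpart V q.2) q.1) \in smooth N.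
Proof.
move=> [ll lr]; apply: smooth_div => -[p t].
have [chi [u [E [chi0 span _ sE]]]] := local_frame p.
exists (pull (chi ^+ 3)); first by rewrite pullE evX expf_neq0.
pose F : Cinf N := \sum_i (pull chi * W (pull (u i)) - pull (u i) * W (pull chi)) *
  MkCinf (smooth_pull1 V (lr (E i))).
have -> : (fun q : N => pull (chi ^+ 3) q * l (hpart W q.2) (hpart V q.2) q.1) = F.
  apply/funext => -[m s]; rewrite /F ev_sum.
  have := congr1 (fun X => l X (hpart V s) m) (frame_vf span (hpart W s)).
  by rewrite (linZ (ll _)) (lin_sum (ll _)) evM ev_sum => E1; rewrite pullE E1;
    apply: eq_bigr => i _; rewrite (linZ (ll _)).
exact: CinfN_smooth.
Qed.

Lemma smooth_expt : (fun q : N => expR q.2) \in smooth N.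
Proof.
apply/asboolP => c k Ac.
apply: (@smooth_on_uni _ _ _ expR (time M \o cinv c)).
- exact: (@cimg_open _ _ N).
- by move=> j; exact: smooth1_expR.
- exact: (@smooth_chart _ _ N).
Qed.

Definition expt : Cinf N := MkCinf smooth_expt.

Lemma ddt_expt : ddt M expt = expt.
Proof.
apply: CinfNP => p t; change ('D_1 (@expR R) t = expR t).
by have [_ ->] := is_derive_expR t.
Qed.

Lemma lift_expt X : lift X expt = 0.
Proof.
apply: CinfNP => p t; rewrite liftE.
have -> : slice t expt = Cinf_cst M (expR t) by exact/CinfP.
by rewrite vf_cst.
Qed.

(** A function with zero derivative is constant along each line over p. This makes translation
    invariant coefficients descend to M. *)
Lemma ddt_eq0 f : ddt M f = 0 -> f = pull (slice 0 f).
Proof.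
move=> f0; apply: CinfNP => p t.
apply: (@is_derive_0_is_cst R (fun s : R => f (p, s)) t 0) => s.
split; first exact: (@derivable_time _ _ M f (p, s)).
exact: (congr1 (fun F : Cinf N => F (p, s)) f0).
Qed.

End Lift.

(** * Generalized complex structures and bihermitian data *)

Section Bracket.
Variables (R : realType) (n : nat) (M : manifold R n).
Implicit Types (f h : Cinf M) (X Y V : vfield M) (l : tensor2 M) (x y z : tbig M).

Lemma bracketE X Y f : bracket X Y f = X (Y f) - Y (X f). Proof. by []. Qed.

Lemma bracketC X Y : bracket X Y = - bracket Y X.
Proof. by apply/vfieldP => f; rewrite vf_oppE !bracketE opprB. Qed.

Lemma bracketDr X Y V : bracket X (Y + V) = bracket X Y + bracket X V.
Proof.
by apply/vfieldP => f; rewrite vf_addE !bracketE !vf_addE vfD; ring.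
Qed.

Lemma bracketDl X Y V : bracket (Y + V) X = bracket Y X + bracket V X.
Proof. by rewrite bracketC bracketDr opprD -!(bracketC _ X). Qed.

Lemma bracketZr X h Y : bracket X (h *: Y) = h *: bracket X Y + (X h : Cinf M) *: Y.
Proof.
apply/vfieldP => f; rewrite vf_addE !vf_scaleE !bracketE !vf_scaleE vf_mul; ring.
Qed.

Lemma bracketZl X h Y : bracket (h *: Y) X = h *: bracket Y X - (X h : Cinf M) *: Y.
Proof. by rewrite bracketC bracketZr opprD -scalerN -bracketC. Qed.

Lemma bracketNr X Y : bracket X (- Y) = - bracket X Y.
Proof.
apply/vfieldP => f; rewrite vf_oppE !bracketE !vf_oppE vf_opp; ring.
Qed.

Lemma bracketNl X Y : bracket (- Y) X = - bracket Y X.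
Proof. by rewrite bracketC bracketNr -bracketC. Qed.

Lemma bracket0r X : bracket X 0 = 0.
Proof. by apply/vfieldP => f; rewrite bracketE !vf_0E vf_0 subrr. Qed.

Section Exterior.
Variable l : tensor2 M.
Hypothesis fl : form2 l.
Let la := fl.2.
Let ll Y := (form2_bilin fl).1 Y.
Let lr X := (form2_bilin fl).2 X.

Lemma d2_cycle X Y V : d2 l Y V X = d2 l X Y V.
Proof.
rewrite /d2 (la V X) (la Y X) (bracketC Y X) (bracketC V X) !(linN (ll _)) !vf_opp; ring.
Qed.

Lemma d2_anti X Y V : d2 l X V Y = - d2 l X Y V.
Proof.
rewrite /d2 (la V Y) (bracketC V Y) (linN (ll _)) vf_opp; ring.
Qed.

Lemma d2_lin X Y : lin (d2 l X Y).
Proof.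
move=> h V V'; rewrite /d2 !(lr _ h V V') !bracketDr !bracketZr.
rewrite !(linD (ll _), linZ (ll _)) !(vfD, vf_mul) vf_addE vf_scaleE.
rewrite (la V X) (la V Y); ring.
Qed.

Lemma d2_lin1 Y V : lin (fun X => d2 l X Y V).
Proof. by move=> h X X'; rewrite -!(d2_cycle _ Y V) d2_lin. Qed.

Lemma d2_lin2 X V : lin (fun Y => d2 l X Y V).
Proof.
by move=> h Y Y'; rewrite -[d2 l X (_ + _) V]opprK -d2_anti d2_lin !(d2_anti X V); ring.
Qed.

End Exterior.

Definition half : Cinf M := Cinf_cst M 2^-1.

Lemma half2 : half = half * half + half * half.
Proof. by apply/CinfP => p; rewrite evD !evM ev_cst; field. Qed.

Lemma half_half : half + half = 1.
Proof. by apply/CinfP => p; rewrite evD ev_cst ev1; field. Qed.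

Lemma vf_half X f : X (half * f) = half * X f.
Proof. by rewrite vf_mul vf_cst mul0r addr0. Qed.

Lemma pairingE x y : pairing x y = half * (x.2 y.1 + y.2 x.1).
Proof. by []. Qed.

Lemma pairingC x y : pairing x y = pairing y x.
Proof. by rewrite !pairingE addrC. Qed.

Lemma pairing_lin z h x y : pairing (h *: x + y) z = h * pairing x z + pairing y z.
Proof.
transitivity (half * ((h * x.2 z.1 + y.2 z.1) + z.2 (h *: x.1 + y.1))); first by [].
rewrite lin_form1 !pairingE; ring.
Qed.

Lemma pairingDl z x y : pairing (x + y) z = pairing x z + pairing y z.
Proof. by rewrite -[x]scale1r pairing_lin mul1r scale1r. Qed.

Lemma pairingDr z x y : pairing z (x + y) = pairing z x + pairing z y.
Proof. by rewrite !(pairingC z) pairingDl. Qed.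

Lemma pairing0l z : pairing 0 z = 0.
Proof.
have /eqP := pairingDl z 0 0.
by rewrite addr0 -subr_eq0 opprD addrA subrr add0r oppr_eq0 => /eqP.
Qed.

Lemma pairingNl z x : pairing (- x) z = - pairing x z.
Proof. by apply/eqP; rewrite -subr_eq0 opprK -pairingDl addNr pairing0l. Qed.

Lemma pairingNr z x : pairing z (- x) = - pairing z x.
Proof. by rewrite !(pairingC z) pairingNl. Qed.

(** The test sections (0, df) and (Y, 0) detect the two components, a vector field being determined
    by its values on functions. *)
Lemma pairing_nondeg x : (forall z, pairing x z = 0) -> x = 0.
Proof.
have half0 f : half * f = 0 -> f = 0.
  by move=> f0; rewrite -[f]mul1r -half_half mulrDl f0 addr0.
move=> x0; case: x x0 => X a x0; congr (_, _).
  apply/vfieldP => f; have := x0 (0, dfun f); rewrite pairingE /= => /half0.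
  by rewrite (lin0 (lin_form1 a)) add0r.
apply/form1P => Y; have H : half * ((a Y : Cinf M) + 0) = 0 := x0 (Y, 0).
by rewrite addr0 in H; exact: half0.
Qed.

Lemma courant2E x y V : (courant x y).2 V =
  x.1 (y.2 V) - y.2 (bracket x.1 V) - (y.1 (x.2 V) - x.2 (bracket y.1 V))
  + half * V (x.2 y.1 - y.2 x.1).
Proof. by []. Qed.

Lemma tbigP x y : x.1 = y.1 -> (forall V, x.2 V = y.2 V) -> x = y.
Proof. by case: x => X a; case: y => Y b /= -> ab; congr (_, _); apply/form1P. Qed.

Lemma courantC x y : courant y x = - courant x y.
Proof.
apply: tbigP; first exact: bracketC.
move=> V; transitivity (- (courant x y).2 V : Cinf M); last by [].
by rewrite !courant2E -(opprB (x.2 y.1)) vf_opp; ring.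
Qed.

Lemma courantDr x y z : courant x (y + z) = courant x y + courant x z.
Proof.
apply: tbigP; first exact: bracketDr.
move=> V; transitivity ((courant x y).2 V + (courant x z).2 V : Cinf M); last by [].
rewrite !courant2E.
transitivity (x.1 (y.2 V + z.2 V) - (y.2 (bracket x.1 V) + z.2 (bracket x.1 V))
  - ((y.1 + z.1) (x.2 V) - x.2 (bracket (y.1 + z.1) V))
  + half * V (x.2 (y.1 + z.1) - (y.2 x.1 + z.2 x.1))); first by [].
rewrite bracketDl !(linD (lin_form1 x.2)) vf_addE !(vfD, vf_opp); ring.
Qed.

Lemma courantNr x y : courant x (- y) = - courant x y.
Proof.
apply: tbigP; first exact: bracketNr.
move=> V; transitivity (- (courant x y).2 V : Cinf M); last by [].
rewrite !courant2E.
transitivity (x.1 (- y.2 V) - (- y.2 (bracket x.1 V))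
  - ((- y.1) (x.2 V) - x.2 (bracket (- y.1) V))
  + half * V (x.2 (- y.1) - (- y.2 x.1))); first by [].
rewrite bracketNl !(linN (lin_form1 x.2)) vf_oppE !(vfD, vf_opp); ring.
Qed.

Lemma courantNl x y : courant (- y) x = - courant y x.
Proof. by rewrite courantC courantNr -courantC. Qed.

(** The skew bracket preserves the pairing only up to the last two terms, derivatives of pairings
    with x; they cancel when four such identities are combined in [nij_skew]. *)
Lemma courant_pairing x y z :
  pairing (courant x y) z + pairing y (courant x z) =
  x.1 (pairing y z) - half * z.1 (pairing x y) - half * y.1 (pairing x z).
Proof.
rewrite !pairingE !courant2E /= !vf_half !(vfD, vf_opp).
rewrite (bracketC z.1 y.1) (linN (lin_form1 x.2)).
apply/eqP; rewrite -subr_eq0; apply/eqP.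
transitivity ((half - (half * half + half * half)) *
  (- (z.1 (x.2 y.1) + y.1 (x.2 z.1)) : Cinf M)); first ring.
by rewrite -half2 subrr mul0r.
Qed.

End Bracket.

(** * The Courant-Nijenhuis tensor and the eigenbundles of S *)

Section Nijenhuis.
Variables (R : realType) (n : nat) (M : manifold R n).
Implicit Types (x y z : tbig M) (Phi : tbig M -> tbig M).

Definition nij Phi x y :=
  courant (Phi x) (Phi y) - Phi (courant (Phi x) y + courant x (Phi y)) - courant x y.

Section Fixed_Phi.
Variable Phi : tbig M -> tbig M.
Hypothesis PL : linear Phi.
Hypothesis PS : forall x y, pairing (Phi x) y = - pairing x (Phi y).
Hypothesis PP : forall x, Phi (Phi x) = - x.

Lemma tlinD x y : Phi (x + y) = Phi x + Phi y.
Proof. by have := PL 1 x y; rewrite !scale1r. Qed.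

Lemma tlin0 : Phi 0 = 0.
Proof. by have /eqP := tlinD 0 0; rewrite addr0 -subr_eq0 opprD addrA subrr add0r oppr_eq0 => /eqP. Qed.

Lemma tlinZ h x : Phi (h *: x) = h *: Phi x.
Proof. by rewrite -[h *: x]addr0 PL tlin0 addr0. Qed.

Lemma tlinN x : Phi (- x) = - Phi x.
Proof. by rewrite -scaleN1r tlinZ scaleN1r. Qed.

(** The eigensections are exactly z - sqrt(-1) Phi z; for the bracket of two of them, membership in
    the eigenbundle is the vanishing of [nij]. *)
Lemma gc_nij : (forall u v, ieigen Phi u -> ieigen Phi v -> ieigen Phi (ccourant u v)) <->
  forall x y, nij Phi x y = 0.
Proof.
split=> [H x y|H [u1 u2] [v1 v2] [/= Pu1 Pu2] [/= Pv1 Pv2]].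
  have E z : ieigen Phi (z, - Phi z) by split; rewrite /= ?opprK// tlinN PP opprK.
  have [_] := H _ _ (E x) (E y); rewrite /ccourant /= !(courantNl, courantNr) !opprK => H2.
  by rewrite /nij -tlinN opprD (addrC (- _)) H2 addrCA subrr addr0 subrr.
have u2E : u2 = - Phi u1 by rewrite Pu1 opprK.
have v2E : v2 = - Phi v1 by rewrite Pv1 opprK.
have A1 : courant u1 v1 - courant u2 v2 = - Phi (courant (Phi u1) v1 + courant u1 (Phi v1)).
  rewrite u2E v2E courantNl courantNr !opprK; apply/eqP.
  by rewrite -subr_eq0 opprK -oppr_eq0 -(H u1 v1) /nij opprD opprB addrAC.
have A2 : courant u1 v2 + courant u2 v1 = - (courant (Phi u1) v1 + courant u1 (Phi v1)).
  by rewrite u2E v2E courantNl courantNr opprD addrC.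
by split; rewrite /ccourant /= A1 A2 tlinN ?PP ?opprK.
Qed.

Lemma nij_anti x y : nij Phi y x = - nij Phi x y.
Proof.
have E : courant (Phi y) x + courant y (Phi x) = - (courant (Phi x) y + courant x (Phi y)).
  by rewrite (courantC x) (courantC (Phi x)) -opprD addrC.
by rewrite /nij E tlinN (courantC (Phi x) (Phi y)) (courantC x y) !opprD.
Qed.

Lemma pairing_Phi x y : pairing (Phi x) (Phi y) = pairing x y.
Proof. by rewrite PS PP pairingNr opprK. Qed.

(** The identities [courant_pairing] with Phi on two of the three places are added and the one with
    Phi on none is subtracted; as Phi is skew and orthogonal, the right sides cancel. *)
Lemma nij_skew x y z : pairing (nij Phi x y) z = - pairing y (nij Phi x z).
Proof.
have T1 := courant_pairing (Phi x) (Phi y) z.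
have T2 := courant_pairing (Phi x) y (Phi z).
have T3 := courant_pairing x (Phi y) (Phi z).
have T4 := courant_pairing x y z.
have S1 : pairing (Phi y) z = - pairing y (Phi z) := PS y z.
have S2 : pairing (Phi x) z = - pairing x (Phi z) := PS x z.
have S3 : pairing (Phi x) y = - pairing x (Phi y) := PS x y.
rewrite S1 S2 !pairing_Phi !vf_opp in T1.
rewrite S3 !pairing_Phi !vf_opp in T2.
rewrite !pairing_Phi in T3.
have PSr A : pairing y (Phi A) = - pairing (Phi y) A by rewrite PS opprK.
rewrite /nij !(pairingDl, pairingDr, pairingNl, pairingNr) PS PSr !(pairingDl, pairingDr).
apply/eqP; rewrite -subr_eq0; apply/eqP.
transitivity ((pairing (courant (Phi x) (Phi y)) z + pairing (Phi y) (courant (Phi x) z))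
  + (pairing (courant (Phi x) y) (Phi z) + pairing y (courant (Phi x) (Phi z)))
  + (pairing (courant x (Phi y)) (Phi z) + pairing (Phi y) (courant x (Phi z)))
  - (pairing (courant x y) z + pairing y (courant x z))); first ring.
rewrite T1 T2 T3 T4; ring.
Qed.

End Fixed_Phi.

Section Splitting.
Variables (S Phi : tbig M -> tbig M).
Hypothesis SL : linear S.
Hypothesis SS : forall x, S (S x) = x.
Hypothesis Sg : forall x y, pairing (S x) (S y) = pairing x y.
Hypothesis PL : linear Phi.
Hypothesis PS : forall x y, pairing (Phi x) y = - pairing x (Phi y).
Hypothesis PP : forall x, Phi (Phi x) = - x.
Hypothesis PSC : forall x, Phi (S x) = S (Phi x).

Definition eigen (b : bool) x := S x = (-1) ^+ b *: x.

Lemma eigen_part (b : bool) x : eigen b (half M *: (x + (-1) ^+ b *: S x)).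
Proof.
rewrite /eigen (tlinZ SL) (tlinD SL) (tlinZ SL) SS [RHS]scalerA [_ * half M]mulrC -[RHS]scalerA.
by congr (_ *: _); rewrite scalerDr scalerA -expr2 sqrr_sign scale1r addrC.
Qed.

Lemma eigen_split x : exists x1 x2, [/\ eigen false x1, eigen true x2 & x = x1 + x2].
Proof.
exists (half M *: (x + (-1) ^+ false *: S x)), (half M *: (x + (-1) ^+ true *: S x)).
split; try exact: eigen_part.
rewrite -scalerDr expr0 expr1 scale1r scaleN1r addrACA subrr addr0 scalerDr.
by rewrite -scalerDl half_half scale1r.
Qed.

Lemma eigenN b x : eigen b x -> eigen b (- x).
Proof. by rewrite /eigen (tlinN SL) => ->; rewrite scalerN. Qed.

Lemma eigen_Phi b x : eigen b x -> eigen b (Phi x).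
Proof. by rewrite /eigen -PSC => ->; rewrite (tlinZ PL). Qed.

Lemma SPhi_skew x y : pairing ((S \o Phi) x) y = - pairing x ((S \o Phi) y).
Proof.
by rewrite /= -[y in LHS]SS Sg PS PSC.
Qed.

Lemma SPhi_sq x : (S \o Phi) ((S \o Phi) x) = - x.
Proof. by rewrite /= PSC PP (tlinN SL) (tlinN SL) SS. Qed.

Lemma SPhi_lin : linear (S \o Phi).
Proof. by move=> a x y; rewrite /= PL SL. Qed.

(* The trilinear form (x, y, z) |-> <nij x y, z> is totally skew, and two of
   three eigenvectors belong to the same sign. *)
Lemma nij_eigen Psi : linear Psi ->
  (forall x y, pairing (Psi x) y = - pairing x (Psi y)) ->
  (forall x, Psi (Psi x) = - x) ->
  (forall b x y, eigen b x -> eigen b y -> nij Psi x y = 0) ->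
  forall x y, nij Psi x y = 0.
Proof.
move=> QL QS QP H.
have nD x y z : nij Psi x (y + z) = nij Psi x y + nij Psi x z.
  have E : courant (Psi x) (y + z) + courant x (Psi (y + z)) =
      (courant (Psi x) y + courant x (Psi y)) + (courant (Psi x) z + courant x (Psi z)).
    by rewrite (tlinD QL) !courantDr addrACA.
  rewrite /nij E (tlinD QL (_ + _)) (tlinD QL y) (courantDr (Psi x)) (courantDr x) !opprD.
  by rewrite (addrACA (courant (Psi x) (Psi y))) (addrACA (courant (Psi x) (Psi y) - _)).
have nDl x y z : nij Psi (y + z) x = nij Psi y x + nij Psi z x.
  by rewrite nij_anti// nD opprD -!(nij_anti QL x).
have K b1 b2 b3 x y z : eigen b1 x -> eigen b2 y -> eigen b3 z -> pairing (nij Psi x y) z = 0.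
  move=> ex ey ez; have [E|ne] := eqVneq b1 b2.
    by rewrite (H b1) ?pairing0l// E.
  have [E|ne'] := eqVneq b2 b3.
    rewrite nij_anti// pairingNl nij_skew// opprK (H b2)// ?E//.
    by rewrite pairingC pairing0l.
  have E : b1 = b3 by case: b1 b2 b3 ne ne' {ex ey ez} => -[] [].
  have xz : nij Psi x z = 0 by apply: (H b1) => //; rewrite E.
  by rewrite nij_skew// xz pairingC pairing0l oppr0.
move=> x y; apply: pairing_nondeg => z.
have [x1 [x2 [ex1 ex2 ->]]] := eigen_split x.
have [y1 [y2 [ey1 ey2 ->]]] := eigen_split y.
have [z1 [z2 [ez1 ez2 ->]]] := eigen_split z.
have pl a b c : pairing a c = 0 -> pairing b c = 0 -> pairing (a + b) c = 0.
  by move=> pa pb; rewrite pairingDl pa pb addr0.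
have pr a b c : pairing c a = 0 -> pairing c b = 0 -> pairing c (a + b) = 0.
  by move=> pa pb; rewrite pairingDr pa pb addr0.
rewrite nDl !nD; do 2!apply: (pl _ _ _); apply: (pr _ _ _); apply: (K _ _ _ _ _ _); eassumption.
Qed.

Definition nij_r x y := courant (Phi x) (Phi y) - courant x y.
Definition nij_u x y := courant (Phi x) y + courant x (Phi y).

(** On V_b the endomorphism [S \o Phi] is s Phi with s = (-1)^b, so the two tensors are r - Phi u
    and r - s S (Phi u). Both vanish exactly when r = Phi u and r is fixed by s S. *)
Lemma nij_sign b x y : eigen b x -> eigen b y ->
  (nij Phi x y = 0 /\ nij (S \o Phi) x y = 0) <->
  (eigen b (nij_r x y) /\ nij_r x y = Phi (nij_u x y)).
Proof.
move=> ex ey; have s2 : (-1) ^+ b * (-1) ^+ b = 1 :> Cinf M by rewrite -expr2 sqrr_sign.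
have SP z : eigen b z -> (S \o Phi) z = (-1) ^+ b *: Phi z.
  by move=> /eigen_Phi.
have E1 : nij Phi x y = nij_r x y - Phi (nij_u x y).
  by rewrite /nij /nij_r /nij_u addrAC.
have cZr z1 z2 : courant z1 ((-1) ^+ b *: z2) = (-1) ^+ b *: courant z1 z2.
  by case: (b); rewrite ?expr0 ?expr1 ?scale1r// !scaleN1r courantNr.
have cZl z1 z2 : courant ((-1) ^+ b *: z1) z2 = (-1) ^+ b *: courant z1 z2.
  by case: (b); rewrite ?expr0 ?expr1 ?scale1r// !scaleN1r courantNl.
have E2 : nij (S \o Phi) x y = nij_r x y - (-1) ^+ b *: S (Phi (nij_u x y)).
  rewrite /nij (SP x ex) (SP y ey) (cZr ((-1) ^+ b *: Phi x)) (cZl (Phi x) (Phi y)) scalerA s2 scale1r cZl cZr -scalerDr (tlinZ SPhi_lin).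
  by rewrite /nij_r /nij_u addrAC.
rewrite E1 E2; split=> [[/eqP + /eqP]|[er ru]].
  rewrite !subr_eq0 => /eqP ru /eqP rs; split=> //.
  by rewrite /eigen [in RHS]rs scalerA s2 scale1r -ru.
by rewrite -ru er scalerA s2 scale1r subrr.
Qed.

End Splitting.
End Nijenhuis.

(** The elimination behind [d3_equiv]: h is dPsi(JX, JY, JV) and k0 is d omega(X, Y, V); p, q, r are
    values of dPsi with one J and k1, k2, k3 values of d omega with two. Twice the sum of the first
    three equations minus the sum of the next three cancels p, q, r, and the type identity turns the
    k_i into k0; this leaves the coefficient 6. *)
Lemma type_combination (A : comPzRingType) (s h p q r k0 k1 k2 k3 : A) :
  h - p + s * (k2 + k3) = 0 -> h - q + s * (k1 + k2) = 0 -> h - r + s * (k3 + k1) = 0 ->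
  - r - q + s * (- k0 + k1) = 0 -> - p - r + s * (- k0 + k3) = 0 ->
  - q - p + s * (- k0 + k2) = 0 -> k1 + k2 + k3 = k0 -> 6%:R * (h + s * k0) = 0.
Proof.
move=> a1 a2 a3 b1 b2 b3 t.
transitivity (2%:R * ((h - p + s * (k2 + k3)) + (h - q + s * (k1 + k2)) +
    (h - r + s * (k3 + k1))) - ((- r - q + s * (- k0 + k1)) + (- p - r + s * (- k0 + k3)) +
    (- q - p + s * (- k0 + k2))) - 3%:R * s * (k1 + k2 + k3 - k0)); first ring.
rewrite a1 a2 a3 b1 b2 b3 t; ring.
Qed.

(** * One sign: an almost complex structure orthogonal for Gam *)

Section Hermitian.
Variables (R : realType) (n : nat) (M : manifold R n).
Implicit Types (X Y V : vfield M) (f : Cinf M).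

Definition sgn (b : bool) : Cinf M := Cinf_cst M ((-1) ^+ b).

Lemma sgnE (b : bool) : (-1) ^+ b = sgn b.
Proof. by apply/CinfP => p; rewrite evX evN ev1. Qed.

Lemma sgn2 (b : bool) : sgn b * sgn b = 1.
Proof. by rewrite -sgnE -expr2 sqrr_sign. Qed.

Lemma vf_sgn X (b : bool) f : X (sgn b * f) = sgn b * X f.
Proof. by rewrite vf_mul vf_cst mul0r addr0. Qed.

Variables (Gam Psi : tensor2 M).
Hypothesis bG : bilin Gam.
Hypothesis sG : forall X Y, Gam X Y = Gam Y X.
Hypothesis fP : form2 Psi.
Let gl Y := bG.1 Y.
Let gr X := bG.2 X.
Let pa := fP.2.
Let pl Y := (form2_bilin fP).1 Y.
Let pr X := (form2_bilin fP).2 X.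

Lemma flat_subproof (b : bool) X :
  (fun Y => Psi X Y + sgn b * Gam X Y) \in one_form M.
Proof.
apply/asboolP => h Y Y'.
change (Psi X (h *: Y + Y') + sgn b * Gam X (h *: Y + Y') =
  h * (Psi X Y + sgn b * Gam X Y) + (Psi X Y' + sgn b * Gam X Y')).
rewrite pr gr; ring.
Qed.

Definition flat b X : form1 M := MkForm1 (flat_subproof b X).

(** This is (L_X i(Y)Gam - L_Y i(X)Gam)(V), the contribution of Gam to the Courant bracket of two
    sections of V_b. *)
Definition gform X Y V : Cinf M :=
  X (Gam Y V) - Gam Y (bracket X V) - Y (Gam X V) + Gam X (bracket Y V).

(** Gam is symmetric, so the exact term of the bracket sees only Psi; with the Lie derivatives of
    i(X)Psi and i(Y)Psi it assembles into i([X, Y])Psi and a contraction of dPsi. *)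
Lemma courant_flat b X Y V :
  (courant (X, flat b X) (Y, flat b Y)).2 V =
  d2 Psi X Y V + Psi (bracket X Y) V + sgn b * gform X Y V.
Proof.
rewrite courant2E /=.
have -> : Psi X Y + sgn b * Gam X Y - (Psi Y X + sgn b * Gam Y X) = Psi X Y + Psi X Y.
  by rewrite (pa Y X) (sG Y X); ring.
rewrite !(vfD, vf_sgn) /gform /d2 (pa (bracket X V) Y) (pa (bracket Y V) X).
have -> : half M * (V (Psi X Y) + V (Psi X Y)) = V (Psi X Y).
  by rewrite mulrDr -mulrDl half_half mul1r.
ring.
Qed.

Section Complex.
Variable J : vfield M -> vfield M.
Hypothesis JL : linear J.
Hypothesis JJ : forall X, J (J X) = - X.
Hypothesis JG : forall X Y, Gam (J X) (J Y) = Gam X Y.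

Lemma JD X Y : J (X + Y) = J X + J Y.
Proof. by have := JL 1 X Y; rewrite !scale1r. Qed.

Lemma J0 : J 0 = 0.
Proof. by have /eqP := JD 0 0; rewrite addr0 -subr_eq0 opprD addrA subrr add0r oppr_eq0 => /eqP. Qed.

Lemma JZ f X : J (f *: X) = f *: J X.
Proof. by rewrite -[f *: X]addr0 JL J0 addr0. Qed.

Lemma JN X : J (- X) = - J X.
Proof. by rewrite -scaleN1r JZ scaleN1r. Qed.

Definition om : tensor2 M := fun X Y => Gam (J X) Y.

Lemma JGl X Y : Gam (J X) Y = - Gam (J Y) X.
Proof. by rewrite -JG JJ (linN (gl _)) sG. Qed.

Lemma om_form2 : form2 om.
Proof.
split; last exact: JGl.
by move=> h X Y V; rewrite /om JL gl.
Qed.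

(** [gform] is not tensorial, but the combinations that occur in [nij_r] and [nij_u] differ from
    values of d omega only by omega of the matching combination of brackets. *)
Lemma gform_r X Y V : gform (J X) (J Y) V - gform X Y V =
  om (bracket (J X) Y + bracket X (J Y)) V + d2 om (J X) Y V + d2 om X (J Y) V.
Proof.
rewrite /gform /d2 /om JD (linD (gl _)) !JJ !(linN (gl _)) !vf_opp.
rewrite (JGl (bracket (J X) V)) (JGl (bracket (J Y) V)).
rewrite (JGl (bracket X V)) (JGl (bracket Y V)) !JJ !(linN (gl _)) JG; ring.
Qed.

Lemma gform_u X Y V : gform (J X) Y V + gform X (J Y) V =
  - om (bracket (J X) (J Y) - bracket X Y) V - d2 om (J X) (J Y) V + d2 om X Y V.
Proof.
rewrite /gform /d2 /om JD JN (linD (gl _)) !JJ !(linN (gl _)) !vf_opp.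
rewrite (JGl (bracket (J X) V)) (JGl (bracket (J Y) V)).
rewrite (JGl (bracket X V)) (JGl (bracket Y V)) !JJ !(linN (gl _)).
have -> : Gam X (J Y) = - Gam (J X) Y by rewrite sG JGl.
rewrite vf_opp; ring.
Qed.

(* For an integrable J, d om has no component of type (3,0) + (0,3). *)
Lemma d_om_type : Defs.integrable J -> forall X Y V,
  d2 om (J X) (J Y) V + d2 om (J X) Y (J V) + d2 om X (J Y) (J V) = d2 om X Y V.
Proof.
move=> IJ X Y V.
have B U W : bracket (J U) (J W) = J (bracket (J U) W) + J (bracket U (J W)) + bracket U W.
  have /eqP := IJ U W; rewrite !subr_eq add0r => /eqP ->.
  by rewrite addrC (addrC (bracket U W)) addrA.
rewrite /d2 !B /om !(JD, linD (gl _)) !JJ !(linN (gl _)) !JG.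
have E U W : Gam U (J W) = - Gam (J U) W by rewrite sG JGl.
by rewrite !E !vf_opp; ring.
Qed.

(** From right to left, J is inserted into the arguments and the type identity for d omega is used
    once. From left to right, six instances of the hypothesis with J on one argument, brought to a
    common order by cyclic symmetry, are eliminated by [type_combination]. *)
Lemma d3_equiv b : Defs.integrable J ->
  (forall X Y V, d2 Psi (J X) (J Y) V - d2 Psi X Y V +
     sgn b * (d2 om (J X) Y V + d2 om X (J Y) V) = 0) <->
  (forall X Y V, d2 Psi (J X) (J Y) (J V) = - sgn b * d2 om X Y V).
Proof.
move=> IJ; have T := d_om_type IJ.
have fo := om_form2.
have HC X Y V := d2_cycle fP X Y V; have KC X Y V := d2_cycle fo X Y V.
have HN1 X Y V : d2 Psi (- X) Y V = - d2 Psi X Y V := linN (d2_lin1 fP Y V) X.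
have HN2 X Y V : d2 Psi X (- Y) V = - d2 Psi X Y V := linN (d2_lin2 fP X V) Y.
have HN3 X Y V : d2 Psi X Y (- V) = - d2 Psi X Y V := linN (d2_lin fP X Y) V.
have KN1 X Y V : d2 om (- X) Y V = - d2 om X Y V := linN (d2_lin1 fo Y V) X.
have KN2 X Y V : d2 om X (- Y) V = - d2 om X Y V := linN (d2_lin2 fo X V) Y.
have KN3 X Y V : d2 om X Y (- V) = - d2 om X Y V := linN (d2_lin fo X Y) V.
split=> A X Y V; last first.
  have E1 : d2 Psi (J X) (J Y) V = sgn b * d2 om X Y (J V).
    by have := A X Y (J V); rewrite JJ HN3 mulNr => /oppr_inj.
  have E2 : d2 Psi X Y V = sgn b * d2 om (J X) (J Y) (J V).
    by have := A (J X) (J Y) (J V); rewrite !JJ HN1 HN2 HN3 opprK mulNr => /oppr_inj.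
  have T3 := T (J X) (J Y) (J V); rewrite !JJ !(KN1, KN2, KN3) in T3.
  rewrite E1 E2 -T3; ring.
have a1 := A X Y (J V).
have a2 := A Y V (J X); rewrite (HC (J X) (J Y)) (HC (J X) Y) (KC (J X) (J Y)) (KC (J X) Y) in a2.
have a3 := A V X (J Y); rewrite -(HC (J V) (J X)) -(HC V X) -(KC (J V) X) -(KC V (J X)) in a3.
have b1 := A (J X) Y V; rewrite JJ HN1 KN1 in b1.
have b2 := A (J Y) V X; rewrite JJ HN1 KN1 (HC X Y) (HC X (J Y)) (KC X Y) (KC X (J Y)) in b2.
have b3 := A (J V) X Y; rewrite JJ HN1 KN1 -(HC V (J X)) -(HC (J V) X) -(KC V X) -(KC (J V) (J X)) in b3.
have t := T X Y V.
have s6 := type_combination a1 a2 a3 b1 b2 b3 (T X Y V).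
apply/eqP; rewrite mulNr -subr_eq0 opprK; apply/eqP.
transitivity (Cinf_cst M 6%:R^-1 * (6%:R * (d2 Psi (J X) (J Y) (J V) + sgn b * d2 om X Y V))).
  rewrite mulrA -[LHS]mul1r; congr (_ * _); apply/CinfP => p; rewrite evM ev_cst ev1.
  have natE k : (k%:R : Cinf M) p = k%:R by elim: k => [|k IH] //; rewrite !mulrS evD IH.
  by rewrite natE; field.
by rewrite s6 mulr0.
Qed.

End Complex.
End Hermitian.

(** * Both signs together *)

Section Bihermitian.
Variables (R : realType) (n : nat) (M : manifold R n).
Implicit Types (X Y V : vfield M) (x y : tbig M).
Variables (Gam Psi : tensor2 M).
Hypothesis bG : bilin Gam.
Hypothesis sG : forall X Y, Gam X Y = Gam Y X.
Hypothesis fP : form2 Psi.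
Variables (S Phi : tbig M -> tbig M).
Hypothesis SL : linear S.
Hypothesis SS : forall x, S (S x) = x.
Hypothesis Sg : forall x y, pairing (S x) (S y) = pairing x y.
Hypothesis PL : linear Phi.
Hypothesis PS : forall x y, pairing (Phi x) y = - pairing x (Phi y).
Hypothesis PP : forall x, Phi (Phi x) = - x.
Hypothesis PSC : forall x, Phi (S x) = S (Phi x).
Hypothesis VE : forall b x, eigen S b x <-> forall Y, x.2 Y = Psi x.1 Y + sgn M b * Gam x.1 Y.
Variable J : bool -> vfield M -> vfield M.
Hypothesis JL : forall b, linear (J b).
Hypothesis JJ : forall b X, J b (J b X) = - X.
Hypothesis JG : forall b X Y, Gam (J b X) (J b Y) = Gam X Y.
Hypothesis PJ : forall b x, eigen S b x -> (Phi x).1 = J b x.1.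

Definition vlift b X : tbig M := (X, flat bG fP b X).

Lemma eigen_vlift b X : eigen S b (vlift b X).
Proof. by apply/VE. Qed.

Lemma eigen_vliftE b x : eigen S b x -> x = vlift b x.1.
Proof. by move=> /VE ex; apply: tbigP. Qed.

Lemma Phi_vlift b X : Phi (vlift b X) = vlift b (J b X).
Proof.
have e := eigen_vlift b X.
by rewrite (eigen_vliftE (eigen_Phi PL PSC e)) (PJ e).
Qed.

Definition brP b X Y := bracket (J b X) (J b Y) - bracket X Y.
Definition brQ b X Y := bracket (J b X) Y + bracket X (J b Y).

(** As soon as [brP] = J [brQ], the first line is the covector of the section of V_b over [brP]; the
    rest is the obstruction that [d3_equiv] rewrites. *)
Lemma nij_r2 b X Y V : (nij_r Phi (vlift b X) (vlift b Y)).2 V =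
  Psi (brP b X Y) V + sgn M b * Gam (J b (brQ b X Y)) V +
  (d2 Psi (J b X) (J b Y) V - d2 Psi X Y V +
   sgn M b * (d2 (om Gam (J b)) (J b X) Y V + d2 (om Gam (J b)) X (J b Y) V)).
Proof.
rewrite /nij_r !Phi_vlift.
transitivity ((courant (vlift b (J b X)) (vlift b (J b Y))).2 V -
  (courant (vlift b X) (vlift b Y)).2 V : Cinf M); first by [].
rewrite !(courant_flat bG sG fP) /brP (linB ((form2_bilin fP).1 V)).
have := gform_r bG sG (JL b) (JJ b) (JG b) X Y V.
rewrite /om -/(brQ b X Y) => E.
transitivity (d2 Psi (J b X) (J b Y) V - d2 Psi X Y V +
  (Psi (bracket (J b X) (J b Y)) V - Psi (bracket X Y) V) +
  sgn M b * (gform Gam (J b X) (J b Y) V - gform Gam X Y V)); first ring.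
rewrite E; ring.
Qed.

Lemma nij_u2 b X Y V : (nij_u Phi (vlift b X) (vlift b Y)).2 V =
  Psi (brQ b X Y) V - sgn M b * Gam (J b (brP b X Y)) V +
  (d2 Psi (J b X) Y V + d2 Psi X (J b Y) V +
   sgn M b * (d2 (om Gam (J b)) X Y V - d2 (om Gam (J b)) (J b X) (J b Y) V)).
Proof.
rewrite /nij_u !Phi_vlift.
transitivity ((courant (vlift b (J b X)) (vlift b Y)).2 V +
  (courant (vlift b X) (vlift b (J b Y))).2 V : Cinf M); first by [].
rewrite !(courant_flat bG sG fP) /brQ (linD ((form2_bilin fP).1 V)).
have := gform_u bG sG (JL b) (JJ b) (JG b) X Y V.
rewrite /om -/(brP b X Y) => E.
transitivity (d2 Psi (J b X) Y V + d2 Psi X (J b Y) V +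
  (Psi (bracket (J b X) Y) V + Psi (bracket X (J b Y)) V) +
  sgn M b * (gform Gam (J b X) Y V + gform Gam X (J b Y) V)); first ring.
rewrite E; ring.
Qed.

Lemma integrable_brPQ b : Defs.integrable (J b) <-> forall X Y, brP b X Y = J b (brQ b X Y).
Proof.
split=> H X Y; have := H X Y; rewrite /brP /brQ (JD (JL b)).
  by move=> /eqP; rewrite subr_eq0 -addrA -opprD subr_eq => /eqP ->; rewrite addrC addKr.
move=> E; apply/eqP; rewrite !subr_eq add0r -[X in X == _](subrK (bracket X Y)) E; apply/eqP.
by rewrite [LHS]addrC [J b _ + _]addrC addrA.
Qed.

(** The vector part of r = Phi u says that J b is integrable, the covector part of r that the mixed
    identity for dPsi holds. Conversely the covector of u needs no new condition: it is the same
    identity at (J X, Y, V). *)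
Lemma bih_sign b :
  (forall x y, eigen S b x -> eigen S b y ->
     eigen S b (nij_r Phi x y) /\ nij_r Phi x y = Phi (nij_u Phi x y)) <->
  (Defs.integrable (J b) /\ forall X Y V,
     d2 Psi (J b X) (J b Y) (J b V) = - sgn M b * d2 (om Gam (J b)) X Y V).
Proof.
split=> [H|[IJ /(d3_equiv bG sG fP (JL b) (JJ b) (JG b) b IJ) A] x y ex ey].
  have K X Y : brP b X Y = J b (brQ b X Y) /\ nij_r Phi (vlift b X) (vlift b Y) = vlift b (brP b X Y).
    have [er ru] := H _ _ (eigen_vlift b X) (eigen_vlift b Y).
    have r1 : (nij_r Phi (vlift b X) (vlift b Y)).1 = brP b X Y by rewrite /nij_r !Phi_vlift.
    have u1 : (nij_u Phi (vlift b X) (vlift b Y)).1 = brQ b X Y by rewrite /nij_u !Phi_vlift.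
    have eu : eigen S b (nij_u Phi (vlift b X) (vlift b Y)).
      have -> : nij_u Phi (vlift b X) (vlift b Y) = - Phi (nij_r Phi (vlift b X) (vlift b Y)).
        by rewrite ru PP opprK.
      exact/(eigenN SL)/(eigen_Phi PL PSC).
    split; last by rewrite {1}(eigen_vliftE er) r1.
    by rewrite -r1 ru (PJ eu) u1.
  have IJ : Defs.integrable (J b) by apply/integrable_brPQ => X Y; case: (K X Y).
  split=> //; apply/(d3_equiv bG sG fP (JL b) (JJ b) (JG b) b IJ) => X Y V.
  have [PQ rE] := K X Y; have := nij_r2 b X Y V; rewrite rE -PQ.
  have -> : (vlift b (brP b X Y)).2 V = Psi (brP b X Y) V + sgn M b * Gam (brP b X Y) V by [].
  by move=> /eqP; rewrite -subr_eq0 opprD addrA subrr add0r oppr_eq0 => /eqP.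
rewrite (eigen_vliftE ex) (eigen_vliftE ey); set X := x.1; set Y := y.1.
have PQ : brP b X Y = J b (brQ b X Y) by exact: (integrable_brPQ b).1.
have r1 : (nij_r Phi (vlift b X) (vlift b Y)).1 = brP b X Y by rewrite /nij_r !Phi_vlift.
have u1 : (nij_u Phi (vlift b X) (vlift b Y)).1 = brQ b X Y by rewrite /nij_u !Phi_vlift.
have er : eigen S b (nij_r Phi (vlift b X) (vlift b Y)).
  by apply/VE => V; rewrite nij_r2 r1 -PQ A addr0.
have eu : eigen S b (nij_u Phi (vlift b X) (vlift b Y)).
  apply/VE => V; rewrite nij_u2 u1 PQ JJ (linN (bG.1 V)).
  have := A (J b X) Y V; rewrite JJ.
  rewrite (linN (d2_lin1 fP _ _)) (linN (d2_lin1 (om_form2 bG sG (JL b) (JJ b) (JG b)) _ _)) => A'.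
  transitivity (Psi (brQ b X Y) V + sgn M b * Gam (brQ b X Y) V -
    (- d2 Psi X (J b Y) V - d2 Psi (J b X) Y V + sgn M b *
     (- d2 (om Gam (J b)) X Y V + d2 (om Gam (J b)) (J b X) (J b Y) V))); first ring.
  by rewrite A' subr0.
split=> //; rewrite {1}(eigen_vliftE er) r1 PQ -u1 -Phi_vlift.
by rewrite -(eigen_vliftE eu).
Qed.

(* The bihermitian form of the integrability conditions: the Courant-Nijenhuis
   tensor of an endomorphism that is skew for the pairing is totally skew, so only
   pairs of sections of the same eigenbundle matter. *)
Lemma gk_bih : (generalized_complex Phi /\ generalized_complex (S \o Phi)) <->
  forall b, Defs.integrable (J b) /\ forall X Y V,
     d2 Psi (J b X) (J b Y) (J b V) = - sgn M b * d2 (om Gam (J b)) X Y V.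
Proof.
have QL := SPhi_lin SL PL.
have QS := SPhi_skew SS Sg PS PSC.
have QP := SPhi_sq SL SS PP PSC.
have sign b x y := nij_sign SL PL PSC (b := b) (x := x) (y := y).
split=> [[[_ _ _ /(gc_nij PL PP) N1] [_ _ _ /(gc_nij QL QP) N2]] b|H].
  by apply/bih_sign => x y ex ey; apply/sign.
have N b x y (ex : eigen S b x) (ey : eigen S b y) : nij Phi x y = 0 /\ nij (S \o Phi) x y = 0.
  by apply/(sign b) => //; move: x y ex ey; exact/bih_sign.
split; split=> //.
  apply/(gc_nij PL PP); apply: (nij_eigen SL SS PL PS PP) => b x y ex ey.
  by case: (N b x y ex ey).
apply/(gc_nij QL QP); apply: (nij_eigen SL SS QL QS QP) => b x y ex ey.
by case: (N b x y ex ey).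
Qed.

End Bihermitian.

(** * The cone over an almost contact metric manifold *)

Section Alternating.
Variables (R : realType) (n : nat) (M : manifold R n).
Notation N := (cylinder M).

(** Up to order, d/dt occurs at most once among frame arguments: a repetition kills an alternating
    form, because 2 is invertible. *)
Lemma alt3_cyl (T : vfield N -> vfield N -> vfield N -> Cinf N) :
  (forall W V, lin (T W V)) -> (forall W V U, T V U W = T W V U) ->
  (forall W V U, T W U V = - T W V U) ->
  (forall X Y V, T (lift X) (lift Y) (lift V) = 0) ->
  (forall X Y, T (lift X) (lift Y) (ddt M) = 0) ->
  forall W V U, T W V U = 0.
Proof.
move=> TL TC TA T3 T2.
have dd W : T W (ddt M) (ddt M) = 0.
  have E : T W (ddt M) (ddt M) + T W (ddt M) (ddt M) = 0 by rewrite {1}TA addNr.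
  by rewrite -[LHS]mul1r -(half_half N) mulrDl -mulrDr E mulr0.
have T1 X V U : T (lift X) V U = 0.
  move: U; apply: cyl_ind; first exact: TL.
    move=> Y; rewrite TA; apply/eqP; rewrite oppr_eq0; apply/eqP.
    by move: V; apply: cyl_ind; [exact: TL|exact: T3|exact: T2].
  rewrite TA; apply/eqP; rewrite oppr_eq0; apply/eqP.
  move: V; apply: cyl_ind; [exact: TL| |exact: dd].
  by move=> Y; rewrite TA T2 oppr0.
move=> W V U; rewrite -TC; move: W; apply: cyl_ind; first exact: TL.
  by move=> X; rewrite TC T1.
rewrite TC; move: U; apply: cyl_ind; first exact: TL.
  by move=> X; rewrite TC T1.
by rewrite TC TC dd.
Qed.

End Alternating.

(** * The metric and the 2-form of the cone *)

Section Cone.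
Variables (R : realType) (n : nat) (M : manifold R n).
Notation N := (cylinder M).
Implicit Types (f : Cinf N) (X Y V : vfield M) (W U : vfield N).

Definition pull1 (Q : vfield M -> Cinf M) (lQ : lin Q) W : Cinf N := MkCinf (smooth_pull1 W lQ).

Lemma pull1_lin Q (lQ : lin Q) : lin (pull1 lQ).
Proof.
move=> f W U; apply: CinfNP => p t.
change (Q (hpart (f *: W + U) t) p = f (p, t) * Q (hpart W t) p + Q (hpart U t) p).
by rewrite hpart_lin lQ.
Qed.

Lemma pull1_lift Q (lQ : lin Q) X : pull1 lQ (lift X) = pull (Q X).
Proof.
by apply: CinfNP => p t; change (Q (hpart (lift X) t) p = Q X p); rewrite hpart_lift.
Qed.

Definition pull2 (l : tensor2 M) (bl : bilin l) W U : Cinf N := MkCinf (smooth_pull2 W U bl).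

Section Pull2.
Variables (l : tensor2 M) (bl : bilin l).

Lemma pull2_linl U : lin (fun W => pull2 bl W U).
Proof.
move=> f W W'; apply: CinfNP => p t.
change (l (hpart (f *: W + W') t) (hpart U t) p =
  f (p, t) * l (hpart W t) (hpart U t) p + l (hpart W' t) (hpart U t) p).
by rewrite hpart_lin (bl.1 _).
Qed.

Lemma pull2_lift X Y : pull2 bl (lift X) (lift Y) = pull (l X Y).
Proof.
apply: CinfNP => p t.
by change (l (hpart (lift X) t) (hpart (lift Y) t) p = l X Y p); rewrite !hpart_lift.
Qed.

Lemma pull2_ddtr W : pull2 bl W (ddt M) = 0.
Proof.
apply: CinfNP => p t; change (l (hpart W t) (hpart (ddt M) t) p = 0).
by rewrite hpart_ddt (lin0 (bl.2 _)).
Qed.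

End Pull2.

Variables (g psi : tensor2 M) (kappa : form1 M).
Hypothesis rg : riemannian g.
Hypothesis fpsi : form2 psi.
Let bg := riemannian_bilin rg.
Let bpsi := form2_bilin fpsi.
Let lk := lin_form1 kappa.

(** [cone_metric] with smooth functions as values, as the exterior calculus requires, and [cPsi]
    likewise for [cone_form]; [W (time M)] is dt(W). *)
Definition cGam : tensor2 N := fun W U =>
  expt M * (pull2 bg W U + W (time M) * U (time M)).

Definition cPsi : tensor2 N := fun W U =>
  expt M * (pull2 bpsi W U + (pull1 lk W * U (time M) - W (time M) * pull1 lk U)).

Lemma expt_gt0 q : 0 < expt M q. Proof. exact: expR_gt0. Qed.

Lemma cGam_sym W U : cGam W U = cGam U W.
Proof.
have [_ gs _ _] := rg; rewrite /cGam (mulrC (W _)); congr (_ * (_ + _)).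
by apply: CinfNP => p t; change (g (hpart W t) (hpart U t) p = g (hpart U t) (hpart W t) p); rewrite gs.
Qed.

Lemma cGam_riemannian : riemannian cGam.
Proof.
have [_ gs gp g0] := rg.
have gE W p t : cGam W W (p, t) =
    expR t * (g (hpart W t) (hpart W t) p + W (time M) (p, t) * W (time M) (p, t)) by [].
split.
- move=> h X Y V; rewrite /cGam (pull2_linl bg V) vf_addE vf_scaleE; ring.
- exact: cGam_sym.
- move=> W [p t]; rewrite gE mulr_ge0 ?expR_ge0// addr_ge0 ?gp// -expr2 sqr_ge0//.
- move=> W [p t]; rewrite gE => /eqP; rewrite mulf_eq0 gt_eqF ?expR_gt0//=.
  rewrite paddr_eq0 ?gp// -?expr2 ?sqr_ge0// sqrf_eq0 => /andP[/eqP gW /eqP Wt] f.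
  by rewrite (vf_decomp W) Wt mul0r addr0 (g0 _ _ gW).
Qed.

Lemma cPsi_form2 : form2 cPsi.
Proof.
split=> [h X Y V|X Y].
  rewrite /cPsi (pull2_linl bpsi V) (pull1_lin lk) vf_addE vf_scaleE; ring.
rewrite /cPsi.
have -> : pull2 bpsi Y X = - pull2 bpsi X Y.
  apply: CinfNP => p t.
  by change (psi (hpart Y t) (hpart X t) p = - psi (hpart X t) (hpart Y t) p); rewrite fpsi.2.
ring.
Qed.

Lemma cGam_ll X Y : cGam (lift X) (lift Y) = expt M * pull (g X Y).
Proof. by rewrite /cGam pull2_lift !lift_time mul0r addr0. Qed.

Lemma cGam_lt X : cGam (lift X) (ddt M) = 0.
Proof. by rewrite /cGam pull2_ddtr lift_time mul0r addr0 mulr0. Qed.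

Lemma cGam_tt : cGam (ddt M) (ddt M) = expt M.
Proof. by rewrite /cGam pull2_ddtr ddt_time mul1r add0r mulr1. Qed.

Lemma cPsi_ll X Y : cPsi (lift X) (lift Y) = expt M * pull (psi X Y).
Proof. by rewrite /cPsi pull2_lift !lift_time mulr0 mul0r subrr addr0. Qed.

Lemma cPsi_lt X : cPsi (lift X) (ddt M) = expt M * pull (kappa X).
Proof.
by rewrite /cPsi pull2_ddtr lift_time ddt_time pull1_lift mulr1 mul0r subr0 add0r.
Qed.

Lemma lift_expt_pull X h : lift X (expt M * pull h) = expt M * pull (X h).
Proof. by rewrite vf_mul lift_expt lift_pull mul0r addr0. Qed.

Lemma ddt_expt_pull h : ddt M (expt M * pull h) = expt M * pull h.
Proof. by rewrite vf_mul ddt_expt ddt_pull mulr0 add0r. Qed.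

Lemma bracket_lift_ddt X : bracket (lift X) (ddt M) = 0.
Proof. by rewrite bracketC bracket_ddt_lift oppr0. Qed.

Lemma d2_lift_lll (l : tensor2 N) (m : tensor2 M) :
  (forall X Y, l (lift X) (lift Y) = expt M * pull (m X Y)) ->
  forall X Y V, d2 l (lift X) (lift Y) (lift V) = expt M * pull (d2 m X Y V).
Proof.
move=> E X Y V; rewrite /d2 !bracket_lift !E !lift_expt_pull !(pullD, pullN); ring.
Qed.

(** Differentiating e^t along d/dt reproduces e^t m, which adds to d w. With m = psi and w = kappa
    this is the origin of psi + d kappa; with m = Xi and w = - xi, that of Xi - d xi. *)
Lemma d2_lift_llt (l : tensor2 N) (m : tensor2 M) (w : form1 M) : bilin l ->
  (forall X Y, l (lift X) (lift Y) = expt M * pull (m X Y)) ->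
  (forall X, l (lift X) (ddt M) = expt M * pull (w X)) ->
  forall X Y, d2 l (lift X) (lift Y) (ddt M) = expt M * pull (m X Y + d1 w X Y).
Proof.
move=> bl E1 E2 X Y; rewrite /d2 !bracket_lift !bracket_lift_ddt !(lin0 (bl.1 _)) !E1 !E2.
rewrite !lift_expt_pull ddt_expt_pull /d1 !(pullD, pullN); ring.
Qed.

End Cone.

(** * The almost complex structure of the cone *)

Section Cone_structure.
Variables (R : realType) (n : nat) (M : manifold R n).
Notation N := (cylinder M).
Implicit Types (f : Cinf N) (X Y V : vfield M) (W U : vfield N).
Variable A : contact_triple M.
Notation F := (tF A).
Notation Z := (tZ A).
Notation xi := (txi A).
Hypothesis FL : linear F.

Lemma FD X Y : F (X + Y) = F X + F Y.
Proof. by have := FL 1 X Y; rewrite !scale1r. Qed.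

Lemma F0 : F 0 = 0.
Proof. by have /eqP := FD 0 0; rewrite addr0 -subr_eq0 opprD addrA subrr add0r oppr_eq0 => /eqP. Qed.

Lemma lin_F (Q : vfield M -> Cinf M) : lin Q -> lin (fun X => Q (F X)).
Proof. by move=> lQ h X Y; rewrite FL lQ. Qed.

Variable J : vfield N -> vfield N.

Definition cone_action := (forall X, J (lift X) = lift (F X) - pull (xi X) *: ddt M) /\
  J (ddt M) = lift Z.

Lemma cone_image_action : (forall W, cone_image A W (J W)) -> linear J /\ cone_action.
Proof.
move=> JC; split; last split.
- move=> h W U; apply/vfieldP => f; apply: CinfNP => p t.
  rewrite vf_addE vf_scaleE evD evM !JC hpart_lin FL form1_lin !vf_addE !vf_scaleE.
  by rewrite !(evD, evM) !sliceE; ring.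
- move=> X; apply/vfieldP => f; apply: CinfNP => p t.
  rewrite JC hpart_lift lift_time ev0 mul0r addr0 vf_addE vf_oppE vf_scaleE.
  by rewrite evD evN evM liftE pullE.
- apply/vfieldP => f; apply: CinfNP => p t.
  rewrite JC hpart_ddt F0 (lin0 (lin_form1 xi)) ddt_time liftE.
  by rewrite vf_0E !ev0 ev1 mul1r mul0r subr0 add0r.
Qed.

Hypothesis JL : linear J.
Hypothesis JA : cone_action.

Lemma lin_J (Q : vfield N -> Cinf N) : lin Q -> lin (fun W => Q (J W)).
Proof. by move=> lQ h X Y; rewrite JL lQ. Qed.

(** Multiplied by chi^3, W is a combination of lifts and d/dt, on which J is known; linearity of J,
    F and xi carries the formula over. *)
Lemma cone_action_image W : cone_image A W (J W).
Proof.
move=> f p t; have [chi [u [E [chi0 span]]]] := cyl_frame p.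
have c0 : chi p ^+ 3 != 0 by rewrite expf_neq0.
pose w i : Cinf N := pull chi * W (pull (u i)) - pull (u i) * W (pull chi).
have spanW : pull (chi ^+ 3) *: W = \sum_i (w i) *: lift (E i)
    + (pull (chi ^+ 3) * W (time M) : Cinf N) *: ddt M := span W.
have JW : chi p ^+ 3 * J W f (p, t) =
    \sum_i w i (p, t) * (F (E i) (slice t f) p - xi (E i) p * ddt M f (p, t))
    + chi p ^+ 3 * (W (time M) (p, t) * Z (slice t f) p).
  have := congr1 (fun V : vfield N => J V f (p, t)) spanW; have lQ := lin_J (lin_vf f).
  rewrite (linZ lQ) (linD lQ) (lin_sum lQ) (linZ lQ) JA.2 evM evD pullE evX => ->.
  rewrite !evM pullE evX liftE mulrA; congr (_ + _); rewrite ev_sum; apply: eq_bigr => i _.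
  by rewrite (linZ lQ) JA.1.
have hW : chi ^+ 3 *: hpart W t = \sum_i (slice t (w i) *: E i).
  have := congr1 (fun V : vfield N => hpart V t) spanW.
  have hD (V U : vfield N) : hpart (V + U) t = hpart V t + hpart U t.
    by apply/vfieldP => h; apply/CinfP.
  have h0 : hpart (0 : vfield N) t = 0 by apply/vfieldP => h; apply/CinfP.
  have hZ (h : Cinf N) (V : vfield N) : hpart (h *: V) t = slice t h *: hpart V t.
    by apply/vfieldP => k; apply/CinfP.
  rewrite hD !hZ hpart_ddt scaler0 addr0 (big_morph (fun V : vfield N => hpart V t) hD h0).
  rewrite (slice_pull t (chi ^+ 3)) => ->; apply: eq_bigr => i _.
  by rewrite hZ hpart_lift.
have FW : chi p ^+ 3 * F (hpart W t) (slice t f) p =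
    \sum_i w i (p, t) * F (E i) (slice t f) p.
  have lQ := lin_F (lin_vf (slice t f)).
  have := congr1 (fun V : vfield M => F V (slice t f) p) hW; rewrite (linZ lQ) (lin_sum lQ).
  rewrite evM evX ev_sum => ->; apply: eq_bigr => i _.
  by rewrite (linZ lQ) evM.
have xW : chi p ^+ 3 * xi (hpart W t) p = \sum_i w i (p, t) * xi (E i) p.
  have lQ := lin_form1 xi.
  have := congr1 (fun V : vfield M => xi V p) hW; rewrite (linZ lQ) (lin_sum lQ).
  rewrite evM evX ev_sum => ->; apply: eq_bigr => i _.
  by rewrite (linZ lQ) evM.
apply: (mulfI c0); rewrite JW mulrBr mulrDr FW addrAC; congr (_ + _).
rewrite mulrA xW mulr_suml -sumrB; apply: eq_bigr => i _; ring.
Qed.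

Variable g : tensor2 M.
Hypothesis rg : riemannian g.

(** The difference of the two sides is function-linear in W, and on lifts and d/dt the coefficients
    of J are pulled back from M, hence killed by d/dt. *)
Lemma cone_J_ddt W : bracket (ddt M) (J W) = J (bracket (ddt M) W).
Proof.
apply/vfieldP => f; apply/eqP; rewrite -subr_eq0; apply/eqP; move: W.
apply: cyl_ind.
- move=> h W U; have lQ := lin_J (lin_vf f).
  rewrite JL !bracketDr !bracketZr !(linD lQ, linZ lQ) !vf_addE !vf_scaleE; ring.
- move=> X; rewrite JA.1 bracketDr bracketNr bracketZr !bracket_ddt_lift ddt_pull.
  rewrite (_ : bracket (ddt M) (ddt M) = 0); last first.
    by apply/vfieldP => h; rewrite bracketE subrr.
  by rewrite scaler0 scale0r addr0 oppr0 addr0 (lin0 (lin_J (lin_vf f))) vf_0E subrr.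
- rewrite JA.2 bracket_ddt_lift (_ : bracket (ddt M) (ddt M) = 0); last first.
    by apply/vfieldP => h; rewrite bracketE subrr.
  by rewrite (lin0 (lin_J (lin_vf f))) vf_0E subrr.
Qed.

Hypothesis HA : almost_contact_metric g A.

Let xiZ : xi Z = 1. Proof. by have [_ [-> _]] := HA. Qed.
Let FZ0 : F Z = 0. Proof. by have [_ [_ ->]] := HA. Qed.
Let xiF X : xi (F X) = 0. Proof. by have [_ _ ->] := HA. Qed.
Let FF X : F (F X) = - X + (xi X : Cinf M) *: Z. Proof. by have [_ _ _ ->] := HA. Qed.
Let gF X Y : g (F X) (F Y) = g X Y - xi X * xi Y. Proof. by have [_ _ _ _ ->] := HA. Qed.
Let bg := riemannian_bilin rg.
Let bG := riemannian_bilin (cGam_riemannian rg).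

Lemma g_Z X : g Z X = xi X.
Proof.
have := gF Z X; rewrite FZ0 (lin0 (bg.1 _)) xiZ mul1r => /eqP.
by rewrite eq_sym subr_eq0 => /eqP.
Qed.

Lemma cone_J_sq W : J (J W) = - W.
Proof.
apply/vfieldP => f; apply/eqP; rewrite vf_oppE -subr_eq0 opprK; apply/eqP; move: W.
have lQ := lin_J (lin_J (lin_vf f)).
have lQ1 := lin_J (lin_vf f).
apply: cyl_ind.
- by move=> h W U; rewrite lQ vf_addE vf_scaleE; ring.
- move=> X; rewrite JA.1 (linB lQ1) (linZ lQ1) JA.1 JA.2 xiF FF liftD liftN liftZ pull0.
  rewrite scale0r subr0 vf_addE vf_oppE vf_scaleE; ring.
- by rewrite JA.2 JA.1 FZ0 xiZ lift0 pull_1 scale1r sub0r vf_oppE addNr.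
Qed.

Lemma cone_J_iso W U : cGam rg (J W) (J U) = cGam rg W U.
Proof.
have gs := cGam_sym rg; have tl X : cGam rg (ddt M) (lift X) = 0 by rewrite gs cGam_lt.
apply/eqP; rewrite -subr_eq0; apply/eqP; move: W; apply: cyl_ind.
- by move=> h W V; rewrite JL !(bG.1 _ h); ring.
- move=> X; move: U; apply: cyl_ind.
  + by move=> h W V; rewrite JL !(bG.2 _ h); ring.
  + move=> Y; rewrite !JA.1 !(linB (bG.1 _)) !(linB (bG.2 _)) !(linZ (bG.1 _)) !(linZ (bG.2 _)).
    by rewrite !cGam_ll !cGam_lt !tl cGam_tt gF !(pullD, pullN, pullM); ring.
  + rewrite JA.1 JA.2 !(linB (bG.1 _)) !(linZ (bG.1 _)) cGam_ll tl cGam_lt.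
    by have [_ sg _ _] := rg; rewrite sg g_Z xiF pull0; ring.
- move: U; apply: cyl_ind.
  + by move=> h W V; rewrite JL !(bG.2 _ h); ring.
  + move=> Y; rewrite JA.1 JA.2 !(linB (bG.2 _)) !(linZ (bG.2 _)) cGam_ll tl cGam_lt.
    by rewrite g_Z xiF pull0; ring.
  + by rewrite JA.2 cGam_ll cGam_tt g_Z xiZ pull_1; ring.
Qed.

(** This is the d/dt-component, read off by applying to [time M], of the Nijenhuis tensor on (d/dt,
    lift X), where J (d/dt) = lift Z. As xi Z = 1, it says L_Z xi = 0. *)
Lemma normal_d_xi : Defs.integrable J -> forall X, d1 xi Z X = 0.
Proof.
move=> IJ X; have := IJ (ddt M) (lift X).
have tt : bracket (ddt M) (J (lift X)) = 0.
  rewrite cone_J_ddt bracket_ddt_lift; apply/vfieldP => f.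
  by rewrite (lin0 (lin_J (lin_vf f))) vf_0E.
rewrite tt JA.2 JA.1 bracket_ddt_lift subr0 bracketDr bracketNr bracketZr !bracket_lift.
rewrite bracket_lift_ddt scaler0 add0r lift_pull JA.1.
move=> /(congr1 (fun V : vfield N => V (time M))).
rewrite !(vf_addE, vf_oppE, vf_scaleE) !lift_time ddt_time !mulr1.
have -> : J 0 (time M) = 0 by rewrite (lin0 (lin_J (lin_vf (time M)))).
rewrite subr0 sub0r sub0r opprK vf_0E /d1 xiZ vf_1 subr0 => /(congr1 (slice 0)).
rewrite -pullN -pullD slice_pull => E.
have {}E : - Z (xi X) + xi (bracket Z X) = 0 by rewrite E; exact/CinfP.
by rewrite -[LHS]opprK opprB addrC E oppr0.
Qed.

End Cone_structure.

Section Forms.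
Variables (R : realType) (n : nat) (M : manifold R n).
Implicit Types (X Y V Z : vfield M) (w : form1 M) (l : tensor2 M).

Lemma d1_form2 w : form2 (d1 w).
Proof.
have lw := lin_form1 w; split=> [h X Y V|X Y].
  rewrite /d1 (lw h) (bracketDl V) bracketZl !(linD lw, linN lw, linZ lw).
  rewrite vf_addE vf_scaleE vfD vf_mul; ring.
by rewrite /d1 (bracketC Y X) (linN lw); ring.
Qed.

Lemma jacobi X Y V : bracket (bracket X Y) V - bracket (bracket X V) Y + bracket (bracket Y V) X = 0.
Proof.
apply/vfieldP => f; rewrite !(vf_addE, vf_oppE) !bracketE !(vfD, vf_opp).
by rewrite vf_0E; ring.
Qed.

Lemma d2_d1 w X Y V : d2 (d1 w) X Y V = 0.
Proof.
have lw := lin_form1 w; rewrite /d2 /d1 !(vfD, vf_opp) !bracketE.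
have := congr1 w (jacobi X Y V); rewrite !(linD lw, linN lw) (lin0 lw) => E.
transitivity (w (bracket (bracket X Y) V) - w (bracket (bracket X V) Y) + w (bracket (bracket Y V) X) : Cinf M); last exact: E.
ring.
Qed.

Lemma lie2_form2 Z l : form2 l -> form2 (lie2 Z l).
Proof.
move=> fl; have [ll la] := fl; have bl := form2_bilin fl; split=> [h X Y V|X Y].
  rewrite /lie2 ll bracketDr bracketZr (linD (bl.1 V)) (linD (bl.1 V)) !(linZ (bl.1 V)) ll.
  rewrite vfD vf_mul; ring.
by rewrite /lie2 (la Y X) (la (bracket Z Y)) (la Y (bracket Z X)) vf_opp; ring.
Qed.

Lemma c2_form2 F l : linear F -> form2 l -> form2 (c2 F l).
Proof. by move=> FL [ll la]; split=> [h X Y V|X Y]; rewrite /c2 ?FL ?ll//. Qed.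

(** In L_Z = i(Z) d + d i(Z) the second term vanishes. *)
Lemma cartan Z l : form2 l -> (forall Y, l Z Y = 0) -> forall X Y, d2 l Z X Y = lie2 Z l X Y.
Proof.
move=> [ll la] Z0 X Y; rewrite /d2 /lie2 (la (bracket X Y)) !Z0 !vf_0 (la X (bracket Z Y)); ring.
Qed.

Lemma d2_alt l X Y : form2 l -> d2 l X Y Y = 0.
Proof.
move=> fl; have E : d2 l X Y Y + d2 l X Y Y = 0 by rewrite {1}(d2_anti fl X Y Y) addNr.
by rewrite -[LHS]mul1r -(half_half M) mulrDl -mulrDr E mulr0.
Qed.

End Forms.

(** * The equations for sigma as components of the cone condition *)

Section Equations.
Variables (R : realType) (n : nat) (M : manifold R n).
Notation N := (cylinder M).
Implicit Types (X Y V : vfield M).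
Variables (g psi : tensor2 M) (kappa : form1 M) (A : contact_triple M) (b : bool).
Hypothesis rg : riemannian g.
Hypothesis fpsi : form2 psi.
Hypothesis HA : almost_contact_metric g A.
Notation F := (tF A).
Notation Z := (tZ A).
Notation xi := (txi A).
Notation s := (sgn M b).

Let FL : linear F. Proof. by have [] := HA. Qed.
Let xiZ : xi Z = 1. Proof. by have [_ [-> _]] := HA. Qed.
Let FZ0 : F Z = 0. Proof. by have [_ [_ ->]] := HA. Qed.
Let FF X : F (F X) = - X + (xi X : Cinf M) *: Z. Proof. by have [_ _ _ ->] := HA. Qed.

Definition sigma : tensor2 M := fun X Y => psi X Y + d1 kappa X Y.
Definition Xi : tensor2 M := fun X Y => g (F X) Y.

(* The condition dPsi(J, J, J) = - (+-) d omega on the cone, evaluated on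
   (lift X, lift Y, d/dt) for cone_eq1 and (lift X, lift Y, lift V) for cone_eq0. *)
Definition cone_eq1 := forall X Y,
  d2 psi (F X) (F Y) Z - xi X * sigma (F Y) Z + xi Y * sigma (F X) Z =
  - s * (Xi X Y - d1 xi X Y).

Definition cone_eq0 := forall X Y V,
  d2 psi (F X) (F Y) (F V) - xi X * sigma (F Y) (F V) + xi Y * sigma (F X) (F V)
    - xi V * sigma (F X) (F Y) = - s * d2 Xi X Y V.

Lemma sigma_form2 : form2 sigma.
Proof.
have [l1 a1] := fpsi; have [l2 a2] := d1_form2 kappa.
split=> [h X Y V|X Y]; rewrite /sigma ?l1 ?l2; first ring.
rewrite (a1 X Y) (a2 X Y); ring.
Qed.

Lemma d2_sigma X Y V : d2 sigma X Y V = d2 psi X Y V.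
Proof.
rewrite -[RHS]addr0 -(d2_d1 kappa X Y V) /sigma /d2 !vfD; ring.
Qed.

Let fs := sigma_form2.
Let sa := fs.2.
Let bs := form2_bilin fs.

Definition Lc : tensor2 M := c2 F (lie2 Z sigma).

Let fLc : form2 Lc := c2_form2 FL (lie2_form2 Z fs).

Lemma Lc_Z Y : Lc Z Y = 0.
Proof. by rewrite /Lc /c2 FZ0 (lin0 ((form2_bilin (lie2_form2 Z fs)).1 _)). Qed.

Lemma d2_Lc_Z Y V : d2 Lc Z Y V = lie2 Z Lc Y V.
Proof. exact: cartan fLc Lc_Z Y V. Qed.

(** By Cartan's formula L_Z sigma = i(Z) d sigma, and d sigma = d psi. *)
Lemma Lc_d2 : (forall Y, sigma Z Y = 0) -> forall X Y, Lc X Y = d2 psi (F X) (F Y) Z.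
Proof.
by move=> Z0 X Y; rewrite /Lc /c2 -cartan// d2_sigma -(d2_cycle fpsi Z).
Qed.

Lemma d2_Xi : (forall X Y, Xi X Y = d1 xi X Y - s * Lc X Y) ->
  forall X Y V, d2 Xi X Y V = - (s * d2 Lc X Y V).
Proof.
move=> E X Y V; rewrite -[RHS]add0r -(d2_d1 xi X Y V) /d2 !E !(vfD, vf_opp, vf_sgn); ring.
Qed.

(** Contraction with Z separates the equations. [cone_eq1] at X = Z gives sigma(F Y, Z) = 0, because
    F Z = 0 and i(Z) d xi = 0, hence i(Z) sigma = 0; what is left of it is the equation for Xi. The
    exterior derivative of that equation replaces d Xi by d Lc in [cone_eq0], whose contraction with
    Z is the second equation and whose remainder is the third. There the sign disappears through s^2
    = 1. *)
Lemma sasakian_cone_eq : (forall X, d1 xi Z X = 0) ->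
  sasakian_equations g psi kappa b A <-> cone_eq1 /\ cone_eq0.
Proof.
move=> dZ.
have -> : sasakian_equations g psi kappa b A =
    [/\ forall Y, sigma Z Y = 0,
      forall X Y, c2 F sigma X Y = - lie2 Z Lc X Y,
      forall X Y V, c3 F (d2 psi) X Y V = wedge13 xi (d2 Lc) Z X Y V &
      forall X Y, g (F X) Y = d1 xi X Y - s * Lc X Y].
  by rewrite /sasakian_equations -sgnE /Lc /sigma; case: (A).
have ss := sgn2 M b.
have sZ X : sigma X Z = - sigma Z X := sa X Z.
split=> [[iZ E2 E3 E4]|[C1 C0]].
  split=> [X Y|X Y V].
    rewrite !sZ !iZ -Lc_d2// /Xi E4.
    transitivity (s * s * Lc X Y); first by rewrite ss; ring.
    ring.
  have := E3 X Y V; rewrite /c3 /wedge13 xiZ !d2_Lc_Z => ->.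
  rewrite (d2_Xi E4).
  have E2' X' Y' : lie2 Z Lc X' Y' = - sigma (F X') (F Y') by rewrite -[RHS]/(- c2 F sigma X' Y') E2 opprK.
  rewrite !E2'; transitivity (s * s * d2 Lc X Y V); first by rewrite ss; ring.
  ring.
have gZ X : Xi Z X = 0 by rewrite /Xi FZ0 (lin0 ((riemannian_bilin rg).1 _)).
have iZF Y : sigma (F Y) Z = 0.
  have := C1 Z Y; rewrite FZ0 xiZ gZ dZ (lin0 (bs.1 _)) (lin0 (d2_lin1 fpsi _ _)).
  by rewrite subr0 !mulr0 addr0 mul1r sub0r => /eqP; rewrite oppr_eq0 => /eqP.
have iZ Y : sigma Z Y = 0.
  have ZZ : sigma Z Z = 0.
    have E : sigma Z Z + sigma Z Z = 0 by rewrite {1}sa addNr.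
    by rewrite -[LHS]mul1r -(half_half M) mulrDl -mulrDr E mulr0.
  (* F^2 Y = - Y + xi(Y) Z passes from arguments in the image of F to arbitrary ones. *)
  have := iZF (F Y); rewrite FF (linD (bs.1 _)) (linN (bs.1 _)) (linZ (bs.1 _)) ZZ mulr0 addr0.
  by rewrite sZ opprK.
have E4 X Y : Xi X Y = d1 xi X Y - s * Lc X Y.
  have := C1 X Y; rewrite !iZF !mulr0 subr0 addr0 -(Lc_d2 iZ) => ->.
  transitivity (d1 xi X Y + s * s * (Xi X Y - d1 xi X Y)); first by rewrite ss; ring.
  ring.
have dX := d2_Xi E4.
have C0' X Y V : d2 psi (F X) (F Y) (F V) - xi X * sigma (F Y) (F V) + xi Y * sigma (F X) (F V)
    - xi V * sigma (F X) (F Y) = d2 Lc X Y V.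
  rewrite C0 dX; transitivity (s * s * d2 Lc X Y V); first ring.
  by rewrite ss mul1r.
have E2 X Y : c2 F sigma X Y = - lie2 Z Lc X Y.
  rewrite -d2_Lc_Z -C0' FZ0 xiZ (lin0 (d2_lin1 fpsi _ _)) !(lin0 (bs.1 _)) !mulr0 /c2; ring.
split=> //.
move=> X Y V; rewrite /c3 /wedge13 xiZ -C0' !d2_Lc_Z.
have E2' X' Y' : lie2 Z Lc X' Y' = - sigma (F X') (F Y') by rewrite -[RHS]/(- c2 F sigma X' Y') E2 opprK.
rewrite !E2'; ring.
Qed.

Variable J : vfield N -> vfield N.
Hypothesis JL : linear J.
Hypothesis JA : cone_action A J.

Let bP := form2_bilin (cPsi_form2 kappa fpsi).
Let fP := cPsi_form2 kappa fpsi.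
Let bG := riemannian_bilin (cGam_riemannian rg).
Notation Ps := (cPsi kappa fpsi).
Notation Om := (om (cGam rg) J).

Lemma om_ll X Y : Om (lift X) (lift Y) = expt M * pull (Xi X Y).
Proof.
rewrite /om JA.1 (linB (bG.1 _)) (linZ (bG.1 _)) cGam_ll (cGam_sym rg (ddt M)) cGam_lt mulr0.
by rewrite subr0.
Qed.

Lemma om_lt X : Om (lift X) (ddt M) = expt M * pull ((- xi) X).
Proof.
rewrite /om JA.1 (linB (bG.1 _)) (linZ (bG.1 _)) cGam_lt cGam_tt.
have -> : (- xi) X = - xi X by [].
by rewrite pullN; ring.
Qed.

Hypothesis fO : form2 Om.
Let bO := form2_bilin fO.

Lemma d2_om_llt X Y : d2 Om (lift X) (lift Y) (ddt M) = expt M * pull (Xi X Y - d1 xi X Y).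
Proof.
rewrite (d2_lift_llt bO om_ll om_lt); congr (_ * pull (_ + _)).
have E V : (- xi) V = - xi V by [].
by rewrite /d1 !E !vf_opp; ring.
Qed.

Lemma d2_Psi_J X Y V : d2 Ps (J (lift X)) (J (lift Y)) (J (lift V)) =
  expt M * pull (d2 psi (F X) (F Y) (F V) - xi X * sigma (F Y) (F V)
    + xi Y * sigma (F X) (F V) - xi V * sigma (F X) (F Y)).
Proof.
have L1 U W := d2_lin1 fP U W; have L2 U W := d2_lin2 fP U W; have L3 U W := d2_lin fP U W.
have PT X' Y' : d2 Ps (lift X') (lift Y') (ddt M) = expt M * pull (sigma X' Y').
  exact: (d2_lift_llt bP (cPsi_ll kappa fpsi) (cPsi_lt kappa fpsi)).
have PT2 X' Y' : d2 Ps (lift X') (ddt M) (lift Y') = - (expt M * pull (sigma X' Y')).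
  by rewrite (d2_anti fP) PT.
have PT1 X' Y' : d2 Ps (ddt M) (lift X') (lift Y') = expt M * pull (sigma X' Y').
  by rewrite -(d2_cycle fP) PT.
have tt1 U : d2 Ps U (ddt M) (ddt M) = 0 by exact: d2_alt.
have tt2 U : d2 Ps (ddt M) U (ddt M) = 0 by rewrite -(d2_cycle fP) tt1.
have tt3 U : d2 Ps (ddt M) (ddt M) U = 0 by rewrite -(d2_cycle fP) tt2.
rewrite !JA.1 !(linB (L1 _ _)) !(linZ (L1 _ _)) !(linB (L2 _ _)) !(linZ (L2 _ _)).
rewrite !(linB (L3 _ _)) !(linZ (L3 _ _)) PT PT2 PT1 !tt1 !tt2 !tt3.
rewrite (d2_lift_lll (cPsi_ll kappa fpsi)) !(pullD, pullN, pullM); ring.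
Qed.

Lemma d2_Psi_Jt X Y : d2 Ps (J (lift X)) (J (lift Y)) (J (ddt M)) =
  expt M * pull (d2 psi (F X) (F Y) Z - xi X * sigma (F Y) Z + xi Y * sigma (F X) Z).
Proof.
have L1 U W := d2_lin1 fP U W; have L2 U W := d2_lin2 fP U W; have L3 U W := d2_lin fP U W.
have PT X' Y' : d2 Ps (lift X') (lift Y') (ddt M) = expt M * pull (sigma X' Y').
  exact: (d2_lift_llt bP (cPsi_ll kappa fpsi) (cPsi_lt kappa fpsi)).
have PT2 X' Y' : d2 Ps (lift X') (ddt M) (lift Y') = - (expt M * pull (sigma X' Y')).
  by rewrite (d2_anti fP) PT.
have PT1 X' Y' : d2 Ps (ddt M) (lift X') (lift Y') = expt M * pull (sigma X' Y').
  by rewrite -(d2_cycle fP) PT.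
have tt3 U : d2 Ps (ddt M) (ddt M) U = 0 by rewrite -(d2_cycle fP) -(d2_cycle fP) d2_alt.
rewrite !JA.1 JA.2 !(linB (L1 _ _)) !(linZ (L1 _ _)) !(linB (L2 _ _)) !(linZ (L2 _ _)).
rewrite PT2 PT1 !tt3 (d2_lift_lll (cPsi_ll kappa fpsi)) !(pullD, pullN, pullM); ring.
Qed.

Lemma expt_pull_eq0 (h : Cinf M) : expt M * pull h = 0 -> h = 0.
Proof.
move=> E; apply/CinfP => p; have := congr1 (fun f : Cinf N => f (p, 0)) E.
rewrite evM => /eqP; rewrite mulf_eq0 gt_eqF; last exact: (@expt_gt0 _ _ M (p, 0)).
by move=> /eqP.
Qed.

(** The factor e^t cancels, and the defect [T] is alternating, so [alt3_cyl] leaves only the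
    components with at most one d/dt. *)
Lemma cone_condition :
  (forall W U V : vfield N, d2 Ps (J W) (J U) (J V) = - sgn N b * d2 Om W U V) <-> cone_eq1 /\ cone_eq0.
Proof.
have sp : sgn N b = pull s by exact/CinfP.
split=> [H|[C1 C0]].
  split=> [X Y|X Y V]; apply/eqP; rewrite -subr_eq0; apply/eqP/expt_pull_eq0.
    rewrite pullD mulrDr -d2_Psi_Jt H d2_om_llt sp.
    by rewrite pullN pullM pullN; ring.
  rewrite pullD mulrDr -d2_Psi_J H (d2_lift_lll om_ll) sp.
  by rewrite pullN pullM pullN; ring.
pose T (W U V : vfield N) := d2 Ps (J W) (J U) (J V) + sgn N b * d2 Om W U V.
have T0 (W U V : vfield N) : T W U V = 0.
  move: W U V; apply: alt3_cyl.
  - by move=> W U h V V'; rewrite /T JL (d2_lin fP) (d2_lin fO); ring.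
  - by move=> W U V; rewrite /T (d2_cycle fP) (d2_cycle fO).
  - by move=> W U V; rewrite /T (d2_anti fP) (d2_anti fO); ring.
  - move=> X Y V; rewrite /T d2_Psi_J C0 (d2_lift_lll om_ll) sp pullM pullN; ring.
  - move=> X Y; rewrite /T d2_Psi_Jt C1 d2_om_llt sp pullM pullN; ring.
move=> W U V; apply/eqP; rewrite mulNr -subr_eq0 opprK; apply/eqP; exact: T0.
Qed.

End Equations.

(** * Translation invariance *)

Section Translation.
Variables (R : realType) (n : nat) (M : manifold R n).
Notation N := (cylinder M).
Implicit Types (x y z : tbig N) (W U : vfield N).

Lemma bracketxx W : bracket W W = 0.
Proof. by apply/vfieldP => f; rewrite bracketE subrr. Qed.

(** The defect of L_(d/dt) l = l is function-linear in both arguments, and on the frame of lifts and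
    d/dt all brackets with d/dt vanish. *)
Lemma lie_ddt_homogeneous (l : tensor2 N) : bilin l ->
  (forall X Y, ddt M (l (lift X) (lift Y)) = l (lift X) (lift Y)) ->
  (forall X, ddt M (l (lift X) (ddt M)) = l (lift X) (ddt M)) ->
  (forall X, ddt M (l (ddt M) (lift X)) = l (ddt M) (lift X)) ->
  ddt M (l (ddt M) (ddt M)) = l (ddt M) (ddt M) ->
  forall W U, ddt M (l W U) = l W U + l (bracket (ddt M) W) U + l W (bracket (ddt M) U).
Proof.
move=> [ll lr] Hll Hlt Htl Htt W U; apply/eqP; rewrite -subr_eq0; apply/eqP.
have linW V : lin (fun W => ddt M (l W V) -
    (l W V + l (bracket (ddt M) W) V + l W (bracket (ddt M) V))).
  move=> h W1 W2; rewrite bracketDr bracketZr !(ll _ h W1 W2) (linD (ll V) (_ + _)).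
  rewrite (linD (ll V) (h *: _)) !(linZ (ll V)) vfD vf_mul; ring.
have linU V : lin (fun U => ddt M (l V U) -
    (l V U + l (bracket (ddt M) V) U + l V (bracket (ddt M) U))).
  move=> h W1 W2; rewrite bracketDr bracketZr !(lr _ h W1 W2) (linD (lr V) (_ + _)).
  rewrite (linD (lr V) (h *: _)) !(linZ (lr V)) vfD vf_mul; ring.
apply: (cyl_ind (linW U) _ _ W) => [X|].
  apply: (cyl_ind (linU (lift X)) _ _ U) => [Y|].
    by rewrite !bracket_ddt_lift (lin0 (ll _)) (lin0 (lr _)) Hll !addr0 subrr.
  by rewrite bracket_ddt_lift bracketxx (lin0 (ll _)) (lin0 (lr _)) Hlt !addr0 subrr.
apply: (cyl_ind (linU (ddt M)) _ _ U) => [Y|].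
  by rewrite bracket_ddt_lift bracketxx (lin0 (ll _)) (lin0 (lr _)) Htl !addr0 subrr.
by rewrite bracketxx (lin0 (ll _)) (lin0 (lr _)) Htt !addr0 subrr.
Qed.

Variables (g psi : tensor2 M) (kappa : form1 M).
Hypothesis rg : riemannian g.
Hypothesis fpsi : form2 psi.
Let rG := cGam_riemannian rg.
Let bG := riemannian_bilin rG.
Let fP := cPsi_form2 kappa fpsi.
Let bP := form2_bilin fP.
Notation Gm := (cGam rg).
Notation Ps := (cPsi kappa fpsi).
Notation vl := (vlift bG fP).

Lemma lie_ddt_cGam W U :
  ddt M (Gm W U) = Gm W U + Gm (bracket (ddt M) W) U + Gm W (bracket (ddt M) U).
Proof.
apply: lie_ddt_homogeneous => //.
- by move=> X Y; rewrite cGam_ll ddt_expt_pull.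
- by move=> X; rewrite cGam_lt vf_0.
- by move=> X; rewrite cGam_sym cGam_lt vf_0.
- by rewrite cGam_tt ddt_expt.
Qed.

Lemma lie_ddt_cPsi W U :
  ddt M (Ps W U) = Ps W U + Ps (bracket (ddt M) W) U + Ps W (bracket (ddt M) U).
Proof.
apply: lie_ddt_homogeneous => //.
- by move=> X Y; rewrite cPsi_ll ddt_expt_pull.
- by move=> X; rewrite cPsi_lt ddt_expt_pull.
- by move=> X; rewrite fP.2 cPsi_lt vf_opp ddt_expt_pull.
- have -> : Ps (ddt M) (ddt M) = 0.
    have E : Ps (ddt M) (ddt M) + Ps (ddt M) (ddt M) = 0 by rewrite {1}fP.2 addNr.
    by rewrite -[LHS]mul1r -(half_half N) mulrDl -mulrDr E mulr0.
  by rewrite vf_0.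
Qed.

(** Weight 1 subtracts exactly the term that differentiating e^t adds to the covector, so the
    operator preserves V_b and acts there as the Lie derivative of the vector part. *)
Lemma lie_time_vl b W : lie_time 1 (vl b W) = vl b (bracket (ddt M) W).
Proof.
apply: tbigP => // U.
transitivity (ddt M (Ps W U + sgn N b * Gm W U) -
  (Ps W (bracket (ddt M) U) + sgn N b * Gm W (bracket (ddt M) U)) -
  1 * (Ps W U + sgn N b * Gm W U)); last first.
  by rewrite vfD vf_sgn lie_ddt_cGam lie_ddt_cPsi /= -/(Ps _ _); ring.
by rewrite -(Cinf_cst1 N).
Qed.

Lemma lie_timeD w x y : lie_time w (x + y) = lie_time w x + lie_time w y.
Proof.
apply: tbigP; first exact: bracketDr.
move=> U.
transitivity (ddt M (x.2 U + y.2 U) - (x.2 (bracket (ddt M) U) + y.2 (bracket (ddt M) U)) -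
  Cinf_cst N w * (x.2 U + y.2 U)); first by [].
transitivity ((ddt M (x.2 U) - x.2 (bracket (ddt M) U) - Cinf_cst N w * x.2 U) +
  (ddt M (y.2 U) - y.2 (bracket (ddt M) U) - Cinf_cst N w * y.2 U)); last by [].
by rewrite vfD; ring.
Qed.

Lemma lie_timeN w x : lie_time w (- x) = - lie_time w x.
Proof.
apply/eqP; rewrite -subr_eq0 opprK -lie_timeD addNr; apply/eqP.
have := lie_timeD w 0 0; rewrite addr0 => /eqP.
by rewrite -subr_eq0 opprD addrA subrr add0r oppr_eq0 => /eqP.
Qed.

Section Weight.
Variables (S Phi : tbig N -> tbig N) (G : tbig N -> tbig N -> Cinf N).
Hypothesis mG : generalized_metric G S.
Hypothesis SV : given_by S (cone_metric g) (cone_form psi kappa).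
Hypothesis PL : linear Phi.
Hypothesis PSC : forall x, Phi (S x) = S (Phi x).

Let SL : linear S. Proof. by have [] := mG. Qed.
Let SS x : S (S x) = x. Proof. by have [_ _ _ ->] := mG. Qed.

Lemma eigen_coneP b x : eigen S b x <-> forall U, x.2 U = Ps x.1 U + sgn N b * Gm x.1 U.
Proof.
split=> [/SV H U|H]; first by apply/CinfP => q; exact: H.
by apply/SV => U q; rewrite H.
Qed.

Lemma lie_time_S x : lie_time 1 (S x) = S (lie_time 1 x).
Proof.
have E b y : eigen S b y -> lie_time 1 (S y) = S (lie_time 1 y).
  move=> ey; have yE : y = vl b y.1 by apply: tbigP => //; apply/eigen_coneP.
  have ely : eigen S b (lie_time 1 y) by rewrite yE lie_time_vl; apply/eigen_coneP.
  rewrite ey ely; case: (b); rewrite ?expr0 ?expr1 ?scale1r ?scaleN1r//.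
  exact: lie_timeN.
have [x1 [x2 [e1 e2 ->]]] := eigen_split SL SS x.
by rewrite !(tlinD SL, lie_timeD) (E _ _ e1) (E _ _ e2).
Qed.

(** The operators of weight 0 and 1 differ by this projection, so the two kinds of invariance agree
    once Phi commutes with it. *)
Let E (x : tbig N) : tbig N := (0, x.2).

Let ED x y : E (x + y) = E x + E y.
Proof. by apply: tbigP; [exact/esym/addr0|]. Qed.

Let EN x : E (- x) = - E x.
Proof. by apply: tbigP; [exact/esym/oppr0|]. Qed.

Let EE x : E (E x) = E x. Proof. by []. Qed.

Lemma lie_time01 x : lie_time 0 x = lie_time 1 x + E x.
Proof.
apply: tbigP; first exact/esym/addr0.
move=> U; have E1 : (Cinf_cst N 0 : Cinf N) = 0 by exact/CinfP.
transitivity ((ddt M (x.2 U) - x.2 (bracket (ddt M) U)) - Cinf_cst N 0 * x.2 U); first by [].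
transitivity ((ddt M (x.2 U) - x.2 (bracket (ddt M) U)) - Cinf_cst N 1 * x.2 U + x.2 U); last by [].
by rewrite E1 Cinf_cst1; ring.
Qed.

Let lie_time_E x : lie_time 1 (E x) = E (lie_time 1 x).
Proof. by apply: tbigP => //; exact: bracket0r. Qed.

Lemma metric_definite x : pairing (S x) x = 0 -> x = 0.
Proof.
move=> x0; have [[_ _ _ G0] _ GE _ _] := mG.
have Gx q : G x x q = 0 by rewrite -GE x0 mulr0.
apply: tbigP => [|U].
  by apply/vfieldP => f; apply/CinfP => q; have [+ _] := G0 _ _ (Gx q); exact.
by apply/CinfP => q; have [_ +] := G0 _ _ (Gx q); exact.
Qed.

(* With D = lie_time 1, the hypothesis is [Phi, D] = - [Phi, E].  As S and E
   commute with D, Phi commutes with T = [S, E] and with [E, T], hence with the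
   two off-diagonal blocks of S, which are definite. *)
Lemma weight0_weight1 : translation_invariant 0 Phi -> translation_invariant 1 Phi.
Proof.
move=> H; pose D := @lie_time R n M 1.
have DD a c : D (a + c) = D a + D c := lie_timeD 1 a c.
have DN a : D (- a) = - D a := lie_timeN 1 a.
have DS a : D (S a) = S (D a) := lie_time_S a.
have DE a : D (E a) = E (D a) := lie_time_E a.
have HD x : Phi (D x) + Phi (E x) = D (Phi x) + E (Phi x).
  by rewrite -(tlinD PL) -!lie_time01 H.
have PD := tlinD PL; have PN := tlinN PL; have SD := tlinD SL; have SN := tlinN SL.
have swap (a b c d : tbig N) : a - b = c - d -> a - c = b - d.
  by move=> /(congr1 (fun y => y + (b - c))); rewrite addrA subrK -addrA (addrC (- d)) addrA subrKC => ->.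
have inj2 (a b : tbig N) : a + a = b + b -> a = b.
  move=> ab; rewrite -[a]scale1r -[b]scale1r -(half_half N) !scalerDl -!scalerDr ab.
  by [].
pose C x := Phi (E x) - E (Phi x).
have CE x : C x = D (Phi x) - Phi (D x).
  have E1 : Phi (E x) = D (Phi x) + E (Phi x) - Phi (D x).
    by rewrite -HD addrAC subrr add0r.
  by rewrite /C E1 addrAC addrK.
pose T x := S (E x) - E (S x).
have TD a c : T (a + c) = T a + T c by rewrite /T !(ED, SD) opprD addrACA.
have TN a : T (- a) = - T a by rewrite /T !(EN, SN) opprD.
have DT x : D (T x) = T (D x).
  by rewrite /T DD DN DS !DE DS.
have PT x : Phi (T x) = T (Phi x).
  have : C (S x) = S (C x).
    by rewrite !CE SD SN PSC !DS PSC.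
  rewrite /C /T PD PN SD SN -!PSC => /swap e.
  by apply: oppr_inj; rewrite !opprB.
pose K x := E (T x) - T (E x).
have PK x : Phi (K x) = K (Phi x).
  have : C (T x) = T (C x) by rewrite !CE PT DT DT PT TD TN.
  move=> e; rewrite /K PD PN (PT (E x)); apply: swap.
  by rewrite -(PT x) -[LHS]/(C (T x)) e /C TD TN.
(* beta = (1 - E) S E and chi = E S (1 - E) are the off-diagonal blocks of S; T is their difference
   and K minus their sum. *)
pose beta x := S (E x) - E (S (E x)).
pose chi x := E (S x) - E (S (E x)).
have KE y : K y = (E (S (E y)) - E (S y)) - (S (E y) - E (S (E y))).
  by rewrite /K {1}/T ED EN.
have Pbeta x : Phi (beta x) = beta (Phi x).
  have bE y : beta y + beta y = T y - K y.
    by rewrite KE /T !opprB [RHS]addrCA [X in _ = _ + X]addrA subrK.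
  by apply: inj2; rewrite -PD !bE PD PN PT PK.
have Pchi x : Phi (chi x) = chi (Phi x).
  have cE y : chi y + chi y = - (T y + K y).
    by rewrite KE /T opprD !opprB [RHS]addrA subrKA.
  by apply: inj2; rewrite -PD !cE PN PD PT PK.
have S0 : S 0 = 0 := tlin0 SL.
(* chi kills E x and hence, commuting with Phi, also v. So v - E v and its image under S both have
   zero covector, and the metric vanishes on v - E v. *)
have P1 x : E (Phi (E x)) = Phi (E x).
  set v := Phi (E x).
  have ESy : E (S (v - E v)) = 0.
    by rewrite SD SN ED EN -/(chi v) -Pchi /chi subrr (tlin0 PL).
  apply/eqP; rewrite eq_sym -subr_eq0; apply/eqP/metric_definite.
  rewrite pairingE.
  have -> : (S (v - E v)).2 = 0 by exact: (congr1 snd ESy).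
  have -> : (v - E v).2 = 0 by exact: subrr.
  by apply/CinfP => q; rewrite evM evD; rewrite addr0 mulr0.
(* Likewise beta kills u = x - E x and Phi u, so z = E (Phi u) and S z both have zero vector part,
   which forces z = 0. *)
have P2 x : E (Phi x) = E (Phi (E x)).
  apply/eqP; rewrite -subr_eq0 -EN -ED -PN -PD; apply/eqP/metric_definite.
  set u := x - E x; set z := E (Phi u).
  have bz : beta (Phi u) = 0.
    have Eu : E u = 0 by rewrite /u ED EN EE subrr.
    by rewrite -Pbeta /beta Eu S0 subrr (tlin0 PL).
  have -> : pairing (S z) z = half N * ((S z).2 0 + z.2 (S z).1) by [].
  have -> : (S z).1 = 0.
    have /eqP : S z - E (S z) = 0 := bz.
    by rewrite subr_eq0 => /eqP ->.
  by rewrite !(lin0 (lin_form1 _)) addr0 mulr0.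
have C0 x : C x = 0 by rewrite /C P2 P1 subrr.
by move=> x; have := CE x; rewrite C0 => /esym/eqP; rewrite subr_eq0 => /eqP.
Qed.

End Weight.
End Translation.

(** * The correspondence *)

Section Cone_lifts.
Variables (R : realType) (n : nat) (M : manifold R n).
Notation N := (cylinder M).
Implicit Types (x y : tbig N) (W U : vfield N).
Variables (g psi : tensor2 M) (kappa : form1 M).
Hypothesis rg : riemannian g.
Hypothesis fpsi : form2 psi.
Let rG := cGam_riemannian rg.
Let bG := riemannian_bilin rG.
Let sG := cGam_sym rg.
Let fP := cPsi_form2 kappa fpsi.
Let bP := form2_bilin fP.
Notation Gm := (cGam rg).
Notation Ps := (cPsi kappa fpsi).
Notation vl := (vlift bG fP).

Lemma cone_vlift_lin b h W U : vl b (h *: W + U) = h *: vl b W + vl b U.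
Proof.
apply: tbigP => // V.
transitivity (Ps (h *: W + U) V + sgn N b * Gm (h *: W + U) V); first by [].
rewrite (bP.1 V) (bG.1 V).
transitivity (h * (Ps W V + sgn N b * Gm W V) + (Ps U V + sgn N b * Gm U V)); last by [].
ring.
Qed.

Lemma cone_vlift0 b : vl b 0 = 0.
Proof.
apply: tbigP => // V; transitivity (Ps 0 V + sgn N b * Gm 0 V); first by [].
by rewrite (lin0 (bP.1 V)) (lin0 (bG.1 V)) mulr0 addr0.
Qed.

Lemma cone_vliftZ b h W : vl b (h *: W) = h *: vl b W.
Proof. by rewrite -[h *: W]addr0 cone_vlift_lin cone_vlift0 addr0. Qed.

Lemma cone_vliftN b W : vl b (- W) = - vl b W.
Proof. by rewrite -scaleN1r cone_vliftZ scaleN1r. Qed.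

Lemma cone_vliftD b W U : vl b (W + U) = vl b W + vl b U.
Proof. by rewrite -[W in LHS]scale1r cone_vlift_lin scale1r. Qed.

Lemma cone_vlift_Vpm b x :
  Vpm (cone_metric g) (cone_form psi kappa) b x <-> x = vl b x.1.
Proof.
split=> [H|->]; last by [].
by apply: tbigP => // U; apply/CinfP => q; exact: H.
Qed.

Lemma pairing_vlift b W U : pairing (vl b W) (vl b U) = sgn N b * Gm W U.
Proof.
rewrite pairingE.
have -> : (vl b W).2 (vl b U).1 = Ps W U + sgn N b * Gm W U by [].
have -> : (vl b U).2 (vl b W).1 = Ps U W + sgn N b * Gm U W by [].
rewrite fP.2 (sG U).
transitivity ((half N + half N) * (sgn N b * Gm W U)); first ring.
by rewrite half_half mul1r.
Qed.

Lemma pairing_vlift_ft W U : pairing (vl false W) (vl true U) = 0.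
Proof.
rewrite pairingE.
have -> : (vl false W).2 (vl true U).1 = Ps W U + sgn N false * Gm W U by [].
have -> : (vl true U).2 (vl false W).1 = Ps U W + sgn N true * Gm U W by [].
by rewrite fP.2 (sG U) -!sgnE expr0 expr1; ring.
Qed.

Lemma expt_pull_inj : injective (fun h : Cinf M => expt M * pull h).
Proof.
move=> h k /eqP; rewrite -subr_eq0 -mulrBr -pullN -pullD => /eqP /expt_pull_eq0 /eqP.
by rewrite subr_eq0 => /eqP.
Qed.

Lemma hpart_lift_ddt X (a : Cinf N) t : hpart (lift X - a *: ddt M) t = X.
Proof.
have -> : lift X - a *: ddt M = (- a) *: ddt M + lift X by rewrite scaleNr addrC.
by rewrite hpart_lin hpart_ddt scaler0 add0r hpart_lift.
Qed.

Lemma cone_action_inj (A A' : contact_triple M) J :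
  cone_action A J -> cone_action A' J -> A = A'.
Proof.
move=> [A1 A2] [B1 B2].
have EF : tF A = tF A'.
  by apply/funext => X; have := A1 X; rewrite B1 => /(congr1 (fun W : vfield N => hpart W 0)); rewrite !hpart_lift_ddt.
have EZ : tZ A = tZ A'.
  by have := A2; rewrite B2 => /(congr1 (fun W : vfield N => hpart W 0)); rewrite !hpart_lift.
have EX : txi A = txi A'.
  apply/form1P => X; have := A1 X; rewrite B1 => /(congr1 (fun W : vfield N => W (time M))).
  rewrite !vf_addE !vf_oppE !vf_scaleE !lift_time ddt_time !mulr1 !add0r => /oppr_inj.
  by move=> /(congr1 (slice 0)); rewrite !slice_pull.
by case: A A' EF EZ EX {A1 A2 B1 B2} => F Z xi [F' Z' xi'] /= -> -> ->.
Qed.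

Section Kahler.
Variables (S Phi : tbig N -> tbig N).
Hypothesis SL : linear S.
Hypothesis SS : forall x, S (S x) = x.
Hypothesis Sg : forall x y, pairing (S x) (S y) = pairing x y.
Hypothesis SV : given_by S (cone_metric g) (cone_form psi kappa).
Hypothesis PL : linear Phi.
Hypothesis PS : forall x y, pairing (Phi x) y = - pairing x (Phi y).
Hypothesis PP : forall x, Phi (Phi x) = - x.
Hypothesis PSC : forall x, Phi (S x) = S (Phi x).

(** [sasakian_cone_eq] needs i(Z) d xi = 0, which comes from integrability of J b; so integrability
    is split off first and the equations are compared under it. *)
Lemma kahler_equations (A : bool -> contact_triple M) (J : bool -> vfield N -> vfield N) :
  (forall b, almost_contact_metric g (A b)) -> (forall b, linear (J b)) ->
  (forall b, cone_action (A b) (J b)) ->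
  (forall b x, eigen S b x -> (Phi x).1 = J b x.1) ->
  (generalized_complex Phi /\ generalized_complex (S \o Phi)) <->
  forall b, Defs.integrable (J b) /\ sasakian_equations g psi kappa b (A b).
Proof.
move=> HA JL JA PJ.
have JJ b := cone_J_sq (JL b) (JA b) (HA b).
have JG b := cone_J_iso (JL b) (JA b) rg (HA b).
have fO b := om_form2 bG sG (JL b) (JJ b) (JG b).
have CC b := cone_condition kappa b fpsi (JL b) (JA b) (fO b).
have E b (IJ : Defs.integrable (J b)) :=
  sasakian_cone_eq kappa b rg fpsi (HA b) (normal_d_xi (JL b) (JA b) (HA b) IJ).
have VE b x := eigen_coneP rg fpsi SV b x.
have bih := gk_bih bG sG fP SL SS Sg PL PS PP PSC VE JL JJ JG PJ.
split=> [/bih H b|H].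
  by have [IJ H1] := H b; split=> //; apply/(E b IJ)/CC.
by apply/bih => b; have [IJ H1] := H b; split=> //; apply/CC/(E b IJ).
Qed.

Lemma Phi_cone_vlift b W : Phi (vl b W) = vl b (Phi (vl b W)).1.
Proof.
have e : eigen S b (vl b W) by apply/(eigen_coneP rg fpsi SV).
have /(eigen_coneP rg fpsi SV) e' := eigen_Phi PL PSC e.
exact: tbigP.
Qed.

Hypothesis T1 : translation_invariant 1 Phi.

(* The structure tau_b o Phi o tau_b^-1. *)
Definition cone_J b W := (Phi (vl b W)).1.

Lemma cone_J_lin b : linear (cone_J b).
Proof. by move=> h W U; rewrite /cone_J cone_vlift_lin PL. Qed.

Let PV b W : Phi (vl b W) = vl b (cone_J b W). Proof. exact: Phi_cone_vlift. Qed.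

Let JJ b W : cone_J b (cone_J b W) = - W.
Proof. by rewrite {1}/cone_J -PV PP. Qed.

Let JG b W U : Gm (cone_J b W) (cone_J b U) = Gm W U.
Proof.
have s0 c d : sgn N b * c = sgn N b * d -> c = d.
  by move=> /(congr1 (fun c => sgn N b * c)); rewrite !mulrA sgn2 !mul1r.
by apply: s0; rewrite -!pairing_vlift -!PV pairing_Phi.
Qed.

Let Jt b W : bracket (ddt M) (cone_J b W) = cone_J b (bracket (ddt M) W).
Proof.
have := congr1 fst (T1 (vl b W)); rewrite lie_time_vl => E; exact: esym E.
Qed.

Section Triple.
Variable b : bool.
Notation J := (cone_J b).
Let JL := @cone_J_lin b.

Lemma cone_xi_subproof : (fun X => - slice 0 (J (lift X) (time M))) \in one_form M.
Proof.
apply/asboolP => h X Y.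
change (- slice 0 (J (lift (h *: X + Y)) (time M)) =
  h * (- slice 0 (J (lift X) (time M))) + (- slice 0 (J (lift Y) (time M)))).
apply/CinfP => p; rewrite lift_lin JL.
change (- (h p * J (lift X) (time M) (p, 0) + J (lift Y) (time M) (p, 0)) =
  h p * (- J (lift X) (time M) (p, 0)) - J (lift Y) (time M) (p, 0)).
by ring.
Qed.

(** Evaluation at t = 0 loses nothing: J preserves the fields that commute with d/dt, and their
    coefficients are constant in t by [ddt_eq0]. *)
Definition cone_triple : contact_triple M :=
  ContactTriple (fun X => hpart (J (lift X)) 0) (hpart (J (ddt M)) 0) (MkForm1 cone_xi_subproof).

Notation F := (tF cone_triple).
Notation Z := (tZ cone_triple).
Notation xi := (txi cone_triple).

Lemma cone_J_stationary W f : bracket (ddt M) W = 0 -> ddt M (J W f) = J W (ddt M f).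
Proof.
move=> W0; have := Jt b W; rewrite W0 (J0 JL) => /(congr1 (fun V : vfield N => V f)).
by rewrite bracketE vf_0E => /eqP; rewrite subr_eq0 => /eqP.
Qed.

Lemma cone_J_pull W h : bracket (ddt M) W = 0 -> J W (pull h) = pull (hpart (J W) 0 h).
Proof. by move=> W0; rewrite [LHS]ddt_eq0// cone_J_stationary// ddt_pull vf_0. Qed.

Lemma cone_J_time W : bracket (ddt M) W = 0 -> J W (time M) = pull (slice 0 (J W (time M))).
Proof. by move=> W0; rewrite -ddt_eq0// cone_J_stationary// ddt_time vf_1. Qed.

Lemma cone_triple_action : cone_action cone_triple J.
Proof.
split=> [X|].
  have X0 := bracket_ddt_lift X.
  apply: vfieldN_ext => [h|]; rewrite vf_addE vf_oppE vf_scaleE.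
    by rewrite cone_J_pull// lift_pull ddt_pull mulr0 subr0.
  by rewrite cone_J_time// lift_time ddt_time mulr1 add0r -pullN opprK.
have t0 := bracketxx (ddt M); set c := slice 0 (J (ddt M) (time M)).
have E : J (ddt M) = pull c *: ddt M + lift Z.
  apply: vfieldN_ext => [h|]; rewrite vf_addE vf_scaleE.
    by rewrite cone_J_pull// lift_pull ddt_pull mulr0 add0r.
  by rewrite cone_J_time// lift_time ddt_time mulr1 addr0.
(* The d/dt-component c of J (d/dt) vanishes because Gam(J (d/dt), d/dt) = e^t c and J is skew for
   Gam. *)
suff c0 : c = 0 by rewrite E c0 pull0 scale0r add0r.
apply: expt_pull_eq0.
have G0 : Gm (J (ddt M)) (ddt M) = 0.
  have A : Gm (J (ddt M)) (ddt M) = - Gm (J (ddt M)) (ddt M).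
    exact: (JGl bG sG (JJ b) (JG b)).
  rewrite -[LHS]mul1r -(half_half N) mulrDl {1}A mulrN addNr //.
by rewrite -G0 E (bG.1 _) cGam_tt cGam_lt addr0 mulrC.
Qed.

(** The axioms are the components of J^2 = -1 and of the invariance of Gam, taken on lifts and on
    d/dt. *)
Lemma cone_triple_acm : almost_contact_metric g cone_triple.
Proof.
have [J1 J2] := cone_triple_action.
have JB W U : J (W - U) = J W - J U by rewrite (JD JL) (JN JL).
have hE X Y c : lift X - c *: ddt M = - lift Y -> X = - Y /\ c = 0.
  move=> E; split.
    have := congr1 (fun W : vfield N => hpart W 0) E.
    by rewrite -liftN hpart_lift hpart_lift_ddt.
  have := congr1 (fun W : vfield N => W (time M)) E.
  rewrite vf_addE !vf_oppE vf_scaleE !lift_time ddt_time mulr1 add0r oppr0 => /eqP.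
  by rewrite oppr_eq0 => /eqP.
have pull_eq0 (h : Cinf M) : pull h = 0 -> h = 0.
  by move=> /(congr1 (slice 0)); rewrite slice_pull => ->; exact/CinfP.
have JX X : F (F X) - (xi X : Cinf M) *: Z = - X /\ xi (F X) = 0.
  have := JJ b (lift X); rewrite J1 JB (JZ JL) J1 J2 addrAC -liftZ -liftN -liftD.
  by move=> /hE[-> /pull_eq0].
have JZZ : F Z = 0 /\ xi Z = 1.
  have := JJ b (ddt M); rewrite J2 J1 => /(congr1 (fun W => W + ddt M)).
  rewrite addNr -addrA -{2}[ddt M]scale1r -pull_1 -scaleNr -scalerDl => E.
  have E' : lift (F Z) - (pull (xi Z) - pull 1) *: ddt M = - lift 0.
    by rewrite lift0 oppr0 -E; congr (_ + _); rewrite -scaleNr opprB addrC.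
  have [-> /eqP] := hE _ _ _ E'; rewrite oppr0 subr_eq0 => /eqP /(congr1 (slice 0)).
  by rewrite !slice_pull.
split.
- move=> h X Y.
  change (hpart (J (lift (h *: X + Y))) 0 = h *: hpart (J (lift X)) 0 + hpart (J (lift Y)) 0).
  by rewrite lift_lin JL hpart_lin slice_pull.
- by case: JZZ.
- by move=> X; case: (JX X).
- by move=> X; case: (JX X) => /eqP + _; rewrite subr_eq => /eqP.
- move=> X Y; have := JG b (lift X) (lift Y).
  rewrite !J1 !(linB (bG.1 _)) !(linB (bG.2 _)) !(linZ (bG.1 _)) !(linZ (bG.2 _)).
  rewrite (sG (ddt M)) !cGam_ll !cGam_lt cGam_tt => E.
  apply/eqP; rewrite eq_sym subr_eq; apply/eqP/expt_pull_inj.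
  by rewrite -E pullD pullM; ring.
Qed.

End Triple.
End Kahler.
End Cone_lifts.

(** * From the generalized structure to the contact pair *)

Section Forward.
Variables (R : realType) (n : nat) (M : manifold R n).
Notation N := (cylinder M).
Variables (g psi : tensor2 M) (kappa : form1 M).
Hypothesis rg : riemannian g.
Hypothesis fpsi : form2 psi.

Lemma generalized_sasakian_pair (w : R) (Phi : tbig N -> tbig N) : w = 0 \/ w = 1 ->
  generalized_sasakian w g psi kappa Phi ->
  exists! A : bool -> contact_triple M,
    sasakian_pair g psi kappa A /\ corresponds g psi kappa Phi A.
Proof.
move=> w01 [Tw [G [S [mG SV [PSC gP gSP]]]]].
have [PL PS PP _] := gP.
have [_ SL _ SS Sg] := mG.
have T1 : translation_invariant 1 Phi.
  case: w01 Tw => -> // T0; exact: (weight0_weight1 rg fpsi mG SV PL PSC T0).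
pose J := cone_J kappa rg fpsi Phi.
pose A b := cone_triple kappa rg fpsi PL b.
have HA b : almost_contact_metric g (A b) := cone_triple_acm rg fpsi SV PL PS PP PSC T1 b.
have JA b : cone_action (A b) (J b) := cone_triple_action rg fpsi SV PL PS PP PSC T1 b.
have JL b : linear (J b) := cone_J_lin kappa rg fpsi PL b.
have FL b : linear (tF (A b)) by have [] := HA b.
have JC b := cone_action_image (FL b) (JL b) (JA b).
have PJ b x : Vpm (cone_metric g) (cone_form psi kappa) b x -> (Phi x).1 = J b x.1.
  by move=> /(cone_vlift_Vpm kappa rg fpsi) {1}->.
have PJ' b x : eigen S b x -> (Phi x).1 = J b x.1.
  by move=> /(SV b x); exact: PJ.
have KE := kahler_equations rg fpsi SL SS Sg SV PL PS PP PSC HA JL JA PJ'.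
exists A; split.
  split=> [b|b x Vx]; last by rewrite (PJ b x Vx); exact: JC.
  have [IJ E] := KE.1 (conj gP gSP) b.
  by split; [exact: HA|exists (J b)|exact: E].
(* [corresponds] determines J b on every W, as V_b projects onto the tangent bundle, and J b
   determines the triple. *)
move=> A' [SA' CA']; apply/funext => b.
have [HA' _ _] := SA' b; have [FL' _ _ _ _] := HA'.
have JC' W : cone_image (A' b) W (J b W).
  by apply: (CA' b (vlift _ _ b W)); exact/(cone_vlift_Vpm kappa rg fpsi).
by have [_ JA'] := cone_image_action FL' JC'; exact: cone_action_inj (JA b) JA'.
Qed.

End Forward.

(** * From the contact pair to the generalized structure *)

Section Backward.
Variables (R : realType) (n : nat) (M : manifold R n).
Notation N := (cylinder M).
Implicit Types (x y : tbig N) (W U : vfield N).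
Variables (g psi : tensor2 M) (kappa : form1 M).
Hypothesis rg : riemannian g.
Hypothesis fpsi : form2 psi.
Let rG := cGam_riemannian rg.
Let bG := riemannian_bilin rG.
Let sG := cGam_sym rg.
Let fP := cPsi_form2 kappa fpsi.
Let bP := form2_bilin fP.
Notation Gm := (cGam rg).
Notation Ps := (cPsi kappa fpsi).
Notation vl := (vlift bG fP).

Lemma half_inj (f : Cinf N) : f + f = 0 -> f = 0.
Proof. by move=> ff; rewrite -[f]mul1r -(half_half N) mulrDl -mulrDr ff mulr0. Qed.

Lemma cGam_nondeg W : (forall U, Gm W U = 0) -> W = 0.
Proof.
move=> W0; apply/vfieldP => f; apply/CinfP => q.
by apply: (riemannian_eq0 rG) => U; rewrite W0.
Qed.

(** If W + B = X, the covector of (W, flat_+ W) + (B, flat_- B) is flat_+ X - 2 Gam(B, .). So B is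
    minus half the field dual to x.2 - flat_+ X, and [musical] provides it. *)
Lemma vlift2_exists x : exists P : vfield N * vfield N, x = vl false P.1 + vl true P.2.
Proof.
have [C EC] := musical rG (x.2 - flat bG fP false x.1).
pose B := - (half N *: C); exists (x.1 - B, B).
apply: tbigP; first exact/esym/subrK.
move=> U.
have EU : Gm C U = x.2 U - (Ps x.1 U + sgn N false * Gm x.1 U) by rewrite EC.
transitivity ((Ps (x.1 - B) U + sgn N false * Gm (x.1 - B) U) +
  (Ps B U + sgn N true * Gm B U)); last by [].
rewrite !(linB (bP.1 U)) !(linB (bG.1 U)) -!sgnE expr0 expr1.
have -> : Gm B U = - (half N * Gm C U) by rewrite /B (linN (bG.1 U)) (linZ (bG.1 U)).
transitivity (Ps x.1 U + Gm x.1 U + (half N + half N) * Gm C U); last ring.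
by rewrite half_half mul1r EU -sgnE expr0; ring.
Qed.

Lemma vlift2_eq0 W U : vl false W + vl true U = 0 -> W = 0 /\ U = 0.
Proof.
move=> E; have WU : W + U = 0 := congr1 fst E.
have UE : U = - W by apply/eqP; rewrite -addr_eq0 addrC WU.
suff W0 : W = 0 by rewrite UE W0 oppr0.
apply: cGam_nondeg => V; apply: half_inj.
have : (Ps W V + sgn N false * Gm W V) + (Ps U V + sgn N true * Gm U V) = 0.
  exact: (congr1 (fun x : tbig N => x.2 V) E).
rewrite UE (linN (bP.1 V)) (linN (bG.1 V)) -!sgnE expr0 expr1 => <-; ring.
Qed.

Lemma vlift2_inj W W' U U' :
  vl false W + vl true U = vl false W' + vl true U' -> W = W' /\ U = U'.
Proof.
move=> /eqP; rewrite -subr_eq0 opprD addrACA -!(cone_vliftN kappa rg fpsi).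
by rewrite -!(cone_vliftD kappa rg fpsi) => /eqP /vlift2_eq0[/eqP + /eqP]; rewrite !subr_eq0 => /eqP-> /eqP->.
Qed.

Variable P : tbig N -> vfield N * vfield N.
Hypothesis PE : forall x, x = vl false (P x).1 + vl true (P x).2.

Definition part (b : bool) x := if b then (P x).2 else (P x).1.

Lemma partE x : x = vl false (part false x) + vl true (part true x).
Proof. exact: PE. Qed.

Lemma part_unique x (W : bool -> vfield N) :
  x = vl false (W false) + vl true (W true) -> forall b, part b x = W b.
Proof.
by move=> E b; have := partE x; rewrite {1}E => /vlift2_inj[E1 E2]; case: b.
Qed.

(** P comes from a choice without any regularity; linearity follows from uniqueness of the
    decomposition. *)
Lemma part_lin b : linear (part b).
Proof.
move=> h x y; apply: (@part_unique _ (fun b => h *: part b x + part b y)).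
by rewrite {1}[x]partE {1}[y]partE !(cone_vlift_lin kappa rg fpsi) scalerDr addrACA.
Qed.

Lemma partZ b h x : part b (h *: x) = h *: part b x.
Proof.
apply: (@part_unique _ (fun b => h *: part b x)).
by rewrite {1}[x]partE scalerDr !(cone_vliftZ kappa rg fpsi).
Qed.

Lemma part_vlift b c W : part c (vl b W) = if b == c then W else 0.
Proof.
apply: (@part_unique _ (fun c => if b == c then W else 0)).
by case: b; rewrite /= (cone_vlift0 kappa rg fpsi) ?addr0 ?add0r.
Qed.

Definition block (J : bool -> vfield N -> vfield N) x : tbig N :=
  vl false (J false (part false x)) + vl true (J true (part true x)).

Lemma part_block J b x : part b (block J x) = J b (part b x).
Proof. exact: (@part_unique _ (fun b => J b (part b x))). Qed.

Lemma block_ext J x y : (forall b, part b y = J b (part b x)) -> block J x = y.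
Proof. by move=> H; rewrite [y]partE !H. Qed.

Lemma block_lin J : (forall b, linear (J b)) -> linear (block J).
Proof.
move=> JL h x y; apply: block_ext => b.
by rewrite !part_lin !part_block JL.
Qed.

Lemma pairing_part x y :
  pairing x y = Gm (part false x) (part false y) - Gm (part true x) (part true y).
Proof.
rewrite {1}[x]partE {1}[y]partE !(pairingDl, pairingDr).
rewrite (pairingC (vl true _) (vl false _)) !pairing_vlift_ft !pairing_vlift.
by rewrite -!sgnE expr0 expr1; ring.
Qed.

Lemma part_ext x y : (forall b, part b x = part b y) -> x = y.
Proof. by move=> E; rewrite [x]partE [y]partE !E. Qed.

Lemma part_Vpm b x : x = vl b x.1 <-> part (~~ b) x = 0.
Proof.
split=> [->|p0]; first by rewrite part_vlift; case: b.
have E : x = vl b (part b x).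
  apply: part_ext => c; rewrite part_vlift; case: eqP => [->//|cb].
  by rewrite -[RHS]p0; congr (part _ x); case: b c cb {p0} => -[].
by rewrite E.
Qed.

Definition part_sign := block (fun b W => (-1) ^+ b *: W).
Notation S := part_sign.

Lemma part_S b x : part b (S x) = (-1) ^+ b *: part b x.
Proof. exact: part_block. Qed.

Lemma part_sign_lin : linear S.
Proof.
by apply: block_lin => b h W U; rewrite scalerDr !scalerA mulrC.
Qed.

Lemma part_sign_eigen (b : bool) x : S x = (-1) ^+ b *: x <-> x = vl b x.1.
Proof.
split=> [E|/part_Vpm p0].
  apply/part_Vpm; have := congr1 (part (~~ b)) E; rewrite part_S partZ => {}E.
  apply/vfieldP => f; apply: half_inj.
  have := congr1 (fun W : vfield N => W f) E.
  case: (b); rewrite ?expr0 ?expr1 !vf_scaleE ?mul1r ?mulN1r => Ef.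
    by rewrite {1}Ef addNr.
  by rewrite -{1}Ef addNr.
apply: part_ext => c; rewrite part_S partZ.
have [->//|cb] := eqVneq c b; have -> : c = ~~ b by case: b c cb {p0} => -[].
by rewrite p0 !scaler0.
Qed.

Lemma part_signK x : S (S x) = x.
Proof.
by apply: part_ext => b; rewrite !part_S scalerA -expr2 sqrr_sign scale1r.
Qed.

Lemma pairing_part_sign x y : pairing (S x) y =
  Gm (part false x) (part false y) + Gm (part true x) (part true y).
Proof.
rewrite pairing_part !part_S !(linZ (bG.1 _)) expr0 expr1; ring.
Qed.

Definition part_metric x y := Cinf_cst N 2 * pairing (S x) y.

Lemma part_sign_metric : generalized_metric part_metric S.
Proof.
have [_ _ Gp G0] := rG.
have SL := part_sign_lin.
split=> //; first split.
- by move=> h x y z; rewrite /part_metric SL pairing_lin; ring.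
- by move=> x y; rewrite /part_metric !pairing_part_sign !(sG (part _ y)).
- move=> x q; rewrite /part_metric pairing_part_sign evM ev_cst mulr_ge0// evD.
  by rewrite addr_ge0.
- move=> x q; rewrite /part_metric pairing_part_sign evM ev_cst evD => /eqP.
  rewrite mulf_eq0 pnatr_eq0 orFb paddr_eq0// => /andP[/eqP /G0 p0 /eqP /G0 p1].
  split=> [f|Y].
    have -> : x.1 = part false x + part true x := congr1 fst (partE x).
    by rewrite vf_addE evD p0 p1 addr0.
  have -> : x.2 Y = (Ps (part false x) Y + sgn N false * Gm (part false x) Y) +
      (Ps (part true x) Y + sgn N true * Gm (part true x) Y).
    exact: (congr1 (fun x : tbig N => x.2 Y) (partE x)).
  (* The two parts vanish only at q; tensoriality carries this to their covectors at q. *)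
  have T W : (forall f, W f q = 0) -> Ps W Y q = 0 /\ Gm W Y q = 0.
    by move=> W0; split; [exact: (lin_tensorial (bP.1 Y) W0)|exact: (lin_tensorial (bG.1 Y) W0)].
  have [[e1 e2] [e3 e4]] := (T _ p0, T _ p1).
  transitivity ((Ps (part false x) Y q + sgn N false q * Gm (part false x) Y q) +
    (Ps (part true x) Y q + sgn N true q * Gm (part true x) Y q)); first by [].
  by rewrite e1 e2 e3 e4 !mulr0 !addr0.
- exact: part_signK.
- move=> x y; rewrite !pairing_part !part_S.
  rewrite !(linZ (bG.1 _)) !(linZ (bG.2 _)) expr0 expr1; ring.
Qed.

Lemma part_sign_given_by : given_by S (cone_metric g) (cone_form psi kappa).
Proof.
by move=> b x; split=> [/part_sign_eigen|] /(cone_vlift_Vpm kappa rg fpsi) => [|/part_sign_eigen].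
Qed.

Lemma part_lie_time b x : part b (lie_time 1 x) = bracket (ddt M) (part b x).
Proof.
apply: (@part_unique _ (fun b => bracket (ddt M) (part b x))).
by rewrite {1}[x]partE lie_timeD !lie_time_vl.
Qed.

Lemma contact_pair_generalized (A : bool -> contact_triple M) :
  sasakian_pair g psi kappa A ->
  exists! Phi : tbig N -> tbig N,
    generalized_sasakian 1 g psi kappa Phi /\ corresponds g psi kappa Phi A.
Proof.
move=> SA.
have HA b : almost_contact_metric g (A b) by have [] := SA b.
have nJ b : normal (A b) by have [] := SA b.
have [J HJ] := choice nJ.
have JC b W : cone_image (A b) W (J b W) := (HJ b).1 W.
have IJ b := (HJ b).2.
have FL b : linear (tF (A b)) by have [] := HA b.
have JL b : linear (J b) := (cone_image_action (FL b) (JC b)).1.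
have JA b : cone_action (A b) (J b) := (cone_image_action (FL b) (JC b)).2.
have JJ b := cone_J_sq (JL b) (JA b) (HA b).
have JG b := cone_J_iso (JL b) (JA b) rg (HA b).
pose Phi := block J.
have PL : linear Phi := block_lin JL.
have PP x : Phi (Phi x) = - x.
  by apply: block_ext => b; rewrite part_block JJ -scaleN1r partZ scaleN1r.
have PS x y : pairing (Phi x) y = - pairing x (Phi y).
  rewrite !pairing_part !part_block.
  have E b W U : Gm W (J b U) = - Gm (J b W) U by rewrite sG (JGl bG sG (JJ b) (JG b)) sG.
  by rewrite !E; ring.
have PSC x : Phi (S x) = S (Phi x).
  by apply: block_ext => b; rewrite part_S part_block part_S (JZ (JL b)).
have mG := part_sign_metric.
have [_ SL _ SS Sg] := mG.
have SV := part_sign_given_by.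
have PV b W : Phi (vl b W) = vl b (J b W).
  apply: block_ext => c; rewrite !part_vlift; case: eqP => [->//|_].
  by rewrite (J0 (JL c)).
have PJ b x : x = vl b x.1 -> (Phi x).1 = J b x.1 by move=> {1}->; rewrite PV.
have PJ' b x : eigen S b x -> (Phi x).1 = J b x.1 by move=> /part_sign_eigen /PJ.
have KE := kahler_equations rg fpsi SL SS Sg SV PL PS PP PSC HA JL JA PJ'.
have [gP gSP] : generalized_complex Phi /\ generalized_complex (S \o Phi).
  by apply/KE => b; split; [exact: IJ|case: (SA b)].
exists Phi; split.
  split; last first.
    by move=> b x /(cone_vlift_Vpm kappa rg fpsi) /PJ ->; exact: JC.
  split; last by exists part_metric, S; split.
  (* On each part the operator of weight 1 is the bracket with d/dt, which commutes with J b. *)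
  move=> x; apply: block_ext => b.
  by rewrite !part_lie_time part_block (cone_J_ddt (JL b) (JA b)).
(* Phi' comes with its own S', but [given_by] fixes the eigenbundles of S' and Phi' preserves them,
   so [corresponds] determines Phi' on V_b through J b. *)
move=> Phi' [[_ [G' [S' [mG' SV' [PSC' [PL' _ _ _] _]]]]] C'].
have PV' b W : Phi' (vl b W) = vl b (J b W).
  rewrite (Phi_cone_vlift rg fpsi SV' PL' PSC'); congr (vl b _).
  have CW : cone_image (A b) W (Phi' (vl b W)).1.
    by apply: (C' b (vl b W)); exact/(cone_vlift_Vpm kappa rg fpsi).
  by apply/vfieldP => f; apply: CinfNP => p t; rewrite CW JC.
apply/funext => x; rewrite [x]partE (tlinD PL) (tlinD PL') !PV !PV' //.
Qed.

End Backward.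

Theorem proposition5p2 (R : realType) (n : nat) (M : manifold R n)
    (gamma psi : vfield M -> vfield M -> Cinf M) (kappa : form1 M) :
  riemannian gamma -> form2 psi ->
  (forall (w : R) (Phi : tbig (cylinder M) -> tbig (cylinder M)),
     w = 0 \/ w = 1 ->
     generalized_sasakian w gamma psi kappa Phi ->
     exists! A : bool -> contact_triple M,
       sasakian_pair gamma psi kappa A /\ corresponds gamma psi kappa Phi A) /\
  (forall A : bool -> contact_triple M,
     sasakian_pair gamma psi kappa A ->
     exists! Phi : tbig (cylinder M) -> tbig (cylinder M),
       generalized_sasakian 1 gamma psi kappa Phi /\
       corresponds gamma psi kappa Phi A).
Proof.
move=> rg fpsi; split=> [w Phi w01 GS|A SA]; first exact: generalized_sasakian_pair w01 GS.
have [P PE] := choice (vlift2_exists kappa rg fpsi).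
exact: (contact_pair_generalized PE SA).
Qed.
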